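(* Let $S=\mathbb{C}^2$, $N,r>0$, $E=\bigoplus_{i=1}^N\mathcal{O}_S\langle y_i\rangle$ and $V=\bigoplus_{i=1}^r\mathcal{O}_S\langle v_i\rangle$. Let $A^{N,r}_{\mu,\nu,\xi}(q)$ be the universal series of the equivariant virtual Segre series on Quot schemes of a rank $N$ bundle with a rank $r$ insertion. Then $$A^{N,r}_{\mu,\nu,\xi}((-1)^Nq)=A^{r,N}_{\xi,\nu,\mu}((-1)^rq)$$ whenever one of $\mu,\nu,\xi$ is $(1)$ and the other two are $(0)$. In degree $0$, $$\mathcal{S}_{S,0}(E,V;(-1)^Nq)-\mathcal{S}_{S,0}(V,E;(-1)^rq)=\sum_{n=1}^\infty\frac{g_n}{(\lambda_1\lambda_2)^{n-2}}\cdot\left(\int_Sc_1(S)\right)^2\cdot q^n$$ for some terms $g_n\in H^{2n-2}_{\mathsf{T}}(\mathrm{pt})$.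
   Context: Setup. $\mathsf{T}=\mathsf{T}_0\times\mathsf{T}_1\times\mathsf{T}_2$, where $\mathsf{T}_0=(\mathbb{C}^* )^2$ (coordinates $t_1,t_2$) acts naturally on $S=\mathbb{C}^2$ with tangent weights $t_1,t_2$ at the origin, and $\mathsf{T}_1,\mathsf{T}_2$ are tori with coordinates $y_i$ and $v_i$ acting trivially on $S$. $\lambda_i,m_i,w_i$ are the equivariant first Chern classes of $t_i,y_i,v_i$; $H^*_{\mathsf{T}}(\mathrm{pt})=\mathbb{C}[\vec\lambda,\vec m,\vec w]$, and $H^d_{\mathsf{T}}(\mathrm{pt})$ denotes here homogeneous polynomials of degree $d$ (each variable having degree 1). $\mathcal{O}_S\langle\chi\rangle$ is the trivial line bundle with character $\chi$. For a class $\alpha=[\bigoplus_{i\le a}\mathcal{O}_S\langle v_i\rangle]-[\bigoplus_{a<i\le a+b}\mathcal{O}_S\langle v_i\rangle]$ of rank $r=a-b$ ($v_i$ generic): $c(\alpha)=\prod_{i\le a}(1+w_i)/\prod_{i>a}(1+w_i)$; $c(E)=\prod(1+m_i)$, $c(S)=(1+\lambda_1)(1+\lambda_2)$, $\int_S\gamma=\gamma/(\lambda_1\lambda_2)$; $c_\mu(\cdot)=\prod_ic_{\mu_i}(\cdot)$, equal to $1$ for the empty partition $(0)$. Invariants. The $\mathsf{T}$-fixed points $Z_\pi$ of $\operatorname{Quot}_S(E,n)$ (zero-dimensional length $n$ quotients of $E=\bigoplus_{i=1}^N\mathcal{O}_S\langle y_i\rangle$) are indexed by $N$-tuples of partitions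 $\pi=(\pi^{(1)},\dots,\pi^{(N)})$ of total size $|\pi|=n$. With boxes $\{(i,j)\in\mathbb{Z}_{\ge0}^2:j<\rho_{i+1}\}$ for a partition $\rho$ and $Q_k=\sum_{(i,j)\in\pi^{(k)}}t_1^{-j}t_2^{-i}$: $T^{\mathrm{vir}}_{Z_\pi}=\sum_{k,l}(Q_l-(1-t_1)(1-t_2)\overline{Q_k}Q_l)y_k^{-1}y_l$ (bar inverts $t_1,t_2$), $\alpha^{[n]}|_{Z_\pi}=\sum_k(\sum_{i\le a}v_i-\sum_{i>a}v_i)y_kQ_k$. For a virtual character $\gamma=\sum n_\chi\chi$: $e(\gamma)=\prod c_1(\chi)^{n_\chi}$, $s(\gamma)=\prod(1+c_1(\chi))^{-n_\chi}$. Set $\mathcal{S}_S(E,\alpha;q)=\sum_\pi q^{|\pi|}s(\alpha^{[n]}|_{Z_\pi})/e(T^{\mathrm{vir}}_{Z_\pi})$. $\mathcal{S}_S(V,E;q)$ is defined in the same way with the roles of $(N,y_i,m_i)$ and $(r,v_i,w_i)$ exchanged (quotients of $V$, insertion $E^{[n]}$). The subscript $0$ in $\mathcal{S}_{S,0}$ denotes the part of total degree $0$ in $(\vec\lambda,\vec m,\vec w)$: the coefficient of $b^0$ in the Laurent expansion in $b$ after scaling all these variables by $b$. Universal series. $A^{N,r}_{\mu,\nu,\xi}\in1+q\,\mathbb{C}[\![q]\!]$ are the series depending only on $N,r$ for which, for all classes $\alpha=[\bigoplus_{i\le a}\mathcal{O}_S\langle v_i\rangle]-[\bigoplus_{a<i\le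 a+b}\mathcal{O}_S\langle v_i\rangle]$ of rank $r=a-b$ and for $E=\bigoplus_{i=1}^N\mathcal{O}_S\langle y_i\rangle$ of rank $N$, $\mathcal{S}_S(E,\alpha;q)=\prod_{\mu,\nu,\xi}A^{N,r}_{\mu,\nu,\xi}(q)^{\int_Sc_\mu(\alpha)c_\nu(S)c_\xi(E)c_1(S)}$ (product over all triples of partitions, read degree by degree). Their existence is known. *)

(* Defs.v *)
From HB Require Import structures.
From mathcomp Require Import all_boot all_order all_algebra.
From mathcomp Require Import generic_quotient reals.
From mathcomp Require Export complex.
From mathcomp.multinomials Require Import freeg mpoly.

Set Implicit Arguments.
Unset Strict Implicit.
Unset Printing Implicit Defensive.

Import GRing.Theory.
Local Open Scope ring_scope.

Section Partitions.

Definition is_part (s : seq nat) : bool := sorted geq s && (0%N \notin s).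

(* The partitions of size at most n, each listed once (see mem_parts_le):
   they are obtained from n-tuples by deleting the zero entries. *)
Definition parts_le (n : nat) : seq (seq nat) :=
  undup [seq s <- [seq [seq x <- map val (tval t) | x != 0%N]
                  | t <- enum {: n.-tuple 'I_n.+1}]
        | sorted geq s && (sumn s <= n)%N].

Lemma mem_parts_le n s : (s \in parts_le n) = is_part s && (sumn s <= n)%N.
Proof.
rewrite mem_undup mem_filter /is_part.
case sorted_s: (sorted geq s) => //=; rewrite andbC.
have [le_s|] := leqP (sumn s) n; last by rewrite !andbF.
rewrite !andbT; apply/mapP/idP => [[t _ ->]|s0].
  by rewrite mem_filter eqxx.
have size_s : (size s <= n)%N.
  apply: leq_trans le_s; elim: s s0 {sorted_s} => //= x s IHs.
  rewrite inE negb_or eq_sym => /andP[x0 /IHs le_s].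
  by rewrite -addn1 addnC leq_add ?lt0n.
have bound_s : all (fun x => x < n.+1)%N s.
  apply/allP => x xs; rewrite ltnS (leq_trans _ le_s) //.
  elim: s xs {sorted_s s0 le_s size_s} => //= y s IHs.
  rewrite inE => /orP[/eqP->|/IHs le_s]; first exact: leq_addr.
  exact: leq_trans le_s (leq_addl _ _).
pose u := [seq inord x : 'I_n.+1 | x <- s] ++ nseq (n - size s) ord0.
have size_u : size u == n by rewrite size_cat size_map size_nseq subnKC.
exists (Tuple size_u); first by rewrite mem_enum.
rewrite /= map_cat filter_cat map_nseq -map_comp.
have -> : [seq x <- nseq (n - size s) (val (@ord0 n)) | x != 0%N] = [::].
  by elim: (n - size s)%N.
rewrite cats0 (@eq_in_map _ _ _ id s).1 ?map_id.
  by apply/esym/all_filterP/allP => x xs; apply: contraNneq s0 => <-.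
by move=> x xs /=; rewrite inordK // (allP bound_s).
Qed.

End Partitions.

(* Formal power series, as coefficient sequences. *)
Definition fps (R : Type) := nat -> R.

Section PowerSeries.
Variable K : fieldType.
Implicit Types (f g : fps K) (c : K).

Definition fps_one : fps K := fun n => (n == 0%N)%:R.
Definition fps_mul f g : fps K := fun n => \sum_(i < n.+1) f i * g (n - i)%N.
Definition fps_exp f (k : nat) : fps K := iter k (fps_mul f) fps_one.

(* f(c q) *)
Definition fps_scale c f : fps K := fun n => c ^+ n * f n.

Definition gbinom c (k : nat) : K :=
  (\prod_(i < k) (c - i%:R)) / (k`!)%:R.

(* f ^ c for f with constant term 1 (K of characteristic 0), by the binomial
   series \sum_k gbinom c k (f - 1)^k; the terms k > n do not contribute to the
   coefficient of q^n. *)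
Definition fps_pow f c : fps K := fun n =>
  \sum_(k < n.+1) gbinom c k * fps_exp (fun i => f i - fps_one i) k n.

End PowerSeries.

Section Degree.
Variables (C : fieldType) (n : nat).
Local Notation P := {mpoly C[n]}.
Local Notation K := {fraction P}.

Definition mpoly_ord (p : P) : nat :=
  find (fun d => pihomog mdeg d p != 0) (iota 0 (msize p)).

(* The part of degree d of a rational function: the coefficient of b^d in the
   Laurent expansion at b = 0 of f(b x_1, ..., b x_n).  If f = p / q and q has
   lowest-degree part q_o, of degree o, then
     f(b x) = b^(-o) (\sum_i (p_i / q_o) b^i) (\sum_i (q_(o+i) / q_o) b^i)^(-1),
   and the last series has constant term 1. *)
Definition degpart (d : int) (f : K) : K :=
  let p := \n_(repr f) in
  let q := \d_(repr f) in
  let o := mpoly_ord q in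
  let qo := tofrac (pihomog mdeg o q) in
  let num : fps K := fun i => tofrac (pihomog mdeg i p) / qo in
  let den : fps K := fun i => tofrac (pihomog mdeg (o + i)%N q) / qo in
  match d + o%:Z with
  | Posz m => fps_mul num (fps_pow den (-1)) m
  | Negz _ => 0
  end.

End Degree.

Section Characters.
Variables (C : fieldType) (n : nat).

(* Characters of (C^* )^n, written additively by their exponents; a virtual
   character is an element of the group ring Z[Z^n]. *)
Definition wt := 'rV[int]_n.
Definition vchar := {freeg wt / int}.

Definition vmul (g h : vchar) : vchar :=
  \sum_(x <- dom g) \sum_(y <- dom h) << coeff x g * coeff y h *g x + y >>.

(* Inverts every coordinate; it is only applied to Qchar below, in which only
   t_1 and t_2 occur. *)
Definition vdual (g : vchar) : vchar :=
  \sum_(x <- dom g) << coeff x g *g - x >>.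

Local Notation P := {mpoly C[n]}.
Local Notation K := {fraction P}.

Definition c1wt (x : wt) : P := \sum_i 'X_i *~ x 0 i.

(* The exponents are the multiplicities in the reduced virtual character; in
   particular cancelling trivial characters do not contribute to the Euler
   class. *)
Definition euler (g : vchar) : K :=
  \prod_(x <- dom g) tofrac (c1wt x) ^ coeff x g.
Definition segre_class (g : vchar) : K :=
  \prod_(x <- dom g) tofrac (1 + c1wt x) ^ (- coeff x g).
Definition chern_class (g : vchar) : K :=
  \prod_(x <- dom g) tofrac (1 + c1wt x) ^ coeff x g.

Definition chern (i : nat) (g : vchar) : K := degpart i%:Z (chern_class g).
Definition chern_part (mu : seq nat) (g : vchar) : K :=
  \prod_(i <- mu) chern i g.

End Characters.

(* The torus T = T_0 x T_1 x T_2 with T_1, T_2 of ranks p, q.  The variables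
   are ordered as lambda_1, lambda_2, m_1, ..., m_p, w_1, ..., w_q. *)
Section Quot.
Variables (C : fieldType) (p q : nat).
Local Notation n := (2 + p + q)%N.
Local Notation W := (wt n).
Local Notation X := (vchar n).
Local Notation K := {fraction {mpoly C[n]}}.

Definition t1 : W := delta_mx 0 (lshift q (lshift p (inord 0 : 'I_2))).
Definition t2 : W := delta_mx 0 (lshift q (lshift p (inord 1 : 'I_2))).
Definition y_ (i : 'I_p) : W := delta_mx 0 (lshift q (rshift 2 i)).
Definition v_ (j : 'I_q) : W := delta_mx 0 (rshift (2 + p) j).

Definition bundle (N : nat) (y : 'I_N -> W) : X := \sum_i << y i >>.

Definition tanS : X := << t1 >> + << t2 >>.
Definition l12 : K := tofrac (c1wt C t1 * c1wt C t2).
Definition int_S (g : K) : K := g / l12.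

Definition Qchar (rho : seq nat) : X :=
  \sum_(i < size rho) \sum_(j < nth 0%N rho i) << - (t1 *+ j) - t2 *+ i >>.

Section FixedPoint.
Variables (N : nat) (y : 'I_N -> W) (pi : 'I_N -> seq nat).

Definition Tvir : X :=
  \sum_(k < N) \sum_(l < N)
    vmul (Qchar (pi l)
          - vmul (vmul (<< 0 >> - << t1 >>) (<< 0 >> - << t2 >>))
                 (vmul (vdual (Qchar (pi k))) (Qchar (pi l))))
         << y l - y k >>.

Definition taut (alpha : X) : X :=
  \sum_(k < N) vmul alpha (vmul << y k >> (Qchar (pi k))).

End FixedPoint.

(* The equivariant virtual Segre series of Quot_S(E, -), E = \bigoplus_i O<y_i>,
   with insertion the tautological class of alpha. *)
Definition segre_series (N : nat) (y : 'I_N -> W) (alpha : X) : fps K :=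
  fun d =>
    \sum_(pi : {ffun 'I_N -> seq_sub (parts_le d)}
         | (\sum_k sumn (ssval (pi k)))%N == d)
      segre_class C (taut y (fun k => ssval (pi k)) alpha)
      / euler C (Tvir y (fun k => ssval (pi k))).

(* The product of the A_{mu,nu,xi} ^ \int_S c_mu(alpha) c_nu(S) c_xi(E) c_1(S)
   over the triples of partitions of total size at most D. *)
Definition univ_prod (A : seq nat -> seq nat -> seq nat -> fps C)
    (alpha E : X) (D : nat) : fps K :=
  \big[@fps_mul K / @fps_one K]_(mu <- parts_le D)
  \big[@fps_mul K / @fps_one K]_(nu <- parts_le D)
  \big[@fps_mul K / @fps_one K]_(xi <- parts_le D
                                | (sumn mu + sumn nu + sumn xi <= D)%N)
    fps_pow (fun i => tofrac (A mu nu xi i)%:MP)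
      (int_S (chern_part C mu alpha * chern_part C nu tanS
             * chern_part C xi E * chern C 1 tanS)).

End Quot.

Arguments t1 {p q}.
Arguments t2 {p q}.
Arguments y_ {p q} i.
Arguments v_ {p q} j.
Arguments tanS {p q}.
Arguments l12 {C p q}.
Arguments int_S {C p q} g.

(* \bigoplus_{i <= a} O<v_i> - \bigoplus_{a < i <= a+b} O<v_i> *)
Definition alpha_class (N a b : nat) : vchar (2 + N + (a + b)) :=
  bundle (fun i : 'I_a => v_ (lshift b i))
  - bundle (fun i : 'I_b => v_ (rshift a i)).

(* A is the family A^{N,r}.  The exponent indexed by (mu, nu, xi) is homogeneous
   of degree |mu| + |nu| + |xi| - 1, so the infinite product is read degree by
   degree: for each power of q, each homogeneous part of the truncated products
   is eventually that of the Segre series. *)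
Definition universal_series (C : fieldType) (N r : nat)
    (A : seq nat -> seq nat -> seq nat -> fps C) : Prop :=
  (forall mu nu xi, is_part mu -> is_part nu -> is_part xi ->
     A mu nu xi 0%N = 1) /\
  (forall a b : nat, a = (r + b)%N -> forall (n : nat) (d : int),
     exists D0 : nat, forall D : nat, (D0 <= D)%N ->
       degpart d (segre_series C y_ (alpha_class N a b) n) =
       degpart d (univ_prod A (alpha_class N a b) (bundle y_) D n)).

(* Main.v *)
Require Import Defs.
From HB Require Import structures.
From mathcomp Require Import all_boot all_order all_algebra fingroup perm.
From mathcomp Require Import generic_quotient reals complex.
From mathcomp.multinomials Require Import freeg mpoly.
From mathcomp Require boolp.
From mathcomp Require Import ring zify.

Set Implicit Arguments.
Unset Strict Implicit.
Unset Printing Implicit Defensive.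

(** The theorem is true because both series agree, up to the sign of q, on the
    line lambda_2 = - 2 lambda_1 of the plane of lambda_1 and lambda_2, where the
    surface behaves like a curve, and because the universal product formula lets one recover the leading universal
    series from their restrictions to this line.

    On that line t_1^2 t_2 = 1. In the virtual tangent space of a fixed point, the
    multiplicity of the weights that vanish there is negative as soon as one of
    the partitions is not a column (tansum_special), so that the point does not
    contribute. The columns are the fixed points of the Quot schemes of a curve of
    tangent weight tau = lambda_2; the rest of the obstruction theory is self-dual
    there and contributes a sign (colterm_vortex). The sum over the columns is a
    vortex partition function: it is attached to the choice of N among N + r
    flavours, and exchanging E and V passes to the complementary choice. It is
    invariant (vortex_sum_duality) for the following reason. Vortex sums are
    maximal minors of a matrix of solutions of a hypergeometric equation; the
    Wronskian is constant (det_hypmx_const), and by the residue theorem the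
    solutions for x and for - x are orthogonal (hyp_pairing), so complementary
    minors are proportional. The outcome is fpsum_symmetry.

    Off the line, put c = lambda_1 + lambda_2 and l = lambda_1 lambda_2. All
    exponents of the universal product are polynomials times c / l. Taking
    logarithmic derivatives, one finds that in any bounded range of degrees the
    coefficient of q^n is P_n / l^n with polynomials such that
      n P_n = \sum_(i < n) c L_(i+1) l^i P_(n-i-1),
    where the linear part of L_i is a_i c_1(V) + b_i c + e_i c_1(E) and a, b, e
    are the logarithmic derivatives of the three universal series in question
    (fpsum_numerators).

    Let P_n, P'_n be the numerators of the two series, the signs included. On the
    line P_n - P'_n vanishes in low degrees (specialized_numerators). By induction
    on n, the recursion shows that c l^(n-1) (L_n - L'_n) has no part of degree 2n
    on the line (numer_cancel). Since neither c nor l vanish there, the linear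
    parts of L_n and L'_n agree, which is the first claim (logder_symmetry). Then
    the terms of P_n - P'_n that are only once divisible by c cancel in degree 2n,
    so the part of degree 2n is c^2 g_n, which is the second claim
    (numer_middle). *)

Import Order.TTheory GRing.Theory Num.Theory.
Local Open Scope ring_scope.

Local Notation hc d p := (pihomog mdeg d p).
Local Notation "p %:F" := (tofrac p).

(** * Power series *)

HB.instance Definition _ (K : fieldType) := boolp.gen_eqMixin (fps K).
HB.instance Definition _ (K : fieldType) := boolp.gen_choiceMixin (fps K).

Section FpsRing.
Variable K : fieldType.
Implicit Types f g h : fps K.

Lemma fpsP f g : f =1 g <-> f = g.
Proof. by split=> [/boolp.funext|->]. Qed.

Definition fps_zero : fps K := fun=> 0.
Definition fps_opp f : fps K := fun n => - f n.
Definition fps_add f g : fps K := fun n => f n + g n.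

Fact fps_addA : associative fps_add.
Proof. by move=> f g h; apply/fpsP => n; apply: addrA. Qed.
Fact fps_addC : commutative fps_add.
Proof. by move=> f g; apply/fpsP => n; apply: addrC. Qed.
Fact fps_add0 : left_id fps_zero fps_add.
Proof. by move=> f; apply/fpsP => n; apply: add0r. Qed.
Fact fps_addN : left_inverse fps_zero fps_opp fps_add.
Proof. by move=> f; apply/fpsP => n; apply: addNr. Qed.

HB.instance Definition _ := GRing.isZmodule.Build (fps K)
  fps_addA fps_addC fps_add0 fps_addN.

(** A coefficient of a product only depends on truncations, hence may be computed
   with polynomials; this transports the ring axioms from {poly K}. *)
Definition fps_trunc (m : nat) f : {poly K} := \poly_(i < m) f i.

Lemma coef_fps_mul m f g n : (n < m)%N ->
  fps_mul f g n = (fps_trunc m f * fps_trunc m g)`_n.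
Proof.
move=> n_m; rewrite coefM; apply: eq_bigr => i _.
have i_n : (i <= n)%N by rewrite -ltnS.
by rewrite !coef_poly (leq_ltn_trans i_n n_m) (leq_ltn_trans (leq_subr _ _) n_m).
Qed.

Fact fps_mulA : associative (@fps_mul K).
Proof.
move=> f g h; apply/fpsP => n; rewrite !(@coef_fps_mul n.+1) //.
have coef_trunc f1 g1 i : (i < n.+1)%N ->
    (fps_trunc n.+1 (fps_mul f1 g1))`_i
      = (fps_trunc n.+1 f1 * fps_trunc n.+1 g1)`_i.
  by move=> i_n; rewrite coef_poly i_n; apply: coef_fps_mul.
transitivity (fps_trunc n.+1 f * (fps_trunc n.+1 g * fps_trunc n.+1 h))`_n.
  rewrite coefM [RHS]coefM; apply: eq_bigr => i _; congr (_ * _).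
  by rewrite coef_trunc // ltnS leq_subr.
rewrite mulrA coefM [RHS]coefM; apply: eq_bigr => i _; congr (_ * _).
by rewrite coef_trunc.
Qed.

Fact fps_mulC : commutative (@fps_mul K).
Proof.
by move=> f g; apply/fpsP => n; rewrite !(@coef_fps_mul n.+1) // mulrC.
Qed.

Fact fps_mul1 : left_id (@fps_one K) (@fps_mul K).
Proof.
move=> f; apply/fpsP => n; rewrite /fps_mul big_ord_recl /fps_one /= mul1r subn0.
by rewrite big1 ?addr0 // => i _; rewrite mul0r.
Qed.

Fact fps_mulDl : left_distributive (@fps_mul K) fps_add.
Proof.
move=> f g h; apply/fpsP => n; rewrite /fps_mul /fps_add -big_split /=.
by apply: eq_bigr => i _; rewrite mulrDl.
Qed.

Fact fps_one_neq0 : @fps_one K != fps_zero.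
Proof.
by apply/negP => /eqP/fpsP/(_ 0%N)/eqP; rewrite /fps_one /fps_zero eqxx oner_eq0.
Qed.

HB.instance Definition _ := GRing.Zmodule_isComNzRing.Build (fps K)
  fps_mulA fps_mulC fps_mul1 fps_mulDl fps_one_neq0.

Lemma coef_fpsD f g n : (f + g) n = f n + g n. Proof. by []. Qed.
Lemma coef_fpsN f n : (- f) n = - f n. Proof. by []. Qed.
Lemma coef_fps1 n : (1 : fps K) n = (n == 0%N)%:R. Proof. by []. Qed.
Lemma coef_fpsM f g n : (f * g) n = \sum_(i < n.+1) f i * g (n - i)%N.
Proof. by []. Qed.

Lemma coef_fps_sum (I : Type) (r : seq I) (P : pred I) (F : I -> fps K) n :
  (\sum_(i <- r | P i) F i) n = \sum_(i <- r | P i) F i n.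
Proof. by elim/big_rec2: _ => // i x f _ <-. Qed.

Definition fpsC (c : K) : fps K := fun n => if n is 0%N then c else 0.

Lemma coef_fpsCM c f n : (fpsC c * f) n = c * f n.
Proof.
rewrite coef_fpsM big_ord_recl /= subn0 big1 ?addr0 // => i _.
by rewrite mul0r.
Qed.

Lemma coef_fpsM0 f g : (f * g) 0%N = f 0%N * g 0%N.
Proof. by rewrite coef_fpsM big_ord1. Qed.

Fact fpsC_zmod_morphism : zmod_morphism fpsC.
Proof. by move=> c c'; apply/fpsP => -[|n] //=; rewrite coef_fpsD coef_fpsN /= subr0. Qed.

Fact fpsC_monoid_morphism : monoid_morphism fpsC.
Proof.
split=> [|c c']; apply/fpsP => -[|n] //=; rewrite coef_fpsCM //=.
by rewrite mulr0.
Qed.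

HB.instance Definition _ :=
  GRing.isZmodMorphism.Build K (fps K) fpsC fpsC_zmod_morphism.
HB.instance Definition _ :=
  GRing.isMonoidMorphism.Build K (fps K) fpsC fpsC_monoid_morphism.

Fact fps_scale_zmod_morphism c : zmod_morphism (fps_scale c).
Proof. by move=> f g; apply/fpsP => n; apply: mulrBr. Qed.

Fact fps_scale_monoid_morphism c : monoid_morphism (fps_scale c).
Proof.
split=> [|f g]; apply/fpsP => n.
  by rewrite /fps_scale coef_fps1; case: n => [|n]; rewrite ?mulr1 // mulr0.
rewrite /fps_scale !coef_fpsM mulr_sumr; apply: eq_bigr => i _.
have i_n : (i <= n)%N by rewrite -ltnS.
have -> : c ^+ n = c ^+ i * c ^+ (n - i) by rewrite -exprD subnKC.
by rewrite mulrACA.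
Qed.

HB.instance Definition _ c :=
  GRing.isZmodMorphism.Build (fps K) (fps K) (fps_scale c)
    (fps_scale_zmod_morphism c).
HB.instance Definition _ c :=
  GRing.isMonoidMorphism.Build (fps K) (fps K) (fps_scale c)
    (fps_scale_monoid_morphism c).

End FpsRing.

(** * Hypergeometric series and residues *)

Section Lagrange.
Variables (L : fieldType) (I : finType) (z : I -> L).
Hypothesis z_inj : injective z.

(** Lagrange interpolation, read in the coefficient of top degree: the residues
    of p(z) / \prod_i (z - z_i) add up to minus the residue at infinity. *)
Lemma sum_residues (p : {poly L}) : (size p <= #|I|)%N ->
  \sum_i p.[z i] / \prod_(j | j != i) (z i - z j) = p`_#|I|.-1.
Proof.
move=> size_p.
pose w i : {poly L} := \prod_(j | j != i) ('X - (z j)%:P).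
have size_w i : size (w i) = #|I|.
  rewrite /w -big_filter size_prod_XsubC -sum1_size big_filter sum1_card.
  by rewrite cardC1 prednK //; apply/card_gt0P; exists i.
have w_at i k : (w i).[z k] = if i == k then \prod_(j | j != i) (z i - z j) else 0.
  rewrite horner_prod; case: eqP => [<-|/eqP i_k].
    by apply: eq_bigr => j _; rewrite !hornerE.
  by rewrite (bigD1 k) 1?eq_sym //= !hornerE subrr mul0r.
have prod_neq0 i : \prod_(j | j != i) (z i - z j) != 0.
  by apply/prodf_neq0 => j; rewrite subr_eq0; apply: contra => /eqP/z_inj ->.
pose q := \sum_i (p.[z i] / \prod_(j | j != i) (z i - z j)) *: w i.
suff p_q : p = q.
  rewrite [in RHS]p_q coef_sum; apply: eq_bigr => i _; rewrite coefZ.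
  have -> : (w i)`_#|I|.-1 = 1.
    by rewrite -(size_w i) -lead_coefE (eqP (monic_prod_XsubC _ _ _)).
  by rewrite mulr1.
apply/eqP; rewrite -subr_eq0; apply/eqP.
apply: (@roots_geq_poly_eq0 _ _ [seq z i | i <- enum I]).
- apply/allP => _ /mapP[i _ ->]; rewrite rootE !hornerE horner_sum (bigD1 i) //=.
  rewrite hornerZ w_at eqxx mulfVK // big1 ?addr0 ?subrr // => j j_i.
  by rewrite hornerZ w_at (negPf j_i) mulr0.
- by rewrite map_inj_uniq ?enum_uniq.
rewrite size_map -cardE (leq_trans (size_polyD _ _)) // geq_max size_p size_polyN.
apply: leq_trans (size_sum _ _ _) _; apply/bigmax_leqP => i _.
by rewrite (leq_trans (size_scale_leq _ _)) ?size_w.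
Qed.
End Lagrange.

Section Flavours.
Variables (L : fieldType) (I : finType) (tau : L).
Implicit Types (x : I -> L) (f : I) (a b d i : nat).

(** The points x_f + i tau, which are the poles in hyp_pairing, are distinct. *)
Definition nonresonant x :=
  forall f g i j, x f + tau *+ i = x g + tau *+ j -> f = g /\ i = j.

Lemma nonresonantN x : nonresonant x -> nonresonant (fun f => - x f).
Proof.
move=> nr f g i j e; have [] // := nr f g j i.
apply/subr0_eq; transitivity (- ((- x f + tau *+ i) - (- x g + tau *+ j))).
  by ring.
by rewrite e subrr oppr0.
Qed.

Lemma prod_ord_neq (h : nat -> L) D (i : 'I_D.+1) :
  \prod_(j < D.+1 | j != i) h j
  = (\prod_(k < i) h (i - k.+1)%N) * \prod_(k < D - i) h (i + k.+1)%N.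
Proof.
have i_D : (i <= D)%N by rewrite -ltnS.
rewrite big_mkcond /=.
rewrite -(big_mkord xpredT (fun j => if j != i :> nat then h j else 1)) /=.
rewrite (@big_cat_nat _ _ _ i) ?(leqW i_D) //= [X in _ * X]big_ltn // eqxx mul1r.
congr (_ * _).
  rewrite big_nat_rev big_mkord add0n; apply: eq_bigr => k _ /=.
  by rewrite ifT //; have := ltn_ord k; lia.
rewrite -{1}[i.+1]add0n big_addn subSS big_mkord; apply: eq_bigr => k _.
by rewrite ifT ?addnS 1?addnC //; lia.
Qed.

Definition hypcoef x f d : L :=
  \prod_(i < d) \prod_g (x f - x g + tau *+ i.+1)^-1.

(** Up to the factor q^(x_f / tau), the series hyp x f 0 is the solution with
    exponent x_f of the hypergeometric equation \prod_g (theta - x_g) I = q I,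
    where theta = tau q d/dq, and hyp x f a is theta^a of that solution. *)
Definition hyp x f a : fps L := fun d => hypcoef x f d * (x f + tau *+ d) ^+ a.

Section Residues.
Variable x : I -> L.
Hypothesis nr_x : nonresonant x.

Let z D (u : I * 'I_D.+1) := x u.1 + tau *+ u.2.

Lemma z_inj D : injective (@z D).
Proof. by move=> [f i] [g j] /nr_x[/= -> /ord_inj->]. Qed.

(** The denominator of the residue at x_f + i tau in hyp_pairing: the poles
    with smaller index make up the coefficient for x, those with larger index
    the coefficient for - x. *)
Lemma prod_differences D f (i : 'I_D.+1) :
  \prod_(u : I * 'I_D.+1 | u != (f, i)) (z (f, i) - z u)
  = (hypcoef x f i * ((-1) ^+ (#|I| * (D - i))
       * hypcoef (fun g => - x g) f (D - i)%N)
     / \prod_(g | g != f) (x f - x g))^-1.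
Proof.
transitivity (\prod_g \prod_(j < D.+1 | (g, j) != (f, i)) (z (f, i) - z (g, j))).
  by rewrite pair_big_dep; apply: eq_big => -[g j].
transitivity (\prod_g ((if g == f then 1 else x f - x g)
   * \prod_(j < D.+1 | j != i) (z (f, i) - z (g, j)))).
  apply: eq_bigr => g _; case: eqP => [->|/eqP g_f].
    by rewrite mul1r; apply: eq_bigl => j; rewrite xpair_eqE eqxx.
  rewrite (bigD1 i) ?xpair_eqE ?(negPf g_f) //=; congr (_ * _).
    by rewrite /z /=; ring.
  by apply: eq_bigl => j; rewrite xpair_eqE (negPf g_f).
rewrite big_split /= !invfM invrK mulrC; congr (_ * _); last first.
  by rewrite [RHS]big_mkcond; apply: eq_bigr => g _; case: eqP.
under eq_bigr => g _.
  rewrite (prod_ord_neq (fun j => x f + tau *+ i - (x g + tau *+ j))). over.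
rewrite big_split /=; congr (_ * _).
  rewrite /hypcoef exchange_big -prodfV; apply: eq_bigr => g _.
  rewrite prodfV invrK; apply: eq_bigr => k _.
  rewrite mulrnBr ?ltn_ord //; by ring.
rewrite invr_sign /hypcoef exchange_big -prodfV.
have -> : (-1) ^+ (#|I| * (D - i)) = \prod_(k < D - i) \prod_(g : I) (-1) :> L.
  by rewrite !prodr_const cardT -cardE card_ord exprM.
rewrite -big_split; apply: eq_bigr => k _; rewrite prodfV invrK -big_split.
by apply: eq_bigr => g _ /=; ring.
Qed.

(** The coefficient of q^D is the sum of the residues of
    z^a (D tau - z)^b / \prod_(g, i <= D) (z - x_g - i tau), which has no pole
    at infinity unless a + b is large. *)
Lemma hyp_pairing a b D : (a + b + 2 <= #|I| * D.+1)%N ->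
  (\sum_f fpsC (\prod_(g | g != f) (x f - x g))^-1
     * (hyp x f a * fps_scale ((-1) ^+ #|I|) (hyp (fun g => - x g) f b))) D = 0.
Proof.
move=> le_ab.
pose p : {poly L} := 'X^a * ((tau *+ D)%:P - 'X) ^+ b.
have size_p : (size p <= (a + b).+1)%N.
  apply: leq_trans (size_polyMleq _ _) _; rewrite size_polyXn.
  have size_lin : (size ((tau *+ D)%:P - 'X : {poly L})).-1 = 1%N.
    by rewrite -opprB size_polyN size_XsubC.
  have := size_poly_exp_leq ((tau *+ D)%:P - 'X) b.
  by rewrite size_lin mul1n /=; lia.
have := @sum_residues L _ (@z D) (@z_inj D) p.
have size_lt : (size p <= (#|I| * D.+1).-1)%N.
  by apply: leq_trans size_p _; clear p; lia.
rewrite card_prod card_ord [p`__]nth_default //.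
move=> <-; last exact: leq_trans size_lt (leq_pred _).
rewrite coef_fps_sum -(pair_bigA _ (fun f (i : 'I_D.+1) => p.[z (f, i)]
  / \prod_(u : I * 'I_D.+1 | u != (f, i)) (z (f, i) - z u))) /=.
apply: eq_bigr => f _; rewrite coef_fpsCM coef_fpsM mulr_sumr.
apply: eq_bigr => i _; have i_D : (i <= D)%N by rewrite -ltnS.
rewrite prod_differences invrK /p !hornerE /hyp /fps_scale /z /= -exprM.
have -> : tau *+ D - (x f + tau *+ i) = - x f + tau *+ (D - i).
  by rewrite mulrnBr //; ring.
by ring.
Qed.
End Residues.

End Flavours.

(** * The Wronskian *)

Section JacobiFormula.
Variables (A : comNzRingType) (d : A -> A).
Hypothesis dD : {morph d : u v / u + v}.
Hypothesis dM : forall u v, d (u * v) = d u * v + u * d v.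

Let d0 : d 0 = 0.
Proof. by apply: (addrI (d 0)); rewrite -dD !addr0. Qed.

Let d1 : d 1 = 0.
Proof. by apply: (addrI (d 1)); rewrite addr0 -[in RHS](mulr1 1) dM mulr1 mul1r. Qed.

Let dN u : d (- u) = - d u.
Proof. by apply: (addrI (d u)); rewrite -dD !subrr d0. Qed.

Let d_sum (J : Type) (r : seq J) (F : J -> A) :
  d (\sum_(i <- r) F i) = \sum_(i <- r) d (F i).
Proof. exact: (big_morph d dD d0). Qed.

Let d_prod (J : finType) (F : J -> A) :
  d (\prod_i F i) = \sum_i d (F i) * \prod_(j | j != i) F j.
Proof.
suff gen (r : seq J) : uniq r ->
    d (\prod_(i <- r) F i) = \sum_(i <- r) d (F i) * \prod_(j <- r | j != i) F j.
  exact: gen (index_enum_uniq J).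
elim: r => [|i r IHr] /=; first by rewrite !big_nil d1.
case/andP=> i_r uniq_r; rewrite !big_cons eqxx dM IHr //; congr (_ + _).
  congr (_ * _); rewrite big_seq [RHS]big_seq_cond; apply: eq_bigl => j.
  by case: eqP => [->|]; rewrite ?(negPf i_r) ?andbT.
rewrite mulr_sumr [LHS]big_seq [RHS]big_seq; apply: eq_bigr => j j_r.
rewrite big_cons ifT; first by rewrite mulrCA.
by apply: contraNneq i_r => ->.
Qed.

Lemma derivation_det n (B : 'M[A]_n) :
  d (\det B) = \sum_i \sum_j d (B i j) * cofactor B i j.
Proof.
pose C (i : 'I_n) := \matrix_(k, j) (if k == i then d (B k j) else B k j).
transitivity (\sum_i \det (C i)).
  rewrite /determinant d_sum exchange_big; apply: eq_bigr => s _ /=.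
  have -> u : d ((-1) ^+ s * u) = (-1) ^+ s * d u.
    by rewrite !mulr_sign; case: (odd_perm s).
  rewrite d_prod mulr_sumr; apply: eq_bigr => i _; congr (_ * _).
  rewrite [RHS](bigD1 i) //= mxE eqxx; congr (_ * _).
  by apply: eq_bigr => k /negPf k_i; rewrite mxE k_i.
apply: eq_bigr => i _; rewrite (expand_det_row _ i); apply: eq_bigr => j _.
rewrite mxE eqxx; congr (_ * ((-1) ^+ _ * \det _)).
by apply/matrixP => k l; rewrite !mxE eq_sym (negPf (neq_lift _ _)).
Qed.
End JacobiFormula.

Section Wronskian.
Variables (L : fieldType) (tau : L).

Definition euler_op (f : fps L) : fps L := fun i => tau *+ i * f i.

Lemma euler_opD : {morph euler_op : f g / f + g}.
Proof. by move=> f g; apply/fpsP => i; apply: mulrDr. Qed.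

Lemma euler_opM (f g : fps L) : euler_op (f * g) = euler_op f * g + f * euler_op g.
Proof.
apply/fpsP => i; rewrite coef_fpsD !coef_fpsM -big_split /euler_op mulr_sumr.
apply: eq_bigr => j _ /=; rewrite mulrnBr -1?ltnS //; ring.
Qed.

Definition fpsX : fps L := fun i => (i == 1%N)%:R.

Lemma coef_fpsXM (f : fps L) i : (fpsX * f) i = if i is j.+1 then f j else 0.
Proof.
case: i => [|i]; first by rewrite coef_fpsM0 /fpsX mul0r.
rewrite coef_fpsM !big_ord_recl /= /fpsX mul0r add0r mul1r big1 ?addr0 //=.
  by rewrite subn1.
by move=> j _; rewrite mul0r.
Qed.

Variables (n : nat) (x : 'I_n -> L).
Hypotheses (n_gt1 : (1 < n)%N) (nr_x : nonresonant tau x).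

Definition hypmx : 'M[fps L]_n := \matrix_(a, f) hyp tau x f a.

Lemma euler_op_hyp f a :
  euler_op (hyp tau x f a) = hyp tau x f a.+1 - fpsC (x f) * hyp tau x f a.
Proof.
apply/fpsP => d; rewrite coef_fpsD coef_fpsN coef_fpsCM /euler_op /hyp exprS.
ring.
Qed.

(** The differential equation \prod_g (theta - x_g) I = q I. *)
Lemma hyp_recurrence f : let P := \prod_g ('X - (x g)%:P) in
  hyp tau x f n
  = (\sum_(b < n) fpsC (- P`_b) * hyp tau x f b) + fpsX * hyp tau x f 0%N.
Proof.
move=> P; apply/fpsP => d.
have size_P : size P = n.+1.
  by rewrite size_prod_XsubC -[RHS]/n.+1; congr _.+1; rewrite -[RHS]card_ord cardT enumT.
have P_n : P`_n = 1.
  by have /eqP := monic_prod_XsubC (index_enum 'I_n) xpredT x; rewrite lead_coefE -/P size_P.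
have := horner_coef P (x f + tau *+ d); rewrite size_P big_ord_recr /= P_n mul1r.
rewrite addrC => /eqP; rewrite -subr_eq => /eqP def_zn.
rewrite coef_fpsD coef_fps_sum coef_fpsXM {1}/hyp -def_zn mulrBr addrC.
congr (_ + _).
  rewrite mulr_sumr -sumrN; apply: eq_bigr => b _; rewrite coef_fpsCM /hyp; ring.
rewrite horner_prod; case: d {def_zn} => [|d].
  rewrite [X in _ * X](_ : _ = 0) ?mulr0 //; apply/eqP/prodf_eq0.
  by exists f; rewrite // hornerXsubC mulr0n addr0 subrr.
rewrite /hyp expr0 mulr1 /hypcoef big_ord_recr /= -mulrA -big_split.
rewrite [X in _ * X]big1 ?mulr1 // => g _ /=.
rewrite hornerXsubC [x f + _ - _]addrAC mulVf //.
apply/eqP => e; have [] // := nr_x (f := f) (g := g) (i := d.+1) (j := 0%N).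
by apply/eqP; rewrite mulr0n addr0 -subr_eq0 addrAC; apply/eqP.
Qed.

Lemma fpsC_sum (J : Type) (r : seq J) (F : J -> L) :
  fpsC (\sum_(j <- r) F j) = \sum_(j <- r) fpsC (F j).
Proof.
apply/fpsP => i; rewrite coef_fps_sum; case: i => [|i] //=.
by rewrite big1.
Qed.

(** Abel's identity. Differentiating row i of the Wronskian gives row i + 1
    minus its columns scaled by the x_f. Only the last row has a successor
    outside the matrix; by the differential equation its component along the
    last row is \sum_f x_f, which cancels the contribution of the scalings. *)
Lemma euler_op_det_hypmx : euler_op (\det hypmx) = 0.
Proof.
have last_lt : (n.-1 < n)%N by lia.
pose last_ := Ordinal last_lt; pose first_ := Ordinal (ltnW n_gt1).
have adjE (i k : 'I_n) : \sum_j hyp tau x j k * cofactor hypmx i j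
    = if k == i then \det hypmx else 0.
  have /matrixP/(_ k i) := mul_mx_adj hypmx; rewrite !mxE mulrb => <-.
  by apply: eq_bigr => j _; rewrite !mxE.
rewrite (derivation_det euler_opD euler_opM).
transitivity (\sum_(i < n) \sum_(j < n) (hyp tau x j i.+1 * cofactor hypmx i j
   - fpsC (x j) * (hypmx i j * cofactor hypmx i j))).
  apply: eq_bigr => i _; apply: eq_bigr => j _.
  by rewrite mxE euler_op_hyp mulrBl -!mulrA.
under eq_bigr do rewrite sumrB; rewrite sumrB [X in _ - X]exchange_big /=.
have -> : \sum_j \sum_i fpsC (x j) * (hypmx i j * cofactor hypmx i j)
    = fpsC (\sum_j x j) * \det hypmx.
  rewrite fpsC_sum mulr_suml; apply: eq_bigr => j _.
  by rewrite -mulr_sumr -(expand_det_col hypmx j).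
apply/eqP; rewrite subr_eq0; apply/eqP.
rewrite (bigD1 last_) //= [X in _ + X]big1 ?addr0; last first.
  move=> i i_last; have i1_n : (i.+1 < n)%N.
    by have := ltn_ord i; have : (i : nat) != n.-1 by []; lia.
  by have := adjE i (Ordinal i1_n); rewrite -val_eqE /= gtn_eqF.
have last_S : n.-1.+1 = n by lia.
rewrite /= last_S.
under eq_bigr do rewrite hyp_recurrence // mulrDl.
rewrite big_split /= [X in _ + X](_ : _ = 0); last first.
  under eq_bigr do rewrite -mulrA; rewrite -mulr_sumr.
  have := adjE last_ first_; rewrite -val_eqE /= ltn_eqF; last by lia.
  by move=> ->; rewrite mulr0.
under eq_bigr do rewrite mulr_suml.
rewrite addr0 exchange_big (bigD1 last_) //= [X in _ + X]big1 ?addr0.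
  under eq_bigr do rewrite -mulrA; rewrite -mulr_sumr.
  rewrite (adjE last_ last_) eqxx; congr (fpsC _ * _).
  have := @coefPn_prod_XsubC L [seq x g | g <- index_enum 'I_n].
  rewrite size_map !big_map.
  have -> : size (index_enum 'I_n) = n by rewrite -[RHS]card_ord cardT enumT.
  by move=> ->; rewrite ?opprK // -lt0n ltnW.
move=> i /negPf i_last; under eq_bigr do rewrite -mulrA; rewrite -mulr_sumr.
by rewrite (adjE last_ i) i_last mulr0.
Qed.

Lemma det_hypmx_const d : (0 < d)%N -> (\det hypmx) d = 0.
Proof.
move=> d_gt0; have /fpsP/(_ d)/eqP := euler_op_det_hypmx.
rewrite mulf_eq0 => /orP[|/eqP //] /eqP tau_d.
have [] // := nr_x (f := Ordinal (ltnW n_gt1)) (g := Ordinal (ltnW n_gt1)) (i := d) (j := 0%N).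
  by rewrite tau_d.
by move=> _ d0; rewrite d0 in d_gt0.
Qed.
End Wronskian.

(** * Duality of vortex sums *)

Section Vortex.
Variables (L : fieldType) (tau : L).

Definition vand n (u : 'I_n -> L) : L :=
  \prod_(k < n) \prod_(l < n | (k < l)%N) (u l - u k).

Lemma det_vand n (u : 'I_n -> L) : \det (\matrix_(k, a < n) u k ^+ a) = vand u.
Proof.
transitivity (\det (Vandermonde n (\row_k u k))).
  by rewrite -det_tr; congr (\det _); apply/matrixP => a k; rewrite !mxE.
rewrite det_Vandermonde; apply: eq_bigr => k _; apply: eq_bigr => l _.
by rewrite !mxE.
Qed.

Lemma vand_neq0 n (u : 'I_n -> L) : injective u -> vand u != 0.
Proof.
move=> u_inj; apply/prodf_neq0 => k _; apply/prodf_neq0 => l k_l.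
by rewrite subr_eq0; apply: contraTneq k_l => /u_inj ->; rewrite ltnn.
Qed.

Lemma coef_fps_prod n (F : 'I_n -> fps L) D :
  (\prod_k F k) D = \sum_(d : {ffun 'I_n -> 'I_D.+1} | (\sum_k d k)%N == D)
                      \prod_k F k (d k).
Proof.
have -> : (\prod_k F k) D = (\prod_k fps_trunc D.+1 (F k))`_D.
  suff gen (r : seq 'I_n) i : (i <= D)%N ->
      (\prod_(k <- r) F k) i = (\prod_(k <- r) fps_trunc D.+1 (F k))`_i by exact: gen.
  elim: r i => [|k r IHr] i i_D; first by rewrite !big_nil coef_fps1 coef1.
  rewrite !big_cons coef_fpsM coefM; apply: eq_bigr => j _.
  rewrite IHr ?(leq_trans (leq_subr _ _)) // coef_poly ltnS.
  by rewrite (leq_trans _ i_D) // -ltnS.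
under eq_bigr do rewrite /fps_trunc poly_def.
rewrite bigA_distr_bigA coef_sum [RHS]big_mkcond; apply: eq_bigr => d _ /=.
have -> : \prod_k (F k (d k) *: 'X^(d k)) = (\prod_k F k (d k)) *: 'X^(\sum_k d k)%N.
  rewrite scaler_prod; congr (_ *: _).
  by elim/big_rec2: _ => [|k i p _ ->]; rewrite ?expr0 // exprD.
by rewrite coefZ coefXn eq_sym; case: eqP; rewrite ?mulr1 ?mulr0.
Qed.

(** The vortex partition function at the fixed point S of a Grassmannian, where
    d k counts the vortices in the flavour S k. *)
Definition vortex_sum (I : finType) (x : I -> L) n (S : 'I_n -> I) : fps L :=
  fun D => \sum_(d : {ffun 'I_n -> 'I_D.+1} | (\sum_k d k)%N == D)
    (\prod_k hypcoef tau x (S k) (d k))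
    * (vand (fun k => x (S k) + tau *+ d k) / vand (x \o S)).

Definition hypminor (I : finType) (x : I -> L) n (S : 'I_n -> I) : fps L :=
  \det (\matrix_(k, a < n) hyp tau x (S k) a).

(** The entry of hyp at q^d is a power of x + d tau, so that the expanded minor
    is a sum of Vandermonde determinants. *)
Lemma coef_hypminor (I : finType) (x : I -> L) n (S : 'I_n -> I) D :
  hypminor x S D = \sum_(d : {ffun 'I_n -> 'I_D.+1} | (\sum_k d k)%N == D)
    (\prod_k hypcoef tau x (S k) (d k)) * vand (fun k => x (S k) + tau *+ d k).
Proof.
rewrite /hypminor /determinant coef_fps_sum.
transitivity (\sum_(s : 'S_n) \sum_(d : {ffun 'I_n -> 'I_D.+1} | (\sum_k d k)%N == D)
  (-1) ^+ s * \prod_k hyp tau x (S k) (s k) (d k)).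
  apply: eq_bigr => s _.
  have -> f : ((-1) ^+ s * f : fps L) D = (-1) ^+ s * f D.
    by rewrite !mulr_sign; case: (odd_perm s).
  rewrite coef_fps_prod mulr_sumr; apply: eq_bigr => d _; congr (_ * _).
  by apply: eq_bigr => k _; rewrite mxE.
rewrite exchange_big; apply: eq_bigr => d _ /=.
rewrite -det_vand /determinant mulr_sumr; apply: eq_bigr => s _.
rewrite mulrCA -big_split; congr (_ * _); apply: eq_bigr => k _ /=.
by rewrite mxE.
Qed.

Lemma coef_hypminor0 (I : finType) (x : I -> L) n (S : 'I_n -> I) :
  hypminor x S 0 = vand (x \o S).
Proof.
rewrite coef_hypminor (bigD1 [ffun => ord0]) /=; last first.
  by rewrite big1 // => k _; rewrite ffunE.
rewrite [X in _ + X]big1 ?addr0 => [|d]; last first.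
  case/andP=> _ /eqP[]; apply/ffunP => k; rewrite ffunE; exact: ord1.
rewrite big1 ?mul1r => [|k _]; last by rewrite ffunE /hypcoef big_ord0.
apply: eq_bigr => k _; apply: eq_bigr => l _.
by rewrite !ffunE !mulr0n !addr0.
Qed.

Lemma coef_vortex_sum (I : finType) (x : I -> L) n (S : 'I_n -> I) D :
  vortex_sum x S D = hypminor x S D / vand (x \o S).
Proof.
rewrite coef_hypminor mulr_suml; apply: eq_bigr => d _.
by rewrite mulrA.
Qed.

End Vortex.

Section Duality.
Variables (L : fieldType) (tau : L) (N r : nat) (x : 'I_(N + r) -> L).
Hypotheses (N_gt0 : (0 < N)%N) (r_gt0 : (0 < r)%N) (nr_x : nonresonant tau x).

Let sgn : L := (-1) ^+ (N + r).
Let nx f := - x f.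
Let M := hypmx tau x.
Let delta f : L := (\prod_(g | g != f) (x f - x g))^-1.
Let B : 'M[fps L]_(N + r, r) :=
  \matrix_(f, b) (fpsC (delta f) * fps_scale sgn (hyp tau nx f b)).

Let nr_inj : injective x.
Proof. by move=> f g e; have [] // := nr_x (f := f) (g := g) (i := 0%N) (j := 0%N); rewrite e. Qed.

Let delta_neq0 f : delta f != 0.
Proof.
rewrite invr_eq0; apply/prodf_neq0 => g; rewrite subr_eq0.
by apply: contra => /eqP/nr_inj ->.
Qed.

Let coef_MB (a : 'I_(N + r)) (b : 'I_r) D : (a + b + 2 <= (N + r) * D.+1)%N -> (M *m B) a b D = 0.
Proof.
move=> le_ab; have := @hyp_pairing _ _ _ _ nr_x a b D; rewrite card_ord => <- //.
rewrite mxE !coef_fps_sum; apply: eq_bigr => f _; congr (_ D).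
by rewrite !mxE mulrCA.
Qed.

Let usubMB : usubmx (M *m B) = 0.
Proof.
apply/matrixP => a b; rewrite mxE [RHS]mxE; apply/fpsP => D.
rewrite coef_MB //=.
by have := ltn_ord a; have := ltn_ord b; have : (N + r <= (N + r) * D.+1)%N; [nia | lia].
Qed.

Let dsubMB : exists C, dsubmx (M *m B) = map_mx (@fpsC L) C.
Proof.
exists (\matrix_(a, b) (M *m B) (rshift N a) b 0%N).
apply/matrixP => a b; rewrite mxE [RHS]mxE mxE; apply/fpsP => -[|D] //.
rewrite coef_MB //=.
by have := ltn_ord a; have := ltn_ord b; have : ((N + r) * 2 <= (N + r) * D.+2)%N; [nia | lia].
Qed.

(** By hyp_pairing, M B vanishes in its first N rows and is constant in the
    others. Evaluating the determinant of M (1 | B) in two ways, with det M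
    constant, relates a minor of M to the complementary minor of B. *)
Lemma hypminor_duality : exists h k, k != 0 /\
  forall D, hypminor tau x (@lshift N r) D * h
            = k * (sgn ^+ D * hypminor tau nx (@rshift N r) D).
Proof.
have [C dsubMBE] := dsubMB.
pose Y : 'M[fps L]_(N + r) := row_mx (col_mx 1%:M 0) B.
have det_Y : \det Y = \det (dsubmx B).
  have -> : Y = block_mx 1%:M (usubmx B) 0 (dsubmx B).
    by rewrite block_mxEh vsubmxK.
  by rewrite det_ublock det1 mul1r.
have det_MY : \det (M *m Y) = \det (ulsubmx M) * fpsC (\det C).
  have -> : M *m Y = block_mx (ulsubmx M) 0 (dlsubmx M) (map_mx (@fpsC L) C).
    rewrite mul_mx_row block_mxEh; congr row_mx; last first.
      by rewrite -usubMB -dsubMBE vsubmxK.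
    by rewrite -[M in LHS]submxK mul_block_col !mulmx1 !mulmx0 !addr0.
  by rewrite det_lblock det_map_mx.
have det_M : \det M = fpsC ((\det M) 0%N).
  apply/fpsP => -[|D] //; apply: det_hypmx_const => //; lia.
have det_ulM : \det (ulsubmx M) = hypminor tau x (@lshift N r).
  rewrite -det_tr; congr (\det _); apply/matrixP => k a; rewrite !mxE.
  by congr hyp.
have det_dB : \det (dsubmx B) = fpsC (\prod_(j < r) delta (rshift N j))
    * fps_scale sgn (hypminor tau nx (@rshift N r)).
  have -> : dsubmx B = diag_mx (\row_j fpsC (delta (rshift N j)))
      *m map_mx (fps_scale sgn) (\matrix_(j, b < r) hyp tau nx (rshift N j) b).
    by apply/matrixP => j b; rewrite mul_diag_mx !mxE.
  rewrite det_mulmx det_diag det_map_mx rmorph_prod.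
  by congr (_ * _); apply: eq_bigr => j _; rewrite mxE.
exists (\det C), ((\det M) 0%N * \prod_(j < r) delta (rshift N j)); split.
  apply: mulf_neq0; last by apply/prodf_neq0.
  have -> : (\det M) 0%N = vand (x \o id).
    rewrite -(coef_hypminor0 tau) -det_tr; congr ((\det _ : fps L) _).
    by apply/matrixP => k a; rewrite !mxE.
  exact: vand_neq0.
move: det_MY; rewrite det_mulmx det_Y det_ulM det_M det_dB mulrA -rmorphM.
by move=> /fpsP dualE D; have := dualE D; rewrite [hypminor _ _ _ * _]mulrC !coef_fpsCM => ->; rewrite mulrC.
Qed.

(** Normalized to 1 at q = 0, complementary minors agree. Geometrically this is
    the isomorphism of the Grassmannians Gr(N, N + r) and Gr(r, N + r). *)
Lemma vortex_sum_duality D :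
  vortex_sum tau x (@lshift N r) D = sgn ^+ D * vortex_sum tau nx (@rshift N r) D.
Proof.
have [h [k [k_neq0 minorE]]] := hypminor_duality.
have vand_l : vand (x \o @lshift N r) != 0.
  by apply: vand_neq0 => i j /nr_inj /lshift_inj.
have vand_r : vand (nx \o @rshift N r) != 0.
  by apply: vand_neq0 => i j /oppr_inj /nr_inj /rshift_inj.
have := minorE 0%N; rewrite !coef_hypminor0 expr0 mul1r => minor0.
rewrite !coef_vortex_sum mulrA; apply/eqP; rewrite eqr_div //; apply/eqP.
apply: (mulIf k_neq0); rewrite -mulrA [_ * k]mulrC -minor0 mulrCA minorE.
by ring.
Qed.
End Duality.

(** * Powers and logarithmic derivatives *)

Section FpsPow.
Variable K : fieldType.
Implicit Types (f g h u : fps K) (c : K).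

Lemma fps_expE f k : fps_exp f k = f ^+ k.
Proof. by elim: k => // k IHk; rewrite exprS -IHk. Qed.

Lemma coef_fpsM_low f g h n : (forall i, (i <= n)%N -> f i = g i) ->
  (f * h) n = (g * h) n.
Proof.
by move=> fg; rewrite !coef_fpsM; apply: eq_bigr => i _; rewrite fg // -ltnS.
Qed.

Definition fps_ord_ge m f := forall i, (i < m)%N -> f i = 0.

Lemma fps_ord_geM m k f g :
  fps_ord_ge m f -> fps_ord_ge k g -> fps_ord_ge (m + k) (f * g).
Proof.
move=> fm gk i i_mk; rewrite coef_fpsM big1 // => j _.
have [/fm ->|m_j] := ltnP j m; first by rewrite mul0r.
by rewrite gk ?mulr0 //; have := ltn_ord j; lia.
Qed.

Lemma fps_ord_geX f k : f 0%N = 0 -> fps_ord_ge k (f ^+ k).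
Proof.
move=> f0; elim: k => [|k IHk]; first by move=> i.
by rewrite exprS -add1n; apply: fps_ord_geM => // -[|i].
Qed.

Definition binom_sum c u m : fps K := \sum_(k < m) fpsC (gbinom c k) * u ^+ k.

Lemma fps_powE f c n m : f 0%N = 1 -> (n < m)%N ->
  fps_pow f c n = binom_sum c (f - 1) m n.
Proof.
move=> f0 n_m; rewrite /fps_pow /binom_sum coef_fps_sum.
rewrite (big_ord_widen m (fun k => gbinom c k
  * fps_exp (fun i => f i - fps_one K i) k n)) // big_mkcond /=.
apply: eq_bigr => k _; rewrite coef_fpsCM fps_expE; case: ifP => // /negbT.
rewrite -leqNgt => n_k; rewrite fps_ord_geX ?mulr0 //.
by rewrite coef_fpsD coef_fpsN coef_fps1 f0 subrr.
Qed.

Lemma fps_pow0 f c : f 0%N = 1 -> fps_pow f c 0%N = 1.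
Proof.
move=> f0; rewrite /fps_pow big_ord1 /gbinom big_ord0 divr1 mul1r.
by rewrite fps_expE expr0.
Qed.

Hypothesis K_char0 : forall k, k.+1%:R != 0 :> K.

Lemma gbinomS c k : k.+1%:R * gbinom c k.+1 = (c - k%:R) * gbinom c k.
Proof.
rewrite /gbinom big_ord_recr /= factS natrM.
have := K_char0 k; move: k.+1%:R => t t_neq0; rewrite invfM.
set P := \prod_(i < k) _; transitivity (t / t * ((c - k%:R) * (P / (k`!)%:R))).
  by ring.
by rewrite divff ?mul1r.
Qed.

Lemma gbinomN1 k : gbinom (-1) k = (-1) ^+ k :> K.
Proof.
elim: k => [|k IHk]; first by rewrite /gbinom big_ord0 divr1.
apply: (mulfI (K_char0 k)); rewrite gbinomS IHk exprS -addn1 natrD; ring.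
Qed.

Lemma fps_pow_inv f : f 0%N = 1 -> fps_pow f (-1) * f = 1.
Proof.
move=> f0; apply/fpsP => n.
rewrite (@coef_fpsM_low _ (binom_sum (-1) (f - 1) n.+1)); last first.
  by move=> i i_n; rewrite (@fps_powE _ _ _ n.+1).
have -> : binom_sum (-1) (f - 1) n.+1 * f = 1 - (- (f - 1)) ^+ n.+1.
  elim: n.+1 => [|m IHm]; first by rewrite /binom_sum big_ord0 mul0r subrr.
  rewrite /binom_sum big_ord_recr mulrDl IHm gbinomN1 /=.
  by rewrite rmorphXn rmorphN rmorph1 -exprNn [_ ^+ m.+1]exprS; ring.
rewrite coef_fpsD coef_fpsN (@fps_ord_geX _ n.+1) ?subr0 //.
by rewrite coef_fpsN coef_fpsD coef_fpsN coef_fps1 f0 subrr oppr0.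
Qed.

Local Notation theta := (euler_op (1 : K)).

Lemma euler_opX u m : theta (u ^+ m.+1) = m.+1%:R * u ^+ m * theta u.
Proof.
elim: m => [|m IHm]; first by rewrite expr1 expr0 !mul1r.
by rewrite exprS euler_opM IHm -(natr1 m.+1) [u ^+ m.+1]exprS; ring.
Qed.

Lemma euler_opCM c f : theta (fpsC c * f) = fpsC c * theta f.
Proof.
apply/fpsP => n; rewrite /euler_op !coef_fpsCM; ring.
Qed.

(** The recurrence of the binomial coefficients makes a partial sum of (1 + u)^c
    satisfy the differential equation of the power up to one term of top order
    in u. *)
Lemma euler_op_binom_sum c u m :
  theta (binom_sum c u m.+1) * (1 + u)
  = theta u * (fpsC c * binom_sum c u m.+1
               - fpsC (m.+1%:R * gbinom c m.+1) * u ^+ m).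
Proof.
elim: m => [|m IHm].
  rewrite /binom_sum big_ord1 expr0 !mulr1 gbinomS.
  have -> : gbinom c 0 = 1 by rewrite /gbinom big_ord0 divr1.
  rewrite subr0 mulr1 rmorph1 mulr1 subrr mulr0.
  suff -> : theta 1 = 0 by rewrite mul0r.
  by apply/fpsP => -[|i]; rewrite /euler_op coef_fps1 ?mulr0n ?mul0r ?mulr0.
rewrite /binom_sum big_ord_recr -/(binom_sum c u m.+1) euler_opD mulrDl IHm /=.
rewrite euler_opCM euler_opX (gbinomS c m.+1) !rmorphM rmorphB !rmorph_nat /= exprS; ring.
Qed.

Definition logder f l := theta f = l * f.

Lemma logder1 : logder 1 0.
Proof.
rewrite /logder mul0r.
by apply/fpsP => -[|i]; rewrite /euler_op coef_fps1 ?mulr0n ?mul0r ?mulr0.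
Qed.

Lemma logderM f g l k : logder f l -> logder g k -> logder (f * g) (l + k).
Proof. by rewrite /logder euler_opM => -> ->; ring. Qed.

(** The error terms of the partial binomial sums have arbitrarily high order. *)
Lemma logder_pow f l c : f 0%N = 1 -> logder f l -> logder (fps_pow f c) (fpsC c * l).
Proof.
move=> f0 fl.
suff eq_f : theta (fps_pow f c) * f = fpsC c * l * fps_pow f c * f.
  rewrite /logder -[LHS]mulr1 -[RHS]mulr1 -(fps_pow_inv f0) [_ * f]mulrC !mulrA.
  by rewrite eq_f.
apply/fpsP => n.
rewrite (@coef_fpsM_low _ (theta (binom_sum c (f - 1) n.+1))); last first.
  by move=> i i_n; rewrite /euler_op (@fps_powE _ _ _ n.+1).
have theta_u : theta (f - 1) = theta f.
  apply/fpsP => -[|i]; rewrite /euler_op ?mul0r // coef_fpsD coef_fpsN coef_fps1.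
  by rewrite subr0.
have -> : theta (binom_sum c (f - 1) n.+1) * f = theta (binom_sum c (f - 1) n.+1) * (1 + (f - 1)).
  by rewrite [1 + _]addrC subrK.
rewrite euler_op_binom_sum mulrBr coef_fpsD coef_fpsN [X in _ - X](_ : _ = 0) ?subr0.
  rewrite theta_u fl !mulrA [in LHS]mulrC [RHS](_ : _ = (fps_pow f c * (fpsC c * l * f)) n); last first.
    by congr ((_ : fps K) n); ring.
  rewrite [RHS](@coef_fpsM_low _ (binom_sum c (f - 1) n.+1)).
    by congr ((_ : fps K) n); ring.
  by move=> i i_n; rewrite (@fps_powE _ _ _ n.+1).
rewrite mulrCA coef_fpsCM (@fps_ord_geM 1 n) ?mulr0 //.
  by case=> // _; rewrite /euler_op mul0r.
by apply: fps_ord_geX; rewrite coef_fpsD coef_fpsN coef_fps1 f0 subrr.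
Qed.

End FpsPow.

(** * Homogeneous parts of rational functions *)

Section Components.
Variables (C : fieldType) (n : nat).
Local Notation P := {mpoly C[n]}.
Implicit Types p q : P.

Lemma mpolyX_neq0 (i : 'I_n) : 'X_i != 0 :> P.
Proof.
apply/eqP => /(congr1 (mcoeff U_(i))); rewrite mcoeffX eqxx mcoeff0 => /eqP.
by rewrite oner_eq0.
Qed.

Lemma mpolyX_dhomog (i : 'I_n) : ('X_i : P) \is 1.-homog.
Proof. by rewrite dhomogX; apply/eqP; apply: mdeg1. Qed.

Lemma mpolyXX_dhomog (i j : 'I_n) : ('X_i * 'X_j : P) \is 2.-homog.
Proof. exact: dhomogM (mpolyX_dhomog i) (mpolyX_dhomog j). Qed.

Lemma hc_msize d p : (msize p <= d)%N -> hc d p = 0.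
Proof.
move=> p_d; rewrite pihomogE big_seq_cond big1 // => m /andP[m_p /eqP m_d].
by have := msize_mdeg_lt m_p; rewrite m_d ltnNge p_d.
Qed.

Lemma hc_dhomog d e p : p \is d.-homog -> hc e p = if d == e then p else 0.
Proof. by move=> p_d; case: eqP => [<-|/eqP d_e]; [apply: pihomog_dE | apply: pihomog_ne0 p_d]. Qed.

Lemma hc_partition k p : (msize p <= k)%N -> p = \sum_(i < k) hc i p.
Proof. exact: pihomog_partitionE. Qed.

Lemma hcM e p q : hc e (p * q) = \sum_(i < e.+1) hc i p * hc (e - i) q.
Proof.
pose k := maxn e.+1 (maxn (msize p) (msize q)).
have [p_k q_k] : (msize p <= k)%N /\ (msize q <= k)%N by rewrite /k; lia.
rewrite {1}(hc_partition p_k) {1}(hc_partition q_k) mulr_suml linear_sum /=.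
transitivity (\sum_(i < k) if (i < e.+1)%N then hc i p * hc (e - i) q else 0).
  apply: eq_bigr => i _; rewrite mulr_sumr linear_sum /=.
  under eq_bigr => j _ do rewrite (hc_dhomog e (dhomogM (pihomogP mdeg i p) (pihomogP mdeg j q))).
  rewrite -big_mkcond /=; case: ltnP => i_e; last first.
    by rewrite big_pred0 // => j; apply/eqP; lia.
  have e_k : (e - i < k)%N by rewrite /k; lia.
  rewrite (big_pred1 (Ordinal e_k)) // => j.
  by apply/eqP/eqP => [i_j|-> /=]; [apply/val_inj => /=; lia | lia].
rewrite -big_mkcond /= (big_ord_widen_cond k xpredT (fun i => hc i p * hc (e - i) q)) //.
by rewrite /k leq_maxl.
Qed.

Lemma hcM_dhomog d e p q : p \is d.-homog ->
  hc e (p * q) = if (d <= e)%N then p * hc (e - d) q else 0.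
Proof.
move=> p_d; rewrite hcM; case: leqP => d_e.
  have d_e1 : (d < e.+1)%N by [].
  rewrite (bigD1 (Ordinal d_e1)) //= (hc_dhomog _ p_d) eqxx big1 ?addr0 // => i i_d.
  by rewrite (hc_dhomog _ p_d) eq_sym; move: i_d; rewrite -val_eqE /= => /negPf->; rewrite mul0r.
rewrite big1 // => i _; rewrite (hc_dhomog _ p_d) ifF ?mul0r //.
by apply/eqP; have := ltn_ord i; lia.
Qed.

Lemma hc_neq0 p : p != 0 -> exists2 o, hc o p != 0 & forall i, (i < o)%N -> hc i p = 0.
Proof.
move=> p_neq0; have [i i_p] : exists i, hc i p != 0.
  case: (boolP [exists i : 'I_(msize p), hc i p != 0]) => [/existsP[i i_p]|hc0].
    by exists i.
  case/eqP: p_neq0; rewrite [LHS](hc_partition (leqnn _)) big1 // => i _.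
  by apply/eqP; apply: contraR hc0 => i_p; apply/existsP; exists i.
have ex_i : exists i, hc i p != 0 by exists i.
exists (ex_minn ex_i); case: ex_minnP => // m m_p le_m j j_m.
by apply/eqP; apply: contraLR j_m; rewrite -leqNgt; apply: le_m.
Qed.

Lemma mpoly_ordP p : p != 0 ->
  hc (mpoly_ord p) p != 0 /\ forall i, (i < mpoly_ord p)%N -> hc i p = 0.
Proof.
case/hc_neq0=> o o_p lt_o.
have o_size : (o < msize p)%N.
  by rewrite ltnNge; apply: contra o_p => /hc_msize ->.
have has_o : has (fun d => hc d p != 0) (iota 0 (msize p)).
  by apply/hasP; exists o => //; rewrite mem_iota.
have := nth_find 0%N has_o; rewrite -/(mpoly_ord p) nth_iota ?add0n => [->|]; last first.
  by move: has_o; rewrite has_find size_iota.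
split=> // i i_p; have := before_find 0%N i_p.
rewrite nth_iota ?add0n => [/negbFE/eqP //|].
by apply: leq_trans i_p _; rewrite -[X in (_ <= X)%N](size_iota 0) find_size.
Qed.

End Components.

Section Degpart.
Variables (C : fieldType) (n : nat).
Local Notation P := {mpoly C[n]}.
Local Notation K := {fraction P}.
Local Notation "p %:F" := (tofrac p).
Implicit Types (p q : P) (f g : K) (s u : int -> K).

Definition hcz (e : int) p : P := if e is Posz m then hc m p else 0.

(** The coefficient of b^e in the product of q(b x) with a Laurent series in b. *)
Definition lconv q s (e : int) : K := \sum_(i < msize q) (hc i q)%:F * s (e - i%:Z).

Lemma lconvE k q s e : (msize q <= k)%N ->
  lconv q s e = \sum_(i < k) (hc i q)%:F * s (e - i%:Z).
Proof.
move=> q_k; rewrite /lconv (big_ord_widen k (fun i => (hc i q)%:F * s (e - i%:Z))) //.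
rewrite big_mkcond /=; apply: eq_bigr => i _; case: ltnP => // /hc_msize ->.
by rewrite tofrac0 mul0r.
Qed.

Lemma hczM e p q : (hcz e (p * q))%:F = lconv p (fun d => (hcz d q)%:F) e.
Proof.
case: e => [e|e]; last first.
  rewrite /lconv big1 ?tofrac0 // => i _.
  rewrite (_ : Negz e - i%:Z = Negz (e + i)) ?tofrac0 ?mulr0 //; lia.
rewrite (@lconvE (maxn (msize p) e.+1)) ?leq_maxl //= hcM rmorph_sum /=.
rewrite (big_ord_widen (maxn (msize p) e.+1) (fun i => (hc i p * hc (e - i) q)%:F)).
  rewrite big_mkcond /=; apply: eq_bigr => i _; case: ltnP => i_e.
    by rewrite tofracM (_ : e%:Z - i%:Z = (e - i)%N%:Z) //; lia.
  by rewrite (_ : e%:Z - i%:Z = Negz (i - e).-1) ?tofrac0 ?mulr0 //; lia.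
exact: leq_maxr.
Qed.

Definition bounded_below s := exists B : int, forall d, (d < B)%R -> s d = 0.

(** The part of q of lowest degree o can be cancelled, so that a convolution
    with q determines the series with a loss of o degrees. *)
Lemma lconv_eq0 q : q != 0 -> exists o : nat, forall s E, bounded_below s ->
  (forall e, (e <= E)%R -> lconv q s e = 0) -> forall d, (d + o%:Z <= E)%R -> s d = 0.
Proof.
case/hc_neq0=> o o_q lt_o; exists o => s E [B s_B] conv0.
have o_size : (o < msize q)%N by rewrite ltnNge; apply: contra o_q => /hc_msize ->.
suff gen (m : nat) d : (d < B + m%:Z)%R -> (d + o%:Z <= E)%R -> s d = 0.
  by move=> d; apply: (gen (`|d - B|.+1)%N); lia.
elim: m d => [|m IHm] d d_m d_E; first by apply: s_B; lia.
have := conv0 _ d_E; rewrite /lconv (bigD1 (Ordinal o_size)) //= big1 ?addr0.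
  move/eqP; rewrite addrK mulf_eq0 tofrac_eq0 (negPf o_q) => /eqP //.
move=> i; rewrite -val_eqE /= => i_o; have [/lt_o ->|o_i] := ltnP i o.
  by rewrite tofrac0 mul0r.
by rewrite IHm ?mulr0 //; lia.
Qed.

End Degpart.

Lemma fracE (R : idomainType) (f : {fraction R}) :
  f = (\n_(repr f))%:F / (\d_(repr f))%:F.
Proof.
have d_neq0 : (\d_(repr f))%:F != 0 by rewrite tofrac_eq0 denom_ratioP.
apply/(canRL (mulfK d_neq0)); rewrite -[X in X * _]reprK.
move: (repr f) => x; unlock tofrac.
rewrite -[LHS]FracField.pi_mul; apply/eqmodP; rewrite /= FracField.equivfE.
rewrite /FracField.mulf !numden_Ratio ?mulf_neq0 ?oner_eq0 ?denom_ratioP //.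
by rewrite !mulr1 mulrC.
Qed.

Lemma frac_common (R : idomainType) (f g : {fraction R}) :
  exists p p' q, [/\ q != 0, f = p%:F / q%:F & g = p'%:F / q%:F].
Proof.
pose q := \d_(repr f); pose q' := \d_(repr g).
have q0 : q != 0 by apply: denom_ratioP.
have q'0 : q' != 0 by apply: denom_ratioP.
exists (\n_(repr f) * q'), (\n_(repr g) * q), (q * q'); split; first exact: mulf_neq0.
  by rewrite [LHS]fracE !tofracM -mulf_div divff ?tofrac_eq0 ?mulr1.
by rewrite [LHS]fracE !tofracM [q%:F * _]mulrC -mulf_div divff ?tofrac_eq0 ?mulr1.
Qed.

Section Degpart.
Variables (C : fieldType) (n : nat).
Hypothesis C_char0 : forall k, k.+1%:R != 0 :> C.
Local Notation P := {mpoly C[n]}.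
Local Notation K := {fraction P}.
Implicit Types (p q : P) (f g : K) (s u : int -> K).

Lemma fracmp_char0 k : k.+1%:R != 0 :> K.
Proof.
rewrite -[_%:R](rmorph_nat (@tofrac P)) tofrac_eq0.
by rewrite -[_%:R](rmorph_nat (@mpolyC n C)) mpolyC_eq0.
Qed.

Lemma lconvM q q' s e : lconv q (lconv q' s) e = lconv q' (lconv q s) e.
Proof.
rewrite /lconv; under eq_bigr do rewrite mulr_sumr.
rewrite exchange_big /=; apply: eq_bigr => i _; rewrite mulr_sumr.
by apply: eq_bigr => j _; rewrite mulrCA; congr (_ * (_ * s _)); lia.
Qed.

Lemma lconvB q s u e : lconv q (fun d => s d - u d) e = lconv q s e - lconv q u e.
Proof. by rewrite /lconv -sumrB; apply: eq_bigr => i _; rewrite mulrBr. Qed.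

Lemma lconv_bounded q s : bounded_below s -> bounded_below (lconv q s).
Proof.
case=> B s_B; exists B => d d_B; rewrite /lconv big1 // => i _.
by rewrite s_B ?mulr0 //; lia.
Qed.

Lemma hcz_bounded p : bounded_below (fun d => (hcz d p)%:F).
Proof. by exists 0 => -[d|d] //=; rewrite tofrac0. Qed.

Lemma bounded_belowB s u :
  bounded_below s -> bounded_below u -> bounded_below (fun d => s d - u d).
Proof.
case=> B s_B [B' u_B']; exists (Num.min B B') => d d_BB.
by rewrite s_B ?u_B' ?subr0 //; lia.
Qed.

Lemma degpart_bounded f : bounded_below (fun d => degpart d f).
Proof.
exists (- (mpoly_ord \d_(repr f))%:Z) => d d_o; rewrite /degpart.
have : (d + (mpoly_ord \d_(repr f))%:Z < 0)%R by lia.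
by case: (d + _).
Qed.

(** The series degpart of f is defined by inverting that of the denominator;
    multiplying back gives the numerator. *)
Lemma lconv_repr f e :
  lconv \d_(repr f) (fun d => degpart d f) e = (hcz e \n_(repr f))%:F.
Proof.
set p := \n_(repr f); set q := \d_(repr f).
have q0 : q != 0 by apply: denom_ratioP.
have [qo lt_o] := mpoly_ordP q0; set o := mpoly_ord q in qo lt_o.
pose Q := (hc o q)%:F; have Q0 : Q != 0 by rewrite tofrac_eq0.
pose num : fps K := fun i => (hc i p)%:F / Q.
pose den : fps K := fun i => (hc (o + i)%N q)%:F / Q.
have degpartE m : degpart (m%:Z - o%:Z) f = (num * fps_pow den (-1)) m.
  by rewrite /degpart subrK.
have den0 : den 0%N = 1 by rewrite /den addn0 divff.
have numE : num = den * (num * fps_pow den (-1)).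
  have denV := fps_pow_inv fracmp_char0 den0.
  by transitivity (num * (fps_pow den (-1) * den)); [rewrite denV mulr1 | rewrite mulrA; apply: mulrC].
have low d : (d + o%:Z < 0)%R -> degpart d f = 0.
  by rewrite /degpart -/q -/o; case: (d + _).
case: e => [e|e] /=; last first.
  rewrite /lconv big1 ?tofrac0 // => i _.
  have [/lt_o ->|o_i] := ltnP i o; first by rewrite tofrac0 mul0r.
  by rewrite low ?mulr0 //; lia.
have -> : (hc e p)%:F = Q * num e by rewrite mulrC divfK.
rewrite numE coef_fpsM (@lconvE _ _ (o + (maxn (msize q) e.+1))); last first.
  by rewrite (leq_trans (leq_maxl _ _) (leq_addl _ _)).
rewrite big_split_ord /= big1 ?add0r => [|i _]; last first.
  by rewrite lt_o // tofrac0 mul0r.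
rewrite mulr_sumr.
rewrite (big_ord_widen (maxn (msize q) e.+1)
  (fun i => Q * (den i * (num * fps_pow den (-1)) (e - i)%N))) ?leq_maxr //.
rewrite [RHS]big_mkcond; apply: eq_bigr => i _; case: ltnP => [i_e|e_i] /=.
  rewrite mulrA [Q * _]mulrC divfK // -degpartE; congr (_ * degpart _ _); lia.
by rewrite low ?mulr0 //; lia.
Qed.

(** Independence of the representative of the fraction: the convolution by a
    nonzero polynomial is injective on series that are bounded below. *)
Lemma lconv_degpart p q e : q != 0 ->
  lconv q (fun d => degpart d (p%:F / q%:F)) e = (hcz e p)%:F.
Proof.
move=> q0; set f := p%:F / q%:F.
set p0 := \n_(repr f); set q0' := \d_(repr f).
have q0'0 : q0' != 0 by apply: denom_ratioP.
have cross : q * p0 = q0' * p.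
  apply/eqP; rewrite -tofrac_eq !tofracM [_ * p0%:F]mulrC [_ * p%:F]mulrC -eqr_div ?tofrac_eq0 //.
  by rewrite -fracE.
have [o uniq_o] := lconv_eq0 q0'0.
apply/eqP; rewrite -subr_eq0; apply/eqP.
apply: (uniq_o (fun d => lconv q (fun d => degpart d f) d - (hcz d p)%:F) (e + o%:Z)) => //.
  apply: bounded_belowB; last exact: hcz_bounded.
  exact/lconv_bounded/degpart_bounded.
move=> d _; rewrite lconvB lconvM.
rewrite -(hczM d q0' p) -cross hczM; apply/eqP; rewrite subr_eq0; apply/eqP.
by apply: eq_bigr => i _; rewrite lconv_repr.
Qed.

Lemma degpart_eq p q s d : q != 0 -> bounded_below s ->
  (forall e, lconv q s e = (hcz e p)%:F) -> degpart d (p%:F / q%:F) = s d.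
Proof.
move=> q0 s_low sE; have [o uniq_o] := lconv_eq0 q0.
apply/eqP; rewrite -subr_eq0; apply/eqP.
apply: (uniq_o (fun d => degpart d (p%:F / q%:F) - s d) (d + o%:Z)) => //.
  exact: bounded_belowB (degpart_bounded _) s_low.
by move=> e _; rewrite lconvB lconv_degpart // sE subrr.
Qed.

Lemma degpart_homog k p q d : q != 0 -> q \is k.-homog ->
  degpart d (p%:F / q%:F) = (hcz (d + k%:Z) p)%:F / q%:F.
Proof.
move=> q0 q_k; apply: (@degpart_eq _ _ (fun d => (hcz (d + k%:Z) p)%:F / q%:F)) => //.
  by exists (- k%:Z) => e e_k; case E : (e + _) => [m|m] /=; rewrite ?tofrac0 ?mul0r //; lia.
move=> e; rewrite (@lconvE _ _ (maxn (msize q) k.+1)) ?leq_maxl //.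
have k_lt : (k < maxn (msize q) k.+1)%N by rewrite leq_maxr.
rewrite (bigD1 (Ordinal k_lt)) //= (hc_dhomog _ q_k) eqxx big1 ?addr0.
  by rewrite subrK mulrC divfK // tofrac_eq0.
move=> i; rewrite -val_eqE /= eq_sym (hc_dhomog _ q_k) => /negPf ->.
by rewrite tofrac0 mul0r.
Qed.

Lemma degpart_tofrac d p : degpart d p%:F = (hcz d p)%:F.
Proof.
have := @degpart_homog 0 p 1 d (oner_neq0 _) (dhomog1 _ _).
by rewrite tofrac1 !divr1 addr0.
Qed.

Lemma degpart_lin (a b : C) f g d :
  degpart d ((a%:MP)%:F * f - (b%:MP)%:F * g)
  = (a%:MP)%:F * degpart d f - (b%:MP)%:F * degpart d g.
Proof.
have lconvZ c q s e : lconv q (fun d => (c%:MP)%:F * s d) e = (c%:MP)%:F * lconv q s e.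
  by rewrite /lconv mulr_sumr; apply: eq_bigr => i _; rewrite mulrCA.
have boundedZ c s : bounded_below s -> bounded_below (fun d => (c%:MP)%:F * s d).
  by case=> B s_B; exists B => e /s_B ->; rewrite mulr0.
have hczZ c e p : (hcz e (c%:MP * p))%:F = (c%:MP)%:F * (hcz e p)%:F.
  by case: e => e /=; rewrite ?tofrac0 ?mulr0 // mul_mpolyC linearZ /= -mul_mpolyC tofracM.
have hczB e p p' : hcz e (p - p') = hcz e p - hcz e p'.
  by case: e => e /=; rewrite ?linearB ?subr0.
have [p [p' [q [q0 fE gE]]]] := frac_common f g.
have -> : (a%:MP)%:F * f - (b%:MP)%:F * g = (a%:MP * p - b%:MP * p')%:F / q%:F.
  by rewrite fE gE tofracB !tofracM mulrBl !mulrA.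
apply: (@degpart_eq _ _ (fun d => (a%:MP)%:F * degpart d f - (b%:MP)%:F * degpart d g)) => //.
  by apply: bounded_belowB; apply/boundedZ/degpart_bounded.
move=> e.
have Ef : lconv q (fun d => degpart d f) e = (hcz e p)%:F.
  by rewrite fE; apply: lconv_degpart.
have Eg : lconv q (fun d => degpart d g) e = (hcz e p')%:F.
  by rewrite gE; apply: lconv_degpart.
rewrite hczB tofracB !hczZ -Ef -Eg; apply: etrans (lconvB _ _ _ _) _.
by congr (_ - _); apply: lconvZ.
Qed.

(** The numerator is the product of the denominator with a series that starts
    beyond E. *)
Lemma degpart_low_numer p q E : q != 0 ->
  (forall d, (d <= E)%R -> degpart d (p%:F / q%:F) = 0) ->
  forall e, (e <= E)%R -> hcz e p = 0.
Proof.
move=> q0 low e e_E; apply/eqP; rewrite -tofrac_eq0 -(lconv_degpart p e q0).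
by rewrite /lconv big1 // => i _; rewrite low ?mulr0 //; lia.
Qed.
End Degpart.

(** * Linear substitutions *)

Section FracMap.
Variables (A B : idomainType) (phi : {rmorphism A -> B}).
Hypothesis phi_inj : injective phi.

Let phi_neq0 q : q != 0 -> phi q != 0.
Proof. by apply: contra => /eqP e; apply/eqP/phi_inj; rewrite e rmorph0. Qed.

(** The injectivity of phi is an argument, so that the structure of ring
    morphism can be attached to the function. *)
Definition fracmap (_ : injective phi) (f : {fraction A}) : {fraction B} :=
  (phi \n_(repr f))%:F / (phi \d_(repr f))%:F.
Local Notation fmap := (fracmap phi_inj).

Lemma fracmap_div p q : q != 0 -> fmap (p%:F / q%:F) = (phi p)%:F / (phi q)%:F.
Proof.
move=> q0; set f := p%:F / q%:F; have d0 : \d_(repr f) != 0 by apply: denom_ratioP.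
apply/eqP; rewrite eqr_div ?tofrac_eq0 ?phi_neq0 // -!tofracM tofrac_eq -!rmorphM.
rewrite (inj_eq phi_inj) -tofrac_eq !tofracM -eqr_div ?tofrac_eq0 //.
by rewrite -fracE.
Qed.

Lemma fracmap_tofrac p : fmap p%:F = (phi p)%:F.
Proof.
by have := fracmap_div p (oner_neq0 A); rewrite !rmorph1 !divr1.
Qed.

Fact fracmap_zmod_morphism : zmod_morphism fmap.
Proof.
move=> f g; have [p [p' [q [q0 -> ->]]]] := frac_common f g.
by rewrite -mulrBl -tofracB !fracmap_div // rmorphB tofracB mulrBl.
Qed.

Fact fracmap_monoid_morphism : monoid_morphism fmap.
Proof.
split=> [|f g]; first by rewrite -tofrac1 fracmap_tofrac rmorph1 tofrac1.
have [p [p' [q [q0 -> ->]]]] := frac_common f g.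
rewrite mulf_div -!tofracM !fracmap_div ?mulf_neq0 //.
by rewrite mulf_div !rmorphM.
Qed.

HB.instance Definition _ :=
  GRing.isZmodMorphism.Build {fraction A} {fraction B} fmap fracmap_zmod_morphism.
HB.instance Definition _ :=
  GRing.isMonoidMorphism.Build {fraction A} {fraction B} fmap fracmap_monoid_morphism.

End FracMap.

Section LinearSubst.
Variables (C : fieldType) (n n' : nat) (h : 'I_n -> {mpoly C[n']}).
Hypothesis h_lin : forall i, h i \is 1.-homog.

Definition lsub : {mpoly C[n]} -> {mpoly C[n']} := mmap (@mpolyC n' C) h.
HB.instance Definition _ := GRing.RMorphism.on lsub.

Lemma lsubX i : lsub 'X_i = h i.
Proof. by rewrite /lsub mmapX mmap1U. Qed.

Lemma lsubC c : lsub c%:MP = c%:MP.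
Proof. by rewrite /lsub mmapC. Qed.

Lemma lsub_monomial c m : lsub (c *: 'X_[m]) = c%:MP * \prod_i h i ^+ m i.
Proof. by rewrite /lsub mmapZ mmapX. Qed.

Lemma dhomog_prod_lin (I : Type) (r : seq I) (P : pred I) (F : I -> {mpoly C[n']})
    (d : I -> nat) :
  (forall i, P i -> F i \is (d i).-homog) ->
  \prod_(i <- r | P i) F i \is (\sum_(i <- r | P i) d i)%N.-homog.
Proof.
move=> F_d; elim/big_rec2: _ => [|i m p Pi p_m]; first exact: dhomog1.
exact: dhomogM (F_d i Pi) p_m.
Qed.

Lemma lsub_dhomog d p : p \is d.-homog -> lsub p \is d.-homog.
Proof.
move=> /dhomogP p_d; rewrite /lsub /mmap big_seq; apply: rpred_sum => m m_p.
rewrite mul_mpolyC; apply: dhomogZ.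
have -> : d = (\sum_(i < n) m i)%N by rewrite -mdegE -(p_d m m_p).
apply: dhomog_prod_lin => i _; rewrite -[X in X.-homog]mul1n; exact: dhomogMn.
Qed.

Lemma hc_lsub d p : hc d (lsub p) = lsub (hc d p).
Proof.
pose k := maxn (msize p) d.+1.
rewrite {1}(@hc_partition _ _ k p) ?leq_maxl // rmorph_sum linear_sum /=.
have d_k : (d < k)%N by rewrite leq_maxr.
rewrite (bigD1 (Ordinal d_k)) //= big1 ?addr0 => [|i].
  by rewrite (hc_dhomog _ (lsub_dhomog (pihomogP _ _ _))) eqxx.
rewrite -val_eqE /= => /negPf i_d.
by rewrite (hc_dhomog _ (lsub_dhomog (pihomogP _ _ _))) i_d.
Qed.

Lemma hcz_lsub d p : hcz d (lsub p) = lsub (hcz d p).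
Proof. by case: d => d /=; rewrite ?hc_lsub ?rmorph0. Qed.

Hypothesis C_char0 : forall k, k.+1%:R != 0 :> C.
Hypothesis lsub_inj : injective lsub.

(** The image of the series of f solves the equation that characterizes the
    series of the image, because a linear substitution respects degrees. *)
Lemma degpart_fracmap d (f : {fraction {mpoly C[n]}}) :
  degpart d (fracmap lsub_inj f) = fracmap lsub_inj (degpart d f).
Proof.
have q0 : \d_(repr f) != 0 by apply: denom_ratioP.
pose s e := fracmap lsub_inj (degpart e f).
apply: (degpart_eq C_char0 (s := s)).
- by apply/eqP => e; case/eqP: q0; apply: lsub_inj; rewrite e rmorph0.
- by case: (degpart_bounded f) => B f_B; exists B => e /f_B; rewrite /s => ->; rewrite rmorph0.
move=> e; set p := \n_(repr f); set q := \d_(repr f).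
rewrite hcz_lsub -fracmap_tofrac -(lconv_repr C_char0) -/q.
rewrite (@lconvE _ _ (maxn (msize (lsub q)) (msize q))) ?leq_maxl //.
rewrite (@lconvE _ _ (maxn (msize (lsub q)) (msize q)) q) ?leq_maxr //.
rewrite rmorph_sum; apply: eq_bigr => i _.
by rewrite rmorphM /= fracmap_tofrac hc_lsub.
Qed.

End LinearSubst.

Lemma lsub_rename_cancel (C : fieldType) n n' (g : 'I_n -> 'I_n') (g' : 'I_n' -> 'I_n) :
  cancel g g' ->
  cancel (lsub (fun i => 'X_(g i) : {mpoly C[n']})) (lsub (fun i => 'X_(g' i))).
Proof.
move=> gK p; rewrite [p in LHS]mpolyE [RHS]mpolyE.
rewrite (raddf_sum (lsub (fun i => 'X_(g i)))) (raddf_sum (lsub (fun i => 'X_(g' i)))) /=.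
apply: eq_bigr => m _.
rewrite lsub_monomial rmorphM /= lsubC rmorph_prod -mul_mpolyC mpolyXE_id.
by congr (_ * _); apply: eq_bigr => i _; rewrite rmorphXn /= lsubX gK.
Qed.

(** * Virtual characters *)

Section ProdFreeg.
Variables (L : fieldType) (T : choiceType) (F : T -> L).
Implicit Types D : {freeg T / int}.

(** The multiplicative class with value F x on the character x; Euler, Chern and
    Segre classes are of this form. *)
Definition prodfg D : L := \prod_(x <- dom D) F x ^ coeff x D.

Lemma prodfg_sub (s : seq T) D : uniq s -> {subset dom D <= s} ->
  prodfg D = \prod_(x <- s) F x ^ coeff x D.
Proof.
move=> uniq_s D_s; rewrite (bigID (mem (dom D))) /= [X in _ * X]big1 ?mulr1.
  rewrite -big_filter; apply/perm_big/uniq_perm; rewrite ?uniq_dom ?filter_uniq //.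
  by move=> x; rewrite mem_filter /= andb_idr // => /D_s.
by move=> x /coeff_outdom ->; rewrite expr0z.
Qed.

Hypothesis F_neq0 : forall x, F x != 0.

Lemma prodfgD D1 D2 : prodfg (D1 + D2) = prodfg D1 * prodfg D2.
Proof.
pose s := undup (dom D1 ++ dom D2).
have s_uniq : uniq s by apply: undup_uniq.
rewrite !(prodfg_sub s_uniq) => [|x|x|x]; rewrite ?mem_undup ?mem_cat; last first.
- by move=> /domD_subset; rewrite mem_cat.
- by move=> ->.
- by move=> ->; rewrite orbT.
rewrite -big_split; apply: eq_bigr => x _.
by rewrite coeffD expfzDr.
Qed.

Lemma prodfg0 : prodfg 0 = 1.
Proof. by rewrite /prodfg dom0 big_nil. Qed.

Lemma prodfgN D : prodfg (- D) = (prodfg D)^-1.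
Proof.
have DN0 : prodfg D * prodfg (- D) = 1 by rewrite -prodfgD subrr prodfg0.
have D0 : prodfg D != 0.
  by apply: contra_eq_neq DN0 => ->; rewrite mul0r eq_sym oner_eq0.
by apply: (mulfI D0); rewrite DN0 divff.
Qed.

Lemma prodfgU x : prodfg << x >> = F x.
Proof. by rewrite /prodfg domU1 big_seq1 coeffU mul1r eqxx expr1z. Qed.

Lemma prodfg_sum (I : Type) (r : seq I) (D : I -> {freeg T / int}) :
  prodfg (\sum_(i <- r) D i) = \prod_(i <- r) prodfg (D i).
Proof. exact: (big_morph prodfg prodfgD prodfg0). Qed.

End ProdFreeg.

HB.instance Definition _ (T : choiceType) (V : lmodType int) (f : T -> V) :=
  GRing.isZmodMorphism.Build {freeg T / int} V (fglift f) (lift_is_additive f).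

Section Vmul.
Variable n : nat.
Implicit Types (x y : wt n) (g h : vchar n).

Lemma fgliftE (V : lmodType int) (f : wt n -> V) g :
  fglift f g = \sum_(x <- dom g) coeff x g *: f x.
Proof.
rewrite -[in LHS](freeg_sumE g) raddf_sum; apply: eq_bigr => x _ /=.
by rewrite liftU.
Qed.

Lemma freegU_scale (c : int) x : << c *g x >> = c *: << x >> :> vchar n.
Proof. by apply/eqP/freeg_eqP => z; rewrite coeffZ !coeffU mul1r. Qed.

(** This form of the product exhibits its bilinearity. *)
Lemma vmulE g h : vmul g h = fglift (fun x => fglift (fun y => << x + y >> : vchar n) h) g.
Proof.
rewrite fgliftE; apply: eq_bigr => x _; rewrite fgliftE scaler_sumr.
by apply: eq_bigr => y _; rewrite freegU_scale scalerA.
Qed.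

Lemma vdualE g : vdual g = fglift (fun x => << - x >> : vchar n) g.
Proof. by rewrite fgliftE; apply: eq_bigr => x _; rewrite freegU_scale. Qed.

Lemma vmulDl g g' h : vmul (g + g') h = vmul g h + vmul g' h.
Proof. by rewrite !vmulE raddfD. Qed.

Lemma vmulNl g h : vmul (- g) h = - vmul g h.
Proof. by rewrite !vmulE raddfN. Qed.

Lemma vmul_suml (I : Type) (r : seq I) (g : I -> vchar n) h :
  vmul (\sum_(i <- r) g i) h = \sum_(i <- r) vmul (g i) h.
Proof. by rewrite vmulE raddf_sum; apply: eq_bigr => i _; rewrite vmulE. Qed.

Lemma vmulUl x h : vmul << x >> h = fglift (fun y => << x + y >> : vchar n) h.
Proof. by rewrite vmulE liftU scale1r. Qed.

Lemma vmulC g h : vmul g h = vmul h g.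
Proof.
rewrite /vmul exchange_big; apply: eq_bigr => x _; apply: eq_bigr => y _.
by rewrite mulrC addrC.
Qed.

Lemma vmulUU x y : vmul << x >> << y >> = << x + y >>.
Proof. by rewrite vmulUl liftU scale1r. Qed.

Lemma vdualU x : vdual << x >> = << - x >>.
Proof. by rewrite vdualE liftU scale1r. Qed.

Lemma vdual_sum (I : Type) (r : seq I) (g : I -> vchar n) :
  vdual (\sum_(i <- r) g i) = \sum_(i <- r) vdual (g i).
Proof. by rewrite vdualE raddf_sum; apply: eq_bigr => i _; rewrite vdualE. Qed.

Lemma vmulDr g h h' : vmul g (h + h') = vmul g h + vmul g h'.
Proof. by rewrite !(vmulC g) vmulDl. Qed.

Lemma vmulNr g h : vmul g (- h) = - vmul g h.
Proof. by rewrite !(vmulC g) vmulNl. Qed.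

Lemma vmul_sumr (I : Type) (r : seq I) (h : I -> vchar n) g :
  vmul g (\sum_(i <- r) h i) = \sum_(i <- r) vmul g (h i).
Proof. by rewrite vmulC vmul_suml; apply: eq_bigr => i _; rewrite vmulC. Qed.

End Vmul.

(** * Fixed-point sums *)

Definition boxes (rho : seq nat) : seq (nat * nat) :=
  [seq (i, j) | i <- iota 0 (size rho), j <- iota 0 (nth 0%N rho i)].

(** Q_l - (1 - t_1)(1 - t_2) (dual of Q_k) Q_l, evaluated by an additive function. *)
Definition tansum (V : zmodType) (Bk Bl : seq (nat * nat)) (c : int -> int -> V) : V :=
  \sum_(b <- Bl) c (- b.2%:Z) (- b.1%:Z)
  - \sum_(a <- Bk) \sum_(b <- Bl)
      let u := a.2%:Z - b.2%:Z in let v := a.1%:Z - b.1%:Z in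
      (c u v + c (u + 1) (v + 1) - c (u + 1) v - c u (v + 1)).

Definition tanprod (L : fieldType) (Bk Bl : seq (nat * nat)) (g : int -> int -> L) : L :=
  (\prod_(b <- Bl) g (- b.2%:Z) (- b.1%:Z))
  / \prod_(a <- Bk) \prod_(b <- Bl)
      let u := a.2%:Z - b.2%:Z in let v := a.1%:Z - b.1%:Z in
      (g u v * g (u + 1) (v + 1) / (g (u + 1) v * g u (v + 1))).

Section FixedPointSum.
Variables (L : fieldType) (N r : nat) (l1 l2 : L) (m : 'I_N -> L) (w : 'I_r -> L).

Definition trivial_wt (k l : 'I_N) (u v : int) : bool := [&& k == l, u == 0 & v == 0].

(** A trivial weight gets the value 1; its multiplicity is recorded apart, by
    fptrivial. *)
Definition fpweight k l (u v : int) : L :=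
  if trivial_wt k l u v then 1 else m l - m k + l1 *~ u + l2 *~ v.

Definition fpsegre (B : 'I_N -> seq (nat * nat)) : L :=
  \prod_(k < N) \prod_(j < r) \prod_(b <- B k)
    (1 + (w j + m k - l1 *+ b.2 - l2 *+ b.1)).

Definition fptrivial (B : 'I_N -> seq (nat * nat)) : int :=
  \sum_(k < N) \sum_(l < N) tansum (B k) (B l) (fun u v => (trivial_wt k l u v)%:Z).

(** If a trivial weight is left in the tangent space, its Euler class is 0 and
    dividing by it gives 0. *)
Definition fpterm (B : 'I_N -> seq (nat * nat)) : L :=
  if fptrivial B == 0 then
    (fpsegre B)^-1 / \prod_(k < N) \prod_(l < N) tanprod (B k) (B l) (fpweight k l)
  else 0.

(** The sum over the fixed points, for parameters in an arbitrary field. It makes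
    sense after renaming and specializing the equivariant parameters. *)
Definition fpsum (d : nat) : L :=
  \sum_(pi : {ffun 'I_N -> seq_sub (parts_le d)}
         | (\sum_k sumn (ssval (pi k)))%N == d) fpterm (fun k => boxes (ssval (pi k))).

End FixedPointSum.

Section C1wt.
Variables (C : fieldType) (n : nat).
Hypothesis C_char0 : forall k, k.+1%:R != 0 :> C.
Local Notation P := {mpoly C[n]}.
Local Notation c1 := (@c1wt C n).

Fact c1wt_zmod_morphism : zmod_morphism c1.
Proof.
by move=> x y; rewrite /c1wt -sumrB; apply: eq_bigr => i _; rewrite !mxE mulrzBr.
Qed.
HB.instance Definition _ := GRing.isZmodMorphism.Build (wt n) P c1 c1wt_zmod_morphism.

Lemma c1wt_delta i : c1 (delta_mx 0 i) = 'X_i.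
Proof.
rewrite /c1wt (bigD1 i) //= mxE !eqxx mulr1z big1 ?addr0 // => j j_i.
by rewrite mxE (negPf j_i) andbF mulr0z.
Qed.

Lemma c1wt_eq0 x : (c1 x == 0) = (x == 0).
Proof.
apply/eqP/eqP => [c1_0|->]; last exact: raddf0.
apply/rowP => i; rewrite mxE.
have /eqP : (c1 x)@_U_(i) = 0 by rewrite c1_0 mcoeff0.
rewrite /c1wt raddf_sum (bigD1 i) //= big1 ?addr0 => [|j j_i]; last first.
  by rewrite raddfMz /= mcoeffXU (negPf j_i) mul0rz.
rewrite raddfMz /= mcoeffX eqxx; case: (x 0 i) => [[|k]|k] //.
  by rewrite -pmulrn (negPf (C_char0 k)).
by rewrite NegzE mulrNz oppr_eq0 -pmulrn (negPf (C_char0 k)).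
Qed.

Lemma onePc1wt_neq0 x : 1 + c1 x != 0.
Proof.
apply/eqP => e; have : (1 + c1 x)@_0 = 0 by rewrite e mcoeff0.
rewrite mcoeffD mcoeff1 eqxx /c1wt raddf_sum big1 ?addr0 => [/eqP|i _ /=].
  by rewrite oner_eq0.
rewrite raddfMz /= mcoeffX; case: eqP => [e'|]; last by rewrite mul0rz.
have := congr1 mdeg e'; by rewrite mdeg1 mdeg0.
Qed.

Definition c1wt1 (x : wt n) : {fraction P} := if x == 0 then 1 else (c1 x)%:F.

Lemma c1wt1_neq0 x : c1wt1 x != 0.
Proof.
rewrite /c1wt1; case: ifP => [_|x0]; first exact: oner_neq0.
by rewrite tofrac_eq0 c1wt_eq0 x0.
Qed.

(** A power of c_1 = 0 with nonzero exponent is 0, also if the exponent is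
    negative. *)
Lemma eulerE (g : vchar n) :
  euler C g = if coeff 0 g == 0 then prodfg c1wt1 g else 0.
Proof.
rewrite /euler /prodfg; case: ifP => g0.
  rewrite big_seq [RHS]big_seq; apply: eq_bigr => x; rewrite mem_dom => gx.
  by rewrite /c1wt1 ifN //; apply: contraNneq gx => ->.
have g_0 : 0 \in dom g by rewrite mem_dom g0.
rewrite (bigD1_seq _ g_0 (uniq_dom _)) /= raddf0 tofrac0 exp0rz g0.
by rewrite mul0r.
Qed.

Lemma segre_classE (g : vchar n) :
  segre_class C g = (prodfg (fun x => (1 + c1 x)%:F) g)^-1.
Proof.
by rewrite /segre_class -prodfV; apply: eq_bigr => x _; rewrite invr_expz.
Qed.

End C1wt.

Lemma eq_tansum (V : zmodType) Bk Bl (c c' : int -> int -> V) :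
  c =2 c' -> tansum Bk Bl c = tansum Bk Bl c'.
Proof.
move=> cc'; rewrite /tansum; congr (_ - _); first by apply: eq_bigr => b _.
by apply: eq_bigr => a _; apply: eq_bigr => b _ /=; rewrite !cc'.
Qed.

Lemma eq_tanprod (L : fieldType) Bk Bl (c c' : int -> int -> L) :
  c =2 c' -> tanprod Bk Bl c = tanprod Bk Bl c'.
Proof.
move=> cc'; rewrite /tanprod; congr (_ / _); first by apply: eq_bigr => b _.
by apply: eq_bigr => a _; apply: eq_bigr => b _ /=; rewrite !cc'.
Qed.

Section SegreSeries.
#[local] Opaque vmul vdual.
Variables (C : fieldType) (p q N r : nat).
Hypothesis C_char0 : forall k, k.+1%:R != 0 :> C.
Local Notation n := (2 + p + q)%N.
Local Notation W := (wt n).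
Local Notation X := (vchar n).
Local Notation K := {fraction {mpoly C[n]}}.

Definition it1 : 'I_n := lshift q (lshift p (inord 0 : 'I_2)).
Definition it2 : 'I_n := lshift q (lshift p (inord 1 : 'I_2)).

Variables (iy : 'I_N -> 'I_n) (iv : 'I_r -> 'I_n).
Hypothesis iy_inj : injective iy.
Hypothesis iy_t : forall k, (iy k != it1) && (iy k != it2).

Let y k : W := delta_mx 0 (iy k).
Let v j : W := delta_mx 0 (iv j).

Lemma QcharE rho : @Qchar p q rho = \sum_(b <- boxes rho) << - (t1 *+ b.2) - t2 *+ b.1 >>.
Proof.
have iotaE (V : zmodType) m (F : nat -> V) : \sum_(i <- iota 0 m) F i = \sum_(i < m) F i.
  by rewrite -(big_mkord xpredT F) /index_iota subn0.
rewrite /boxes big_allpairs_dep iotaE; apply: eq_bigr => i _.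
by rewrite iotaE.
Qed.

Definition boxwt (k l : 'I_N) (u s : int) : W := y l - y k + t1 *~ u + t2 *~ s.

Let TkE (Bk Bl : seq (nat * nat)) k l :
  let Q (B : seq (nat * nat)) : X := \sum_(b <- B) << - (t1 *+ b.2) - t2 *+ b.1 >> in
  vmul (Q Bl - vmul (vmul (<< 0 >> - << t1 >>) (<< 0 >> - << t2 >>)) (vmul (vdual (Q Bk)) (Q Bl)))
    << y l - y k >>
  = tansum Bk Bl (fun u s => << boxwt k l u s >>).
Proof.
move=> Q; rewrite vmulDl vmulNl /tansum; congr (_ - _).
  rewrite vmul_suml; apply: eq_bigr => b _; rewrite vmulUU; congr << _ >>.
  by rewrite /boxwt !mulrNz -!pmulrn addrC -!addrA.
rewrite [Q Bk]/Q vdual_sum vmul_suml vmul_sumr vmul_suml; apply: eq_bigr => a _.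
rewrite vdualU; set A := vmul (_ - _) _; set x := - (- _ - _).
pose wb (b : nat * nat) : W := - (t1 *+ b.2) - t2 *+ b.1.
have -> : vmul << x >> (Q Bl) = \sum_(b <- Bl) << x + wb b >>.
  by rewrite /Q vmul_sumr; apply: eq_bigr => b _; rewrite vmulUU.
rewrite (vmul_sumr Bl (fun b => << x + wb b >>) A).
rewrite (vmul_suml Bl (fun b => vmul A << x + wb b >>)); apply: eq_bigr => b _.
rewrite /A /x /wb.
rewrite /= !(vmulDl, vmulDr, vmulNl, vmulNr, vmulUU).
rewrite /boxwt !mulrzDr !mulrNz !mulr1z -!pmulrn.
move: (t1 *+ _) (t1 *+ _) (t2 *+ _) (t2 *+ _) (y l - y k) => A1 B1 A2 B2 Z.
move: t1 t2 => s1 s2.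
have wtE (a1 b1 : W) : (forall i, a1 0 i = b1 0 i) -> << a1 >> = << b1 >> :> X.
  by move=> ab; congr << _ >>; apply/rowP.
transitivity (<< Z + (B1 - A1) + (B2 - A2) >> - << Z + (B1 - A1) + (B2 - A2 + s2) >>
  - (<< Z + (B1 - A1 + s1) + (B2 - A2) >> - << Z + (B1 - A1 + s1) + (B2 - A2 + s2) >>) : X).
  by congr (_ - _ - (_ - _)); apply: wtE => i; rewrite !mxE; ring.
by rewrite opprB addrACA -!addrA; do 2!congr (_ + _); rewrite addrC.
Qed.

Lemma TvirE (pi : 'I_N -> seq nat) :
  Tvir y pi = \sum_(k < N) \sum_(l < N)
    tansum (boxes (pi k)) (boxes (pi l)) (fun u s => << boxwt k l u s >>).
Proof.
apply: eq_bigr => k _; apply: eq_bigr => l _; rewrite !QcharE.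
exact: TkE.
Qed.

Lemma prodfg_tansum (L : fieldType) (F : W -> L) Bk Bl k l : (forall x, F x != 0) ->
  prodfg F (tansum Bk Bl (fun u s => << boxwt k l u s >>))
  = tanprod Bk Bl (fun u s => F (boxwt k l u s)).
Proof.
move=> F0; rewrite prodfgD // prodfgN // /tanprod prodfg_sum //; congr (_ / _).
  by apply: eq_bigr => b _; rewrite prodfgU.
rewrite prodfg_sum //; apply: eq_bigr => a _; rewrite prodfg_sum //.
apply: eq_bigr => b _ /=; rewrite !prodfgD // !prodfgN // !prodfgU.
by rewrite invfM !mulrA.
Qed.

Lemma coeff_tansum x Bk Bl k l :
  coeff x (tansum Bk Bl (fun u s => << boxwt k l u s >>) : X)
  = tansum Bk Bl (fun u s => (boxwt k l u s == x)%:Z).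
Proof.
have cU z : coeff x (<< z >> : X) = (z == x)%:Z by rewrite coeffU mul1r; case: (z == x).
rewrite /tansum coeffD coeffN; congr (_ - _).
  by rewrite raddf_sum; apply: eq_bigr => b _; apply: cU.
rewrite raddf_sum; apply: eq_bigr => a _; rewrite raddf_sum; apply: eq_bigr => b _ /=.
by rewrite !coeffD !coeffN !cU.
Qed.

Lemma boxwt_eq0 k l u s : (boxwt k l u s == 0) = trivial_wt k l u s.
Proof.
have it12 : it1 != it2 by apply/eqP => /lshift_inj/lshift_inj/(congr1 val); rewrite /= !inordK.
have entryMz (A : W) (z : int) i : (A *~ z) 0 i = A 0 i *~ z.
  by case: z => z; rewrite ?NegzE ?mulrNz -!pmulrn ?mxE mulmxnE.
apply/eqP/and3P => [e|[/eqP -> /eqP -> /eqP ->]]; last first.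
  by rewrite /boxwt !mulr0z !addr0 subrr.
have entry i : (i == iy l)%:R - (i == iy k)%:R + (i == it1)%:R * u + (i == it2)%:R * s = 0 :> int.
  have /rowP/(_ i) := e; rewrite /boxwt !mxE !entryMz !mxE !eqxx /=.
  by rewrite !mulrzz.
have [i1y i2y] : (forall k, (it1 == iy k) = false) /\ (forall k, (it2 == iy k) = false).
  by split=> k'; have /andP[/negPf e1 /negPf e2] := iy_t k'; rewrite eq_sym.
have := entry (iy k); have := entry it1; have := entry it2.
rewrite !eqxx !i1y !i2y ![iy k == _]eq_sym !i1y !i2y (negPf it12).
rewrite (eq_sym it2) (negPf it12) (inj_eq iy_inj) /=.
by case: (eqVneq l k) => _; split=> //; lia.
Qed.

Lemma segre_tautE (B : 'I_N -> seq nat) :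
  segre_class C (taut y B (bundle v))
  = (fpsegre ('X_it1)%:F ('X_it2)%:F (fun k => ('X_(iy k))%:F)
       (fun j => ('X_(iv j))%:F) (fun k => boxes (B k)))^-1 :> K.
Proof.
have F0 x : (1 + c1wt C x)%:F != 0 :> K by rewrite tofrac_eq0 onePc1wt_neq0.
rewrite segre_classE; congr _^-1; rewrite /taut prodfg_sum //.
apply: eq_bigr => k _; rewrite vmul_suml prodfg_sum //; apply: eq_bigr => j _.
have -> : vmul << v j >> (vmul << y k >> (@Qchar p q (B k)))
    = \sum_(b <- boxes (B k)) << v j + (y k + (- (t1 *+ b.2) - t2 *+ b.1)) >>.
  rewrite QcharE [vmul << y k >> _]vmul_sumr vmul_sumr.
  by apply: eq_bigr => b _; rewrite !vmulUU.
rewrite prodfg_sum //; apply: eq_bigr => b _; rewrite prodfgU //.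
rewrite !raddfD !raddfN !raddfMn /= !c1wt_delta.
by rewrite ?tofrac1 ?addrA.
Qed.

Lemma segre_seriesE d :
  segre_series C y (bundle v) d
  = fpsum ('X_it1)%:F ('X_it2)%:F (fun k => ('X_(iy k))%:F) (fun j => ('X_(iv j))%:F) d
  :> K.
Proof.
apply: eq_bigr => pi _; set B := fun k => ssval (pi k).
rewrite segre_tautE /fpterm eulerE // TvirE.
have -> : coeff 0 (\sum_(k < N) \sum_(l < N)
    tansum (boxes (B k)) (boxes (B l)) (fun u s => << boxwt k l u s >>) : X)
    = fptrivial (fun k => boxes (B k)).
  rewrite raddf_sum; apply: eq_bigr => k _; rewrite raddf_sum; apply: eq_bigr => l _.
  by rewrite /= coeff_tansum; apply: eq_tansum => u s; rewrite boxwt_eq0.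
case: ifP => _; last by rewrite invr0 mulr0.
have c10 := c1wt1_neq0 C_char0 : forall x : W, _.
congr (_ / _); rewrite (prodfg_sum c10); apply: eq_bigr => k _.
rewrite (prodfg_sum c10); apply: eq_bigr => l _.
rewrite (prodfg_tansum _ _ _ _ c10); apply: eq_tanprod => u s.
rewrite /c1wt1 boxwt_eq0 /fpweight; case: ifP => // _.
by rewrite /boxwt !raddfD !raddfN !raddfMz /= !c1wt_delta.
Qed.
End SegreSeries.

(** * Multiplicity of the weights trivial for t_1^2 t_2 = 1 *)

Section Content.
Variables (B : seq (nat * nat)) (M : nat).
Hypothesis small : forall i j : nat, (i, j) \in B -> (2 * i + j + 4 <= M)%N.
Hypothesis M_ge : (4 <= M)%N.
(* The content 2 i - j of a box, shifted so as to be a natural number; V counts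
   the boxes of given content. *)
Let kappa (b : nat * nat) : nat := (M + 2 * b.1 - b.2)%N.
Let V (j : nat) : int := \sum_(b <- B) (kappa b == j)%:Z.

Let V_out j : (j < 2)%N || (2 * M - 2 <= j)%N -> V j = 0.
Proof.
move=> j_out; rewrite /V big_seq big1 // => -[b1 b2] /small b_M.
by rewrite (_ : kappa (b1, b2) == j = false) //; apply/negbTE/eqP; rewrite /kappa /=; lia.
Qed.

Let pair_count (s : nat) :
  \sum_(a <- B) \sum_(b <- B) (kappa a + s == kappa b)%N%:Z
  = \sum_(j < 2 * M) V j * V (j + s)%N.
Proof.
transitivity (\sum_(a <- B) \sum_(b <- B) \sum_(j < 2 * M)
   (kappa a == j)%:Z * (kappa b == j + s)%N%:Z).
  rewrite !big_seq; apply: eq_bigr => a aB; apply: eq_bigr => b _.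
  have a_M : (kappa a < 2 * M)%N.
    by move: aB; case: a => a1 a2 /small; rewrite /kappa /=; lia.
  rewrite (bigD1 (Ordinal a_M)) //= eqxx mul1r big1 ?addr0 1?eq_sym // => j.
  by rewrite -val_eqE /= eq_sym => /negPf ->; rewrite mul0r.
under eq_bigr do rewrite exchange_big; rewrite exchange_big; apply: eq_bigr => j _.
rewrite /V mulr_suml; apply: eq_bigr => a _; rewrite mulr_sumr.
by apply: eq_bigr => b _.
Qed.

Let shift_sq : \sum_(j < 2 * M) V (j + 2)%N * V (j + 2)%N = \sum_(j < 2 * M) V j * V j.
Proof.
pose f j := V j * V j.
have f_out j : (j < 2)%N || (2 * M - 2 <= j)%N -> f j = 0 by rewrite /f => /V_out ->; rewrite mul0r.
have -> : \sum_(j < 2 * M) V (j + 2)%N * V (j + 2)%N = \sum_(2 <= j < 2 * M + 2) f j.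
  by rewrite (big_addn 0 (2 * M + 2) 2) addnK big_mkord.
rewrite -(big_mkord xpredT f) [RHS](@big_cat_nat _ _ _ 2) //=; last by lia.
rewrite (@big_cat_nat _ _ _ (2 * M)) /=; [|by lia|by lia].
rewrite [X in _ + X]big_nat [X in _ + X]big1 ?addr0 => [|j j_M]; last by apply: f_out; lia.
by rewrite [X in _ = X + _]big_nat [X in _ = X + _]big1 ?add0r // => j j_2; apply: f_out; lia.
Qed.

Let telescope2 (a b : nat) : (a <= b)%N ->
  \sum_(a <= j < b) (V j - V (j + 2)%N) = V a + V a.+1 - V b - V b.+1.
Proof.
elim: b => [|b IHb]; first by case: a => // _; rewrite big_geq //; ring.
rewrite leq_eqVlt => /orP[/eqP <-|]; first by rewrite big_geq //; ring.
rewrite ltnS => a_b; rewrite big_nat_recr //= IHb // addn2; ring.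
Qed.

Let square_ge : (V M + V M.-1) *+ 2 <= \sum_(j < 2 * M) (V j - V (j + 2)%N) ^+ 2.
Proof.
rewrite -(big_mkord xpredT (fun j => (V j - V (j + 2)%N) ^+ 2)).
rewrite (@big_cat_nat _ _ _ M.-1) //=; last by lia.
have sqr_ge (x : int) : x <= x ^+ 2 /\ - x <= x ^+ 2.
  by rewrite expr2; split; nia.
have low : V M + V M.-1 <= \sum_(0 <= j < M.-1) (V j - V (j + 2)%N) ^+ 2.
  apply: le_trans (_ : \sum_(0 <= j < M.-1) - (V j - V (j + 2)%N) <= _); last first.
    by apply: ler_sum => j _; case: (sqr_ge (V j - V (j + 2)%N)).
  rewrite sumrN telescope2 // prednK ?(V_out (j := 0)) ?(V_out (j := 1)) //; last by lia.
  by rewrite le_eqVlt; apply/orP; left; apply/eqP; ring.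
have high : V M + V M.-1 <= \sum_(M.-1 <= j < 2 * M) (V j - V (j + 2)%N) ^+ 2.
  apply: le_trans (_ : \sum_(M.-1 <= j < 2 * M) (V j - V (j + 2)%N) <= _); last first.
    by apply: ler_sum => j _; case: (sqr_ge (V j - V (j + 2)%N)).
  rewrite telescope2; last by lia.
  rewrite prednK ?(V_out (j := 2 * M)) ?(V_out (j := (2 * M).+1)) //; lia.
by rewrite mulr2n; apply: lerD.
Qed.

(** With n_c the number of boxes of content c = 2 i - j, the multiplicity of the
    weights that are trivial for t_1^2 t_2 = 1 is
    n_0 - (1/2) \sum_c (n_c - n_(c+2))^2. Integers are dominated by their
    squares, and the differences with c < -1 and those with c >= -1 both
    telescope, up to sign, to n_0 + n_(-1). So the multiplicity is at most
    - n_(-1), and the box (0, 1) has content -1. *)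
Lemma tansum_special_le :
  tansum B B (fun u v => (u == 2 * v)%:Z) <= - (count_mem (0, 1)%N B)%:Z.
Proof.
have V1_ge : (count_mem (0, 1)%N B)%:Z <= V M.-1.
  rewrite /V -sum1_count big_mkcond /= (big_morph Posz PoszD (erefl _)).
  apply: ler_sum => b _; case: eqP => [->|_] //=.
  by rewrite /kappa /= muln0 addn0 subn1 eqxx.
have tansumE : tansum B B (fun u v => (u == 2 * v)%:Z)
    = V M - \sum_(j < 2 * M) V j * V j + \sum_(j < 2 * M) V j * V (j + 2)%N.
  have count_b (b : nat * nat) : b \in B -> (- b.2%:Z == 2 * - b.1%:Z) = (kappa b == M).
    by case: b => b1 b2 /small b_M; rewrite /kappa /=; apply/eqP/eqP; lia.
  rewrite /tansum -addrA; congr (_ + _).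
    by rewrite /V !big_seq; apply: eq_bigr => b /count_b ->.
  have E0 := pair_count 0; have E2 := pair_count 2; have E1 := pair_count 1.
  have E1' : \sum_(a <- B) \sum_(b <- B) (kappa b + 1 == kappa a)%N%:Z
      = \sum_(a <- B) \sum_(b <- B) (kappa a + 1 == kappa b)%N%:Z.
    by rewrite exchange_big.
  have -> : \sum_(j < 2 * M) V j * V j = \sum_(j < 2 * M) V j * V (j + 0)%N.
    by apply: eq_bigr => j _; rewrite addn0.
  rewrite -E0 -E2 -[RHS]addr0.
  rewrite -[X in _ + X](subrr (\sum_(a <- B) \sum_(b <- B) (kappa a + 1 == kappa b)%N%:Z)).
  rewrite -{1}E1' -!sumrN -!big_split !big_seq; apply: eq_bigr => a aB.
  rewrite -!sumrN -!big_split !big_seq; apply: eq_bigr => b bB /=.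
  move: aB bB; case: a b => [a1 a2] [b1 b2] /small a_M /small b_M /=.
  set u := a2%:Z - b2%:Z; set v := a1%:Z - b1%:Z.
  have -> : (u == 2 * v) = (kappa (a1, a2) + 0 == kappa (b1, b2))%N.
    by rewrite /u /v /kappa /=; apply/eqP/eqP; lia.
  have -> : (u + 1 == 2 * (v + 1)) = (kappa (a1, a2) + 1 == kappa (b1, b2))%N.
    by rewrite /u /v /kappa /=; apply/eqP/eqP; lia.
  have -> : (u + 1 == 2 * v) = (kappa (b1, b2) + 1 == kappa (a1, a2))%N.
    by rewrite /u /v /kappa /=; apply/eqP/eqP; lia.
  have -> : (u == 2 * (v + 1)) = (kappa (a1, a2) + 2 == kappa (b1, b2))%N.
    by rewrite /u /v /kappa /=; apply/eqP/eqP; lia.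
  ring.
have := square_ge.
have -> : \sum_(j < 2 * M) (V j - V (j + 2)%N) ^+ 2
    = (\sum_(j < 2 * M) V j * V j - \sum_(j < 2 * M) V j * V (j + 2)%N) *+ 2.
  rewrite mulr2n addrACA -{2}shift_sq -!sumrN -!big_split.
  by apply: eq_bigr => j _ /=; ring.
rewrite tansumE; lia.
Qed.
End Content.

Lemma tansum_special (B : seq (nat * nat)) :
  tansum B B (fun u v => (u == 2 * v)%:Z) <= - (count_mem (0, 1)%N B)%:Z.
Proof.
apply: (@tansum_special_le B (\sum_(b <- B) (2 * b.1 + b.2)).+4) => // i j.
elim: B => //= b B IHB; rewrite inE big_cons => /orP[/eqP <- /=|/IHB]; lia.
Qed.

Definition column (n : nat) : seq (nat * nat) := [seq (i, 0%N) | i <- iota 0 n].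

Lemma boxes_column n : boxes (nseq n 1%N) = column n.
Proof.
have gen s : all (ltn^~ n) s ->
    [seq (i, j) | i <- s, j <- iota 0 (nth 0%N (nseq n 1%N) i)] = [seq (i, 0%N) | i <- s].
  by elim: s => //= i s IHs /andP[i_n /IHs ->]; rewrite nth_nseq i_n.
by rewrite /boxes size_nseq gen //; apply/allP => i; rewrite mem_iota.
Qed.

Lemma part_column rho : is_part rho -> (0, 1)%N \notin boxes rho ->
  rho = nseq (size rho) 1%N.
Proof.
case: rho => // x rho /andP[/= le_x]; rewrite inE negb_or => /andP[x0 rho0] no01.
have x1 : x = 1%N.
  have : ~~ (1 < x)%N.
    apply: contra no01 => x_gt1; apply/allpairsPdep; exists 0%N, 1%N.
    by split; rewrite ?mem_iota //=.
  by move: x0; case: x {le_x no01} => [|[|x]].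
congr (_ :: _) => //; apply/all_pred1P/allP => y y_rho /=.
have y_x : (y <= x)%N.
  have geq_trans : transitive geq by move=> a b c /= ab bc; apply: leq_trans bc ab.
  by move/(order_path_min geq_trans)/allP/(_ y y_rho): le_x.
have : y != 0%N by apply: contraNneq rho0 => <-.
by rewrite eqn_leq; lia.
Qed.

Lemma ratio_telescope (L : fieldType) n (f : nat -> L) : (forall i, f i != 0) ->
  \prod_(i < n) (f i.+1 / f i) = f n / f 0%N.
Proof.
move=> f0; elim: n => [|n IHn]; first by rewrite big_ord0 divff.
by rewrite big_ord_recr IHn /= mulrC mulrA divfK.
Qed.

Section Columns.

Let big_column (R : Type) (idx : R) (op : Monoid.com_law idx) k (F : nat * nat -> R) :
  \big[op/idx]_(b <- column k) F b = \big[op/idx]_(i < k) F (i : nat, 0%N).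
Proof.
by rewrite big_map -(big_mkord xpredT (fun i => F (i, 0%N))) /index_iota subn0.
Qed.

(** For columns the sum over the boxes of the dual factor telescopes. *)
Lemma tansum_column (V : zmodType) n m (c : int -> int -> V) :
  tansum (column n) (column m) c
  = \sum_(i < m) (c 0 (n%:Z - i%:Z) + c 1 (- i%:Z) - c 1 (n%:Z - i%:Z)).
Proof.
rewrite /tansum !big_column.
under [X in _ - X]eq_bigr => a _ do rewrite big_column.
rewrite exchange_big -sumrB; apply: eq_bigr => i _ /=.
pose f (a : nat) := c 1 (a%:Z - i%:Z) - c 0 (a%:Z - i%:Z).
rewrite (eq_bigr (fun a : 'I_n => f a.+1 - f a)); last first.
  move=> a _; rewrite /f (_ : a%:Z - i%:Z + 1 = a.+1%:Z - i%:Z); last by lia.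
  rewrite subrr add0r opprB [RHS]addrACA [c 0 _ + c 1 _]addrC -!addrA.
  by do 2!congr (_ + _); rewrite addrC.
rewrite -(big_mkord xpredT (fun a => f a.+1 - f a)) telescope_sumr // /f sub0r.
by rewrite oppr0 opprB addrA [c 0 (- _) + _]addrC subrK opprB addrCA addrA.
Qed.

Lemma tanprod_column (L : fieldType) n m (g : int -> int -> L) :
  (forall u v, g u v != 0) ->
  tanprod (column n) (column m) g
  = \prod_(i < m) (g 0 (n%:Z - i%:Z) * g 1 (- i%:Z) / g 1 (n%:Z - i%:Z)).
Proof.
move=> g0; rewrite /tanprod !big_column.
under [X in _ / X]eq_bigr => a _ do rewrite big_column.
rewrite exchange_big -prodf_div; apply: eq_bigr => i _ /=.
pose f (a : nat) := g 1 (a%:Z - i%:Z) / g 0 (a%:Z - i%:Z).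
rewrite (eq_bigr (fun a : 'I_n => f a.+1 / f a)); last first.
  move=> a _; rewrite /f (_ : a%:Z - i%:Z + 1 = a.+1%:Z - i%:Z); last by lia.
  by rewrite subrr add0r; field; rewrite !g0.
rewrite ratio_telescope => [|a]; last by rewrite mulf_neq0 ?invr_eq0.
by rewrite /f sub0r; field; rewrite !g0.
Qed.
End Columns.

(** * Restriction to t_1^2 t_2 = 1 *)

Section Regular.
Variables (A B : idomainType) (sigma : {rmorphism A -> B}).
Implicit Types (f g : {fraction A}) (u v : {fraction B}).

(** f has no pole along the kernel of sigma, and v is its restriction. *)
Definition regular f v := exists p q,
  [/\ sigma q != 0, f = p%:F / q%:F & v = (sigma p)%:F / (sigma q)%:F].

Let q_neq0 q : sigma q != 0 -> q != 0.
Proof. by apply: contra => /eqP ->; rewrite rmorph0. Qed.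

Lemma regular_tofrac p : regular p%:F (sigma p)%:F.
Proof. by exists p, 1; rewrite !rmorph1 !divr1 oner_neq0. Qed.

Lemma regular0 : regular 0 0.
Proof. by have := regular_tofrac 0; rewrite !rmorph0. Qed.

Lemma regular1 : regular 1 1.
Proof. by have := regular_tofrac 1; rewrite !rmorph1. Qed.

Lemma regularD f g u v : regular f u -> regular g v -> regular (f + g) (u + v).
Proof.
move=> [p [q [q0 -> ->]]] [p' [q' [q'0 -> ->]]].
exists (p * q' + p' * q), (q * q'); rewrite !rmorphM !rmorphD !rmorphM mulf_neq0 //.
by rewrite !addf_div ?tofrac_eq0 ?q_neq0.
Qed.

Lemma regularM f g u v : regular f u -> regular g v -> regular (f * g) (u * v).
Proof.
move=> [p [q [q0 -> ->]]] [p' [q' [q'0 -> ->]]].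
exists (p * p'), (q * q'); rewrite !rmorphM mulf_neq0 //.
by rewrite !mulf_div.
Qed.

Lemma regularN f u : regular f u -> regular (- f) (- u).
Proof.
by move=> [p [q [q0 -> ->]]]; exists (- p), q; rewrite !rmorphN !mulNr.
Qed.

Lemma regularV f u : u != 0 -> regular f u -> regular f^-1 u^-1.
Proof.
move=> u0 [p [q [q0 fE uE]]]; exists q, p; rewrite fE uE !invf_div; split=> //.
by apply: contraNneq u0 => p0; rewrite uE p0 tofrac0 mul0r.
Qed.

Lemma regular_sum (I : Type) (r : seq I) (P : pred I) (f : I -> {fraction A})
    (u : I -> {fraction B}) :
  (forall i, P i -> regular (f i) (u i)) ->
  regular (\sum_(i <- r | P i) f i) (\sum_(i <- r | P i) u i).
Proof.
move=> fu; elim/big_rec2: _ => [|i g v Pi gv]; first exact: regular0.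
exact: regularD (fu i Pi) gv.
Qed.

Lemma regular_prod (I : Type) (r : seq I) (P : pred I) (f : I -> {fraction A})
    (u : I -> {fraction B}) :
  (forall i, P i -> regular (f i) (u i)) ->
  regular (\prod_(i <- r | P i) f i) (\prod_(i <- r | P i) u i).
Proof.
move=> fu; elim/big_rec2: _ => [|i g v Pi gv]; first exact: regular1.
exact: regularM (fu i Pi) gv.
Qed.

(** Units of the local ring at the kernel of sigma. *)
Definition runit f := exists2 v, v != 0 & regular f v.

Lemma runit1 : runit 1.
Proof. by exists 1; [exact: oner_neq0 | exact: regular1]. Qed.

Lemma runitM f g : runit f -> runit g -> runit (f * g).
Proof.
move=> [u u0 fu] [v v0 gv]; exists (u * v); [exact: mulf_neq0 | exact: regularM].
Qed.

Lemma runitV f : runit f -> runit f^-1.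
Proof. by case=> u u0 fu; exists u^-1; [rewrite invr_eq0 | apply: regularV]. Qed.

Lemma runit_neq0 f : runit f -> f != 0.
Proof.
case=> v v0 [p [q [q0 fE vE]]]; rewrite fE mulf_neq0 ?invr_eq0 ?tofrac_eq0 ?q_neq0 //.
by apply: contraNneq v0 => p0; rewrite vE p0 !rmorph0 mul0r.
Qed.

Lemma runit_prod (I : Type) (r : seq I) (f : I -> {fraction A}) :
  (forall i, runit (f i)) -> runit (\prod_(i <- r) f i).
Proof. by move=> fu; elim/big_rec: _ => [|i g _]; [exact: runit1 | apply: runitM]. Qed.

Lemma runit_tofrac p : sigma p != 0 -> runit p%:F.
Proof. by move=> p0; exists (sigma p)%:F; [rewrite tofrac_eq0 | exact: regular_tofrac]. Qed.

Lemma runit_tanprod Bk Bl (g : int -> int -> {fraction A}) :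
  (forall i j : int, runit (g i j)) -> runit (tanprod Bk Bl g).
Proof.
move=> gu; apply: runitM; first by apply: runit_prod.
apply: runitV; apply: runit_prod => a; apply: runit_prod => b /=.
by do ?[apply: runitM | apply: runitV].
Qed.

End Regular.

Lemma tanprodM (L : fieldType) Bk Bl (g h : int -> int -> L) :
  tanprod Bk Bl (fun u v => g u v * h u v) = tanprod Bk Bl g * tanprod Bk Bl h.
Proof.
rewrite /tanprod big_split mulf_div; congr (_ / _); rewrite -big_split.
apply: eq_bigr => a _; rewrite -big_split; apply: eq_bigr => b _ /=.
by rewrite mulf_div; congr (_ / _); rewrite mulrACA.
Qed.

Lemma prodr_exprz (L : fieldType) (x : L) (I : Type) (s : seq I) (F : I -> int) : x != 0 ->
  \prod_(i <- s) x ^ F i = x ^ (\sum_(i <- s) F i).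
Proof.
by move=> x0; elim/big_rec2: _ => [|i a b _ ->]; rewrite ?expr0z // expfzDr.
Qed.

Lemma tanprod_exp (L : fieldType) Bk Bl (x : L) (e : int -> int -> int) : x != 0 ->
  tanprod Bk Bl (fun u v => x ^ e u v) = x ^ tansum Bk Bl e.
Proof.
move=> x0; have prodX I r F := @prodr_exprz L x I r F x0.
rewrite /tanprod /tansum prodX expfzDr // -invr_expz; congr (_ / _).
rewrite -prodX; apply: eq_bigr => a _; rewrite -prodX; apply: eq_bigr => b _ /=.
by rewrite -!expfzDr // invr_expz -expfzDr // opprD !addrA.
Qed.

Lemma tansumB (Bk Bl : seq (nat * nat)) (c c' : int -> int -> int) :
  tansum Bk Bl (fun u v => c u v - c' u v) = tansum Bk Bl c - tansum Bk Bl c'.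
Proof.
rewrite /tansum [X in X - _ = _]sumrB opprD opprK [RHS]addrACA; congr (_ + _).
rewrite -!sumrN -big_split; apply: eq_bigr => a _ /=.
by rewrite -!sumrN -big_split; apply: eq_bigr => b _ /=; ring.
Qed.

Section ColumnSum.
Variables (L : fieldType) (N r : nat) (lam tau : L) (m : 'I_N -> L) (w : 'I_r -> L).

(** The contribution of the fixed point whose k-th partition is a column of
    length d k, with lam and tau in the place of the weights lambda_1 and
    lambda_2. These are the fixed points of the Quot schemes of a line of
    tangent weight tau. *)
Definition colterm (d : 'I_N -> nat) : L :=
  (\prod_(k < N) \prod_(j < r) \prod_(i < d k) (1 + (w j + m k - tau *+ i)))^-1
  / \prod_(k < N) \prod_(l < N) \prod_(i < d l)
      ((m l - m k + tau *~ ((d k)%:Z - i%:Z)) * (m l - m k + lam + tau *~ (- i%:Z))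
       / (m l - m k + lam + tau *~ ((d k)%:Z - i%:Z))).

Definition colsum (D : nat) : L :=
  \sum_(d : {ffun 'I_N -> 'I_D.+1} | (\sum_k d k)%N == D) colterm (fun k => d k).

End ColumnSum.

Section Specialization.
Variables (C : fieldType) (n N r : nat).
Hypothesis C_char0 : forall k, k.+1%:R != 0 :> C.
Local Notation P := {mpoly C[n]}.
Local Notation K := {fraction P}.
Variables (i1 i2 : 'I_n) (iy : 'I_N -> 'I_n) (iv : 'I_r -> 'I_n).
Hypotheses (i12 : i1 != i2) (iy_inj : injective iy).
Hypotheses (iy_t : forall k, (iy k != i1) && (iy k != i2)).
Hypotheses (iv_t : forall j, (iv j != i1) && (iv j != i2)).

(** The restriction to lambda_2 = - 2 lambda_1, that is to t_1^2 t_2 = 1. *)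
Definition spec_var (i : 'I_n) : P := if i == i2 then - ('X_i1 *+ 2) else 'X_i.
Definition spec : P -> P := lsub spec_var.
HB.instance Definition _ := GRing.RMorphism.on spec.

Lemma spec_var_lin i : spec_var i \is 1.-homog.
Proof.
by rewrite /spec_var; case: eqP => _; rewrite ?rpredN ?rpredMn // mpolyX_dhomog.
Qed.

Lemma spec_i1 : spec 'X_i1 = 'X_i1.
Proof. by rewrite /spec lsubX /spec_var (negPf i12). Qed.
Lemma spec_i2 : spec 'X_i2 = - ('X_i1 *+ 2).
Proof. by rewrite /spec lsubX /spec_var eqxx. Qed.
Lemma spec_iy k : spec 'X_(iy k) = 'X_(iy k).
Proof. by rewrite /spec lsubX /spec_var; case/andP: (iy_t k) => _ /negPf ->. Qed.
Lemma spec_iv j : spec 'X_(iv j) = 'X_(iv j).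
Proof. by rewrite /spec lsubX /spec_var; case/andP: (iv_t j) => _ /negPf ->. Qed.

Local Notation reg := (regular spec).
Local Notation X1 := (('X_i1 : P)%:F).
Local Notation X2 := (('X_i2 : P)%:F).
Local Notation Y := (fun k => ('X_(iy k) : P)%:F).
Local Notation V := (fun j => ('X_(iv j) : P)%:F).
Let lam : K := X1.
Let tau : K := - (X1 *+ 2).

Lemma intr_neq0 (z : int) : z != 0 -> z%:~R != 0 :> C.
Proof.
case: z => [[|k]|k] // _; first by rewrite -pmulrn C_char0.
by rewrite NegzE mulrNz oppr_eq0 -pmulrn C_char0.
Qed.

Definition wpoly k l (u v : int) : P := 'X_(iy l) - 'X_(iy k) + 'X_i1 *~ u + 'X_i2 *~ v.

Lemma wpolyE k l u v : (wpoly k l u v)%:F = Y l - Y k + X1 *~ u + X2 *~ v.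
Proof. by rewrite /wpoly !(rmorphD, rmorphN, rmorphMz). Qed.

Lemma spec_wpoly k l u v :
  spec (wpoly k l u v) = 'X_(iy l) - 'X_(iy k) + 'X_i1 *~ (u - 2 * v).
Proof.
rewrite /wpoly !(rmorphD, rmorphN, rmorphMz) /= !spec_iy spec_i1 spec_i2; ring.
Qed.

Lemma spec_wpoly_eq0 k l u v : (spec (wpoly k l u v) == 0) = (k == l) && (u == 2 * v).
Proof.
rewrite spec_wpoly; have [<-|k_l] := eqVneq k l.
  rewrite subrr add0r -(subr_eq0 u); have [->|uv] := eqVneq (u - 2 * v) 0.
    by rewrite mulr0z eqxx.
  apply/negbTE/eqP => /(congr1 (meval (fun i => (i == i1)%:R))).
  by rewrite rmorphMz /= mevalXU meval0 eqxx => /eqP; rewrite (negPf (intr_neq0 uv)).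
apply/negbTE/eqP => /(congr1 (meval (fun i => (i == iy l)%:R))).
case/andP: (iy_t l) => yl _.
rewrite !(rmorphD, rmorphN, rmorphMz) /= !mevalXU meval0 eqxx (inj_eq iy_inj).
rewrite (negPf k_l) eq_sym (negPf yl) /= mul0rz subr0 addr0 => /eqP.
by rewrite oner_eq0.
Qed.

Lemma spec_wpolyF k l u v :
  (spec (wpoly k l u v))%:F = Y l - Y k + lam *~ u + tau *~ v.
Proof.
rewrite spec_wpoly !(rmorphD, rmorphN, rmorphMz) /= /lam /tau; ring.
Qed.

Definition segpoly k j (a b : nat) : P := 1 + ('X_(iv j) + 'X_(iy k) - 'X_i1 *+ b - 'X_i2 *+ a).

Lemma spec_segpoly k j a b : spec (segpoly k j a b) != 0.
Proof.
apply/eqP => /(congr1 (meval (fun=> 0))).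
rewrite /segpoly !(rmorphD, rmorphN, rmorphMn) rmorph1 /= spec_iv spec_iy spec_i1 spec_i2.
rewrite !(rmorphD, rmorphN, rmorphMn) rmorph1 /= !mevalXU meval0 !(mul0rn, oppr0, subr0, addr0) => /eqP.
by rewrite oner_eq0.
Qed.

Lemma spec_segpolyF k j a b :
  (spec (segpoly k j a b))%:F = 1 + (V j + Y k - lam *+ b - tau *+ a).
Proof.
rewrite /segpoly !(rmorphD, rmorphN, rmorphMn) rmorph1 /=.
rewrite spec_iv spec_iy spec_i1 spec_i2 !(rmorphD, rmorphN, rmorphMn) rmorph1 /=.
by rewrite /lam /tau; ring.
Qed.

Let ell : P := 'X_i1 *+ 2 + 'X_i2.

Let spec_ell : spec ell = 0.
Proof. by rewrite /ell rmorphD rmorphMn /= spec_i1 spec_i2 subrr. Qed.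

Let ell_neq0 : ell%:F != 0 :> K.
Proof.
rewrite tofrac_eq0; apply/eqP => /(congr1 (meval (fun i => (i == i2)%:R))).
rewrite rmorphD rmorphMn /= !mevalXU meval0 eqxx (negPf i12) mul0rn add0r => /eqP.
by rewrite oner_eq0.
Qed.

(* The exponent to which ell divides the weight: ell is a factor of the weights
   that vanish on the line, except of the trivial ones, which were replaced
   by 1. *)
Let killed (k l : 'I_N) (u v : int) : int := ((k == l) && (u == 2 * v))%:Z - (trivial_wt k l u v)%:Z.

Let weight_unit k l u v :
  runit spec (fpweight X1 X2 Y k l u v * ell%:F ^ (- killed k l u v)).
Proof.
rewrite /fpweight /killed; case: ifP => [/and3P[/eqP-> /eqP-> /eqP->]|ntriv].
  by rewrite mulr0 !eqxx subrr oppr0 expr0z mulr1; apply: runit1.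
rewrite -wpolyE; have [/andP[/eqP kl /eqP uv]|not_killed] := boolP ((k == l) && (u == 2 * v)).
  have v0 : v != 0 by move: ntriv; rewrite /trivial_wt kl uv eqxx mulf_eq0 /=; case: eqP.
  rewrite kl uv wpolyE subrr add0r; set e := - _; have -> : e = -1 by [].
  rewrite exprN1 (_ : _ + _ = ell%:F * (v%:~R : P)%:F); last first.
    by rewrite mulrzA -mulrzDl rmorph_int mulrzr /ell rmorphD rmorphMn.
  rewrite mulrC mulKf //; apply: runit_tofrac; rewrite rmorph_int.
  rewrite -(rmorph_int (@mpolyC n C)) mpolyC_eq0; exact: intr_neq0.
rewrite subr0 oppr0 expr0z mulr1; apply: runit_tofrac.
by rewrite spec_wpoly_eq0.
Qed.

Let runit_segre (B : 'I_N -> seq (nat * nat)) : runit spec (fpsegre X1 X2 Y V B).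
Proof.
apply: runit_prod => k; apply: runit_prod => j; apply: runit_prod => b.
rewrite (_ : _ + _ = (segpoly k j b.1 b.2)%:F); last first.
  by rewrite /segpoly !(rmorphD, rmorphN, rmorphMn) rmorph1 /= !addrA.
exact/runit_tofrac/spec_segpoly.
Qed.

(** Freed from its factor ell, every weight is a unit on the line. By
    tansum_special the product of the weights carries a negative power of ell
    as soon as the box (0, 1) occurs; a pole of the Euler class makes the
    contribution vanish on the line. *)
Lemma reg_fpterm_noncolumn (B : 'I_N -> seq (nat * nat)) k0 : (0, 1)%N \in B k0 ->
  reg (fpterm X1 X2 Y V B) 0.
Proof.
move=> k0_01; rewrite /fpterm; case: ifP => [/eqP triv0|_]; last exact: regular0.
pose U k l u v := fpweight X1 X2 Y k l u v * ell%:F ^ (- killed k l u v).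
pose mult : int := \sum_(k < N) \sum_(l < N) tansum (B k) (B l) (killed k l).
have prodX I s F := @prodr_exprz K ell%:F I s F ell_neq0.
have -> : \prod_(k < N) \prod_(l < N) tanprod (B k) (B l) (fpweight X1 X2 Y k l)
    = (\prod_(k < N) \prod_(l < N) tanprod (B k) (B l) (U k l)) * ell%:F ^ mult.
  rewrite /mult -prodX -big_split; apply: eq_bigr => k _.
  rewrite -prodX -big_split; apply: eq_bigr => l _ /=.
  rewrite -tanprod_exp // -tanprodM; apply: eq_tanprod => u v.
  by rewrite /U -mulrA -expfzDr // addNr expr0z mulr1.
have mult_lt0 : mult < 0.
  have -> : mult = \sum_(k < N) tansum (B k) (B k) (fun u v => (u == 2 * v)%:Z).
    transitivity (\sum_(k < N) tansum (B k) (B k) (fun u v => (u == 2 * v)%:Z) - fptrivial B).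
      2: by rewrite triv0 subr0.
    rewrite /mult /fptrivial -sumrB; apply: eq_bigr => k _.
    have -> : tansum (B k) (B k) (fun u v => (u == 2 * v)%:Z) = \sum_(l < N)
        tansum (B k) (B l) (fun u v => ((k == l) && (u == 2 * v))%:Z).
      rewrite (bigD1 k) //= eqxx [X in _ + X]big1 ?addr0 // => l /negPf l_k.
      rewrite eq_sym l_k /tansum [X in X - _]big1 // [X in _ - X]big1 ?subr0 // => a _.
      by rewrite big1.
    by rewrite -sumrB; apply: eq_bigr => l _; rewrite /killed tansumB.
  apply: le_lt_trans (_ : - (count_mem (0, 1)%N (B k0))%:Z < 0); last first.
    by rewrite oppr_lt0 ltz_nat -has_count has_pred1.
  rewrite (bigD1 k0) //= -[leRHS]addr0 lerD ?tansum_special //.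
  apply: sumr_le0 => k _; apply: le_trans (tansum_special _) _.
  by rewrite oppr_le0.
have [e multE] : exists e : nat, mult = - e.+1%:Z by exists (`|mult|.-1)%N; lia.
rewrite multE -invr_expz invfM invrK mulrA -exprnP exprS.
have reg_ell : reg ell%:F 0 by rewrite -(rmorph0 (@tofrac P)) -spec_ell; apply: regular_tofrac.
have [u u0 prod_u] : runit spec ((fpsegre X1 X2 Y V B)^-1
    / \prod_(k < N) \prod_(l < N) tanprod (B k) (B l) (U k l)).
  apply: runitM; first exact/runitV/runit_segre.
  apply/runitV; apply: runit_prod => k; apply: runit_prod => l.
  by apply: runit_tanprod => i j; apply: weight_unit.
have [v reg_e] : exists v, reg (ell%:F ^+ e) v.
  elim: e {multE} => [|e [v IHe]]; first by exists 1; apply: regular1.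
  by exists (0 * v); rewrite exprS; apply: regularM.
have := regularM prod_u (regularM reg_ell reg_e).
by rewrite mul0r mulr0.
Qed.

Lemma fptrivial_column (d : 'I_N -> nat) : fptrivial (fun k => column (d k)) = 0.
Proof.
rewrite /fptrivial big1 // => k _; rewrite big1 // => l _.
rewrite tansum_column big1 // => i _; rewrite /trivial_wt !andbF /= addr0 subr0.
have [kl /=|//] := eqVneq k l; rewrite (_ : _ == 0 = false) //.
by apply/negbTE; move: i; rewrite kl => i; have := ltn_ord i; lia.
Qed.

Lemma colweight_neq0 k l (u v : int) : (k == l) && (u == 2 * v) = false ->
  Y l - Y k + lam *~ u + tau *~ v != 0.
Proof. by move=> nt; rewrite -spec_wpolyF tofrac_eq0 spec_wpoly_eq0 nt. Qed.

Lemma reg_fpterm_column (d : 'I_N -> nat) :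
  reg (fpterm X1 X2 Y V (fun k => column (d k))) (colterm lam tau Y V d).
Proof.
have reg_w k l u v : (k == l) && (u == 2 * v) = false ->
    reg (fpweight X1 X2 Y k l u v) (Y l - Y k + lam *~ u + tau *~ v).
  move=> nt; rewrite /fpweight ifF.
    by rewrite -wpolyE -spec_wpolyF; apply: regular_tofrac.
  by apply: contraFF nt => /and3P[-> /eqP -> /eqP ->].
have odd_v (v : int) : (1 == 2 * v) = false by apply/negbTE; lia.
have w_neq0 k l u v : fpweight X1 X2 Y k l u v != 0.
  by have := runit_neq0 (weight_unit k l u v); apply: contra => /eqP ->; rewrite mul0r.
rewrite /fpterm fptrivial_column eqxx; apply: regularM.
  have -> : fpsegre X1 X2 Y V (fun k => column (d k))
      = \prod_(k < N) \prod_(j < r) \prod_(i < d k) (segpoly k j i 0)%:F.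
    apply: eq_bigr => k _; apply: eq_bigr => j _.
    rewrite big_map -(big_mkord xpredT (fun i => (segpoly k j i 0)%:F)) /index_iota subn0.
    apply: eq_bigr => i _.
    by rewrite /segpoly !(rmorphD, rmorphN, rmorphMn) rmorph1 /= !addrA.
  have reg_seg : reg (\prod_(k < N) \prod_(j < r) \prod_(i < d k) (segpoly k j i 0)%:F)^-1
      (\prod_(k < N) \prod_(j < r) \prod_(i < d k) (spec (segpoly k j i 0))%:F)^-1.
    apply: regularV.
      apply/prodf_neq0 => k _; apply/prodf_neq0 => j _; apply/prodf_neq0 => i _.
      by rewrite tofrac_eq0 spec_segpoly.
    apply: regular_prod => k _; apply: regular_prod => j _; apply: regular_prod => i _.
    exact: regular_tofrac.
  suff <- : \prod_(k < N) \prod_(j < r) \prod_(i < d k) (spec (segpoly k j i 0))%:F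
      = \prod_(k < N) \prod_(j < r) \prod_(i < d k) (1 + (V j + Y k - tau *+ i)) by [].
  apply: eq_bigr => k _; apply: eq_bigr => j _; apply: eq_bigr => i _.
  by rewrite spec_segpolyF mulr0n subr0.
have nt0 (k l : 'I_N) (i : 'I_(d l)) :
    (k == l) && (0 == 2 * ((d k)%:Z - i%:Z)) = false.
  have [kl /=|//] := eqVneq k l; apply/negbTE; move: i; rewrite kl => i.
  by have := ltn_ord i; lia.
have u0 k l (i : 'I_(d l)) := colweight_neq0 (nt0 k l i).
have u1 k l v : Y l - Y k + lam + tau *~ v != 0.
  by have := @colweight_neq0 k l 1 v; rewrite mulr1z; apply; rewrite odd_v andbF.
apply: regularV.
  apply/prodf_neq0 => k _; apply/prodf_neq0 => l _; apply/prodf_neq0 => i _.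
  have := u0 k l i; rewrite mulr0z addr0 => u0'.
  apply: mulf_neq0; first exact: mulf_neq0 u0' (u1 _ _ _).
  by rewrite invr_eq0; apply: u1.
apply: regular_prod => k _; apply: regular_prod => l _.
rewrite (tanprod_column _ _ (w_neq0 k l)); apply: regular_prod => i _.
have := reg_w k l 0 _ (nt0 k l i); rewrite mulr0z addr0 => r0.
have r1 v : reg (fpweight X1 X2 Y k l 1 v) (Y l - Y k + lam + tau *~ v).
  by have := @reg_w k l 1 v; rewrite mulr1z; apply; rewrite odd_v andbF.
apply: regularM; first exact: regularM r0 (r1 _).
exact: regularV (u1 _ _ _) (r1 _).
Qed.

End Specialization.

Lemma column_part D n : (n <= D)%N -> nseq n 1%N \in parts_le D.
Proof.
rewrite mem_parts_le sumn_nseq mul1n => ->; rewrite andbT /is_part mem_nseq andbF andbT.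
by elim: n => //= -[|n] //= ->.
Qed.

Section ReindexColumns.
Variables (N D : nat).

Definition is_column (pi : {ffun 'I_N -> seq_sub (parts_le D)}) :=
  [forall k, (0, 1)%N \notin boxes (ssval (pi k))].

Lemma is_columnP pi : is_column pi ->
  forall k, ssval (pi k) = nseq (size (ssval (pi k))) 1%N.
Proof.
move=> /forallP col k; apply: part_column (col k).
by have := ssvalP (pi k); rewrite mem_parts_le => /andP[].
Qed.

Lemma size_column_le pi : is_column pi -> forall k, (size (ssval (pi k)) < D.+1)%N.
Proof.
move=> /is_columnP col k; rewrite ltnS; have := ssvalP (pi k).
by rewrite mem_parts_le => /andP[_]; rewrite {1}(col k) sumn_nseq mul1n.
Qed.

Lemma column_proof (i : 'I_D.+1) : nseq i 1%N \in parts_le D.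
Proof. by apply: column_part; rewrite -ltnS. Qed.

Lemma sum_columns (V : nmodType) (F : ('I_N -> nat) -> V) :
  \sum_(pi : {ffun 'I_N -> seq_sub (parts_le D)} |
      ((\sum_k sumn (ssval (pi k)))%N == D) && is_column pi)
    F (fun k => size (ssval (pi k)))
  = \sum_(d : {ffun 'I_N -> 'I_D.+1} | (\sum_k d k)%N == D) F (fun k => d k).
Proof.
pose h (d : {ffun 'I_N -> 'I_D.+1}) : {ffun 'I_N -> seq_sub (parts_le D)} :=
  [ffun k => SeqSub (column_proof (d k))].
pose h' (pi : {ffun 'I_N -> seq_sub (parts_le D)}) : {ffun 'I_N -> 'I_D.+1} :=
  [ffun k => inord (size (ssval (pi k)))].
have size_h d k : size (ssval (h d k)) = d k by rewrite ffunE size_nseq.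
rewrite (reindex_onto h h') => [|pi /andP[_ col]]; last first.
  apply/ffunP => k; apply/val_inj; rewrite /= !ffunE /= ?ffunE inordK ?size_column_le //.
  by rewrite -(is_columnP col).
apply: eq_big => [d|d _]; last first.
  by congr F; apply/boolp.funext => k.
have -> : h' (h d) == d.
  by apply/eqP/ffunP => k; rewrite ffunE size_h inord_val.
have -> : is_column (h d).
  apply/forallP => k; rewrite ffunE /= boxes_column.
  by apply/negP => /mapP[i _ []].
rewrite !andbT; congr (_ == _); apply: eq_bigr => k _.
by rewrite ffunE /= sumn_nseq mul1n.
Qed.

End ReindexColumns.

Section RegularSeries.
Variables (C : fieldType) (n N r : nat).
Hypothesis C_char0 : forall k, k.+1%:R != 0 :> C.
Local Notation P := {mpoly C[n]}.
Local Notation K := {fraction P}.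
Variables (i1 i2 : 'I_n) (iy : 'I_N -> 'I_n) (iv : 'I_r -> 'I_n).
Hypotheses (i12 : i1 != i2) (iy_inj : injective iy).
Hypotheses (iy_t : forall k, (iy k != i1) && (iy k != i2)).
Hypotheses (iv_t : forall j, (iv j != i1) && (iv j != i2)).

Local Notation X i := (('X_i : P)%:F).

(** On t_1^2 t_2 = 1 only the columns contribute: the Segre series of the surface
    becomes that of a curve. *)
Lemma reg_fpsum D :
  regular (@spec C n i1 i2)
    (fpsum (X i1) (X i2) (fun k => X (iy k)) (fun j => X (iv j)) D)
    (colsum (X i1) (- (X i1 *+ 2)) (fun k => X (iy k)) (fun j => X (iv j)) D).
Proof.
rewrite /colsum -sum_columns big_mkcondr /=; apply: regular_sum => pi _.
case: ifP => [col|/negbT].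
  rewrite (_ : (fun k => boxes (ssval (pi k))) = (fun k => column (size (ssval (pi k))))).
    exact: reg_fpterm_column.
  by apply/boolp.funext => k; rewrite {1}(is_columnP col) boxes_column.
rewrite negb_forall => /existsP[k]; rewrite negbK => pi_k.
exact: reg_fpterm_noncolumn (pi_k).
Qed.

End RegularSeries.

(** * Symmetry on the curve *)

Section PairProducts.
Variable L : fieldType.

Lemma prod_pairs n (F : 'I_n -> 'I_n -> L) :
  \prod_k \prod_l F k l
  = (\prod_k F k k) * \prod_(k < n) \prod_(l < n | (k < l)%N) (F k l * F l k).
Proof.
pose low := \prod_(k < n) \prod_(l < n | (l < k)%N) F k l.
pose upp := \prod_(k < n) \prod_(l < n | (k < l)%N) F k l.
have -> : \prod_(k < n) \prod_(l < n | (k < l)%N) (F k l * F l k) = upp * low.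
  under eq_bigr do rewrite big_split.
  rewrite big_split; congr (_ * _); rewrite (exchange_big_dep xpredT) //=.
rewrite -!big_split; apply: eq_bigr => k _ /=.
rewrite (bigD1 k) //=; congr (_ * _).
rewrite (bigID (fun l : 'I_n => (k < l)%N)) /=; congr (_ * _).
  by apply: eq_bigl => l; rewrite -val_eqE /=; case: ltngtP.
by apply: eq_bigl => l; rewrite -val_eqE /= -leqNgt; case: ltngtP.
Qed.

(** Both sides are the product of the g (j - i) / g (j + 1 - i) over i < a and
    j < b, which telescopes in either direction. *)
Lemma prod_shift_exchange (g : int -> L) (a b : nat) : (forall v, g v != 0) ->
  \prod_(i < a) (g (- i%:Z) / g (b%:Z - i%:Z))
  = \prod_(j < b) (g (j.+1%:Z - a%:Z) / g j.+1%:Z).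
Proof.
move=> g0; have tel n f := @ratio_telescope L n f.
transitivity (\prod_(i < a) \prod_(j < b) (g (j%:Z - i%:Z) / g (j.+1%:Z - i%:Z))).
  apply: eq_bigr => i _.
  transitivity (g (b%:Z - i%:Z) / g (0%N%:Z - i%:Z))^-1; first by rewrite invf_div sub0r.
  have /= <- := tel b (fun j => g (j%:Z - i%:Z)) (fun _ => g0 _); rewrite -prodfV.
  by apply: eq_bigr => j _; rewrite invf_div.
rewrite exchange_big; apply: eq_bigr => j _ /=.
transitivity (g (j.+1%:Z - a%:Z) / g (j.+1%:Z - 0%N%:Z)); last by rewrite subr0.
have /= <- := tel a (fun i => g (j.+1%:Z - i%:Z)) (fun _ => g0 _).
apply: eq_bigr => i _.
by congr (g _ / _); lia.
Qed.

(** Both sides enumerate the values of phi on the interval from - b to a. *)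
Lemma prod_interval (phi : int -> L) (a b : nat) :
  (\prod_(i < b) phi (a%:Z - i%:Z)) * (\prod_(i < a) phi (i%:Z - b%:Z)) * phi (a%:Z - b%:Z)
  = (\prod_(i < a) phi i.+1%:Z) * (\prod_(i < b) phi (- i.+1%:Z)) * phi 0.
Proof.
pose psi (k : nat) := phi (k%:Z - b%:Z).
have split_at c d : (c + d = a + b)%N ->
    \prod_(0 <= k < (a + b).+1) psi k
    = (\prod_(i < c) psi i) * (psi c * \prod_(i < d) psi (c + i.+1)%N).
  move=> cd; rewrite (@big_cat_nat _ _ _ c) //=; last by lia.
  rewrite big_mkord; congr (_ * _); rewrite big_ltn; last by lia.
  congr (_ * _); rewrite -{1}[c.+1]add0n big_addn (_ : (a + b).+1 - c.+1 = d)%N; last by lia.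
  by rewrite big_mkord; apply: eq_bigr => i _; congr psi; lia.
have rev_psi c (e : nat -> nat) : (forall i, (i < c)%N -> e i = (c - i.+1)%N) ->
    \prod_(i < c) psi i = \prod_(i < c) psi (e i).
  move=> eE; rewrite -(big_mkord xpredT psi) big_nat_rev big_mkord.
  by apply: eq_bigr => i _; rewrite add0n eE.
transitivity (\prod_(0 <= k < (a + b).+1) psi k).
  rewrite (split_at a b) // [\prod_(i < b) psi _](_ : _ = \prod_(i < b) phi (a%:Z - i%:Z)).
    by rewrite /psi; ring.
  rewrite -(big_mkord xpredT (fun i => psi (a + i.+1)%N)) big_nat_rev big_mkord.
  by apply: eq_bigr => i _; rewrite /psi; congr phi; have := ltn_ord i; lia.
rewrite (split_at b a) 1?addnC // [\prod_(i < a) psi _](_ : _ = \prod_(i < a) phi i.+1%:Z).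
  rewrite (rev_psi b (fun i => b - i.+1)%N) //.
  rewrite [\prod_(i < b) psi _](_ : _ = \prod_(i < b) phi (- i.+1%:Z)).
    by rewrite {1}/psi subrr; ring.
  by apply: eq_bigr => i _; rewrite /psi; congr phi; have := ltn_ord i; lia.
by apply: eq_bigr => i _; rewrite /psi; congr phi; lia.
Qed.

End PairProducts.

Section ColumnVortex.
Variables (L : fieldType) (I : finType) (N r : nat) (lam tau : L).
Variables (m : 'I_N -> L) (w : 'I_r -> L) (x : I -> L) (S : 'I_N -> I) (T : 'I_r -> I).
Hypothesis tauE : tau = - (lam *+ 2).
Hypothesis prodST : forall F : I -> L,
  \prod_g F g = (\prod_k F (S k)) * \prod_j F (T j).
Hypothesis xS : forall k l, x (S k) - x (S l) = m l - m k.
Hypothesis xT : forall k j, x (S k) - x (T j) = - (1 + (w j + m k) + tau).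
Hypothesis S_inj : injective S.
Hypothesis nr_x : nonresonant tau x.
Hypothesis half_neq0 : forall k l (v : int), m l - m k + lam + tau *~ v != 0.

Let u_neq0 k l (v : int) : (k == l) && (v == 0) = false -> m l - m k + tau *~ v != 0.
Proof.
rewrite -xS => nt; apply/eqP => e; move: nt; case: v e => a e.
  have [] := nr_x (f := S k) (g := S l) (i := a) (j := 0%N).
    by apply/eqP; rewrite mulr0n addr0 -subr_eq0 addrAC; apply/eqP.
  by move=> /S_inj -> ->; rewrite eqxx.
have [] // := nr_x (f := S k) (g := S l) (i := 0%N) (j := a.+1).
apply/eqP; rewrite mulr0n addr0 -subr_eq0 opprD addrA; apply/eqP; rewrite -[RHS]e NegzE.
by rewrite mulrNz.
Qed.

Let half (k l : 'I_N) (v : int) := m l - m k + lam + tau *~ v.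

Let half_sym k l v : half l k v = - half k l (1 - v).
Proof. by rewrite /half tauE mulrzBr; ring. Qed.

(* Because 2 lam + tau = 0, the weights shifted by lam are opposite to each other
   in pairs and contribute a sign only. *)
Let prod_half (d : 'I_N -> nat) :
  \prod_k \prod_l \prod_(i < d l) (half k l (- i%:Z) / half k l ((d k)%:Z - i%:Z))
  = (-1) ^+ (\sum_k d k).
Proof.
rewrite prod_pairs [X in _ * X]big1 ?mulr1 => [|k _].
  have -> : (-1) ^+ (\sum_k d k) = \prod_(k < N) (-1) ^+ d k :> L.
    exact: (big_morph _ (exprD _) (expr0 _)).
  apply: eq_bigr => k _.
  have -> : \prod_(i < d k) (half k k (- i%:Z) / half k k ((d k)%:Z - i%:Z))
      = \prod_(i < d k) - half k k i.+1%:Z / \prod_(i < d k) half k k i.+1%:Z.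
    rewrite big_split prodfV /=; congr (_ / _).
      by apply: eq_bigr => i _; rewrite half_sym; congr (- half _ _ _); lia.
    rewrite -(big_mkord xpredT (fun i => half k k ((d k)%:Z - i%:Z))) big_nat_rev big_mkord.
    by apply: eq_bigr => i _; congr half; have := ltn_ord i; lia.
  rewrite prodrN card_ord mulfK //; apply/prodf_neq0 => i _; exact: half_neq0.
rewrite big1 // => l k_l.
rewrite [X in X * _]prod_shift_exchange; last by move=> v; apply: half_neq0.
rewrite -big_split big1 // => i _ /=.
rewrite !(half_sym k l) opprK [1 - (_ - _)](_ : _ = i.+1%:Z - (d l)%:Z); last by lia.
rewrite (_ : 1 + i%:Z = i.+1%:Z); last by lia.
have := half_neq0 k l i.+1%:Z; have := half_neq0 k l (i.+1%:Z - (d l)%:Z).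
rewrite -!/(half _ _ _) => h0 h1.
by field; rewrite oppr_eq0 h0 h1.
Qed.

Let E (d : 'I_N -> nat) k l := \prod_(i < d l) (m l - m k + tau *~ ((d k)%:Z - i%:Z)).
Let H (d : 'I_N -> nat) (k l : 'I_N) := \prod_(i < d k) (m l - m k + tau *~ i.+1%:Z).

Let pair_EH d k l :
  E d k l * E d l k * (m l - m k + tau *~ ((d k)%:Z - (d l)%:Z))
  = (-1) ^+ (d k + d l) * (H d k l * H d l k * (m l - m k)).
Proof.
pose phi v := m l - m k + tau *~ v.
have Elk : E d l k = (-1) ^+ d k * \prod_(i < d k) phi (i%:Z - (d l)%:Z).
  transitivity (\prod_(i < d k) - phi (i%:Z - (d l)%:Z)); last by rewrite prodrN card_ord.
  by apply: eq_bigr => i _; rewrite /phi !mulrzBr; ring.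
have Hlk : H d l k = (-1) ^+ d l * \prod_(i < d l) phi (- i.+1%:Z).
  transitivity (\prod_(i < d l) - phi (- i.+1%:Z)); last by rewrite prodrN card_ord.
  by apply: eq_bigr => i _; rewrite /phi mulrNz; ring.
have := prod_interval phi (d k) (d l).
have -> : phi 0 = m l - m k by rewrite /phi mulr0z addr0.
rewrite Elk Hlk -/(E d k l) -/(H d k l) => eq_int.
transitivity ((-1) ^+ d k * (E d k l * (\prod_(i < d k) phi (i%:Z - (d l)%:Z))
  * phi ((d k)%:Z - (d l)%:Z))); first by rewrite /phi; ring.
rewrite eq_int exprD; have sq : (-1) ^+ d l * (-1) ^+ d l = 1 :> L by rewrite -expr2 sqrr_sign.
transitivity ((-1) ^+ d k * ((-1) ^+ d l * (-1) ^+ d l) * (H d k l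
  * (\prod_(i < d l) phi (- i.+1%:Z)) * (m l - m k))); first by rewrite sq mulr1.
by ring.
Qed.

Let diag_EH d k : E d k k = H d k k.
Proof.
rewrite /E /H -(big_mkord xpredT (fun i => m k - m k + tau *~ ((d k)%:Z - i%:Z))).
rewrite big_nat_rev big_mkord; apply: eq_bigr => i _; congr (_ + _ *~ _).
by have := ltn_ord i; lia.
Qed.

Let H_neq0 d k l : H d k l != 0.
Proof. by apply/prodf_neq0 => i _; apply: u_neq0; rewrite andbF. Qed.

Let vandE (d : 'I_N -> nat) :
  vand (fun k => x (S k) + tau *+ d k) / vand (x \o S)
  = \prod_(k < N) \prod_(l < N | (k < l)%N)
      ((m l - m k + tau *~ ((d k)%:Z - (d l)%:Z)) / (m l - m k)).
Proof.
rewrite /vand -prodf_div; apply: eq_bigr => k _; rewrite -prodf_div.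
apply: eq_bigr => l k_l /=; rewrite -xS mulrzBr -!pmulrn.
by rewrite -(opprB (x (S l))) invrN mulrN -mulNr; congr (_ / _); ring.
Qed.

Let sgn_sum (d : 'I_N -> nat) : (-1) ^+ (\sum_k d k) = \prod_(k < N) (-1) ^+ d k :> L.
Proof. exact: (big_morph _ (exprD _) (expr0 _)). Qed.

Let prod_E d :
  (\prod_k \prod_l E d k l) * (vand (fun k => x (S k) + tau *+ d k) / vand (x \o S))
  = (-1) ^+ ((N.+1 * \sum_k d k)%N) * \prod_k \prod_l H d k l.
Proof.
have signed_H : \prod_k \prod_l ((-1) ^+ d k * H d k l)
    = (-1) ^+ ((N * \sum_k d k)%N) * \prod_k \prod_l H d k l.
  rewrite mulnC exprM sgn_sum -prodrXl -big_split; apply: eq_bigr => k _ /=.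
  by rewrite big_split prodr_const card_ord.
rewrite mulSn exprD -mulrA -signed_H !prod_pairs vandE -mulrA.
have -> : \prod_k ((-1) ^+ d k * H d k k) = (-1) ^+ (\sum_k d k) * \prod_k E d k k.
  by rewrite sgn_sum -big_split; apply: eq_bigr => k _; rewrite diag_EH.
rewrite !mulrA -expr2 sqrr_sign mul1r -mulrA; congr (_ * _).
rewrite -big_split; apply: eq_bigr => k _; rewrite -big_split; apply: eq_bigr => l k_l /=.
have u0 : m l - m k != 0.
  by have := @u_neq0 k l 0; rewrite mulr0z addr0; apply; rewrite andbT -val_eqE /= ltn_eqF.
by rewrite mulrA pair_EH exprD mulrA mulfK // mulrACA.
Qed.

Let prod_hypcoef (d : 'I_N -> nat) :
  \prod_k hypcoef tau x (S k) (d k)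
  = (-1) ^+ (r * \sum_k d k)%N * (\prod_k \prod_l H d k l)^-1
    * (\prod_(k < N) \prod_(j < r) \prod_(i < d k) (1 + (w j + m k - tau *+ i)))^-1.
Proof.
rewrite mulnC exprM sgn_sum -prodrXl -!prodfV -!big_split; apply: eq_bigr => k _ /=.
transitivity (\prod_(i < d k) ((\prod_l (m l - m k + tau *~ i.+1%:Z)^-1)
    * (\prod_(j < r) - (1 + (w j + m k - tau *+ i))^-1))).
  apply: eq_bigr => i _; rewrite (prodST (fun g => (x (S k) - x g + tau *+ i.+1)^-1)).
  congr (_ * _); first by apply: eq_bigr => l _; rewrite xS.
  apply: eq_bigr => j _; rewrite xT -invrN; congr _^-1; ring.
have prodH : \prod_(i < d k) \prod_l (m l - m k + tau *~ i.+1%:Z)^-1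
    = (\prod_l H d k l)^-1.
  by rewrite exchange_big -prodfV; apply: eq_bigr => l _; rewrite prodfV.
have prod_seg : \prod_(i < d k) \prod_(j < r) - (1 + (w j + m k - tau *+ i))^-1
    = ((-1) ^+ d k) ^+ r
      * (\prod_(j < r) \prod_(i < d k) (1 + (w j + m k - tau *+ i)))^-1.
  have -> : ((-1) ^+ d k) ^+ r = \prod_(j < r) (-1) ^+ d k :> L.
    by rewrite prodr_const card_ord.
  rewrite exchange_big -prodfV -big_split; apply: eq_bigr => j _ /=.
  by rewrite prodrN card_ord prodfV.
rewrite big_split /= prodH prod_seg; ring.
Qed.

(** The weights that are not shifted by lam pair up to quotients of Vandermonde
    products, and the r factors of the Segre class provide the differences of a
    chosen flavour S k with the remaining flavours T j. *)
Lemma colterm_vortex (d : 'I_N -> nat) :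
  colterm lam tau m w d
  = (-1) ^+ ((N + r) * (\sum_k d k))%N * ((\prod_k hypcoef tau x (S k) (d k))
      * (vand (fun k => x (S k) + tau *+ d k) / vand (x \o S))).
Proof.
have -> : colterm lam tau m w d
    = (\prod_(k < N) \prod_(j < r) \prod_(i < d k) (1 + (w j + m k - tau *+ i)))^-1
      / ((\prod_k \prod_l E d k l) * (-1) ^+ (\sum_k d k)).
  rewrite /colterm -prod_half -big_split; congr (_ / _); apply: eq_bigr => k _.
  rewrite -big_split; apply: eq_bigr => l _; rewrite -big_split; apply: eq_bigr => i _.
  by rewrite /= mulrA.
have := prod_E d; set Vr := vand _ / _ => prodE.
have Vr0 : Vr != 0.
  rewrite /Vr vandE; apply/prodf_neq0 => k _; apply/prodf_neq0 => l k_l.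
  have nt : (k == l) = false by rewrite -val_eqE /= ltn_eqF.
  have u0 : m l - m k != 0 by have := @u_neq0 k l 0; rewrite mulr0z addr0; apply; rewrite nt.
  by apply: mulf_neq0; rewrite ?invr_eq0 // u_neq0 // nt.
have E0 : \prod_k \prod_l E d k l != 0.
  apply: contra_eq_neq prodE => ->; rewrite mul0r eq_sym mulf_neq0 ?signr_eq0 //.
  by apply/prodf_neq0 => k _; apply/prodf_neq0.
rewrite prod_hypcoef invfM.
have -> : (\prod_k \prod_l E d k l)^-1
    = (-1) ^+ ((N.+1 * \sum_k d k)%N) * Vr * (\prod_k \prod_l H d k l)^-1.
  have -> : \prod_k \prod_l E d k l
      = (-1) ^+ ((N.+1 * \sum_k d k)%N) * (\prod_k \prod_l H d k l) / Vr.
    by rewrite -prodE mulfK.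
  by rewrite invf_div invfM invr_sign mulrCA mulrA.
set n := \sum_k d k; rewrite mulSn mulnDl !exprD invr_sign.
have sq a : (-1) ^+ a * (-1) ^+ a = 1 :> L by rewrite -expr2 sqrr_sign.
set s := _^-1; set h := _^-1.
transitivity (((-1) ^+ n * (-1) ^+ n) * (-1) ^+ (N * n)%N * s * Vr * h); first by ring.
transitivity (((-1) ^+ (r * n)%N * (-1) ^+ (r * n)%N) * (-1) ^+ (N * n)%N * s * Vr * h).
  by rewrite !sq.
by ring.
Qed.

End ColumnVortex.

Section CurveSymmetry.
Variables (C : fieldType) (n N r : nat).
Hypothesis C_char0 : forall k, k.+1%:R != 0 :> C.
Local Notation P := {mpoly C[n]}.
Local Notation K := {fraction P}.
Variables (i1 i2 : 'I_n) (iy : 'I_N -> 'I_n) (iv : 'I_r -> 'I_n).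
Hypotheses (i12 : i1 != i2) (iy_inj : injective iy) (iv_inj : injective iv).
Hypotheses (iy_t : forall k, (iy k != i1) && (iy k != i2)).
Hypotheses (iv_t : forall j, (iv j != i1) && (iv j != i2)).
Hypotheses (N_gt0 : (0 < N)%N) (r_gt0 : (0 < r)%N).

Local Notation X i := (('X_i : P)%:F).
Local Notation tau := (- (X i1 *+ 2)).

(* The flavours of E and of V. Exchanging the two bundles turns x, up to a common
   translation, into - x, and the chosen flavours into their complement. *)
Let x (f : 'I_(N + r)) : K :=
  match split f with inl k => - X (iy k) | inr j => 1 + X (iv j) + tau end.

Let xl k : x (lshift r k) = - X (iy k).
Proof. by rewrite /x -[lshift r k]/(unsplit (inl k)) unsplitK. Qed.
Let xr j : x (rshift N j) = 1 + X (iv j) + tau.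
Proof. by rewrite /x -[rshift N j]/(unsplit (inr j)) unsplitK. Qed.

Let eq_weights (M : nat) (im : 'I_M -> 'I_n) (im_inj : injective im)
    (im_t : forall k, (im k != i1) && (im k != i2)) k l a b :
  X (im k) + tau *+ a = X (im l) + tau *+ b -> k = l /\ a = b.
Proof.
move=> e; have [kl|kl] := boolP ((l == k) && (0 == 2 * (a%:Z - b%:Z))).
  by case/andP: kl => /eqP -> ab; split=> //; lia.
have := colweight_neq0 C_char0 i12 im_inj im_t (negPf kl).
rewrite mulr0z addr0 mulrzBr -!pmulrn => /eqP[].
transitivity ((X (im k) + tau *+ a) - (X (im l) + tau *+ b)); first by ring.
by rewrite e subrr.
Qed.

Let cross_neq k j (a b : nat) : 1 + X (iv j) + tau + tau *+ a != - X (iy k) + tau *+ b.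
Proof.
rewrite -subr_eq0; apply/eqP => e.
have /eqP : (1 + ('X_(iv j) + 'X_(iy k) - ('X_i1 *+ 2) *+ a.+1 + ('X_i1 *+ 2) *+ b) : P)%:F = 0 :> K.
  rewrite -[RHS]e !(rmorphD, rmorphN, rmorphMn) rmorph1 /=; ring.
rewrite tofrac_eq0 => /eqP/(congr1 (meval (fun=> 0))).
rewrite !(rmorphD, rmorphN, rmorphMn) rmorph1 /= !mevalXU meval0.
by rewrite !(mul0rn, oppr0, subr0, addr0) => /eqP; rewrite oner_eq0.
Qed.

Let nr_x : nonresonant tau x.
Proof.
move=> f g a b; rewrite -(splitK f) -(splitK g).
case: (split f) (split g) => [k|j] [l|j'] /=; rewrite ?xl ?xr => e.
- suff [-> ->] : l = k /\ b = a by [].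
  have e' : X (iy l) + tau *+ a = X (iy k) + tau *+ b.
    transitivity (X (iy l) + X (iy k) + (- X (iy k) + tau *+ a)); first by ring.
    by rewrite e; ring.
  by have [-> ->] := eq_weights iy_inj iy_t e'.
- by have /eqP[] := cross_neq k j' b a.
- by have /eqP[] := cross_neq l j a b.
have e' : X (iv j) + tau *+ a = X (iv j') + tau *+ b.
  by apply: (addrI (1 + tau)); rewrite !addrA ![1 + tau + _]addrAC.
by have [-> ->] := eq_weights iv_inj iv_t e'.
Qed.

Let half_neq0 (M : nat) (im : 'I_M -> 'I_n) (im_inj : injective im)
    (im_t : forall k, (im k != i1) && (im k != i2)) k l (v : int) :
  X (im l) - X (im k) + X i1 + tau *~ v != 0.
Proof.
have := @colweight_neq0 _ _ _ C_char0 i1 i2 im i12 im_inj im_t k l 1 v.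
rewrite mulr1z; apply; rewrite (_ : 1 == 2 * v = false) ?andbF //.
by apply/negbTE; lia.
Qed.

Lemma colsum_symmetry D :
  (-1) ^+ (N * D)%N * colsum (X i1) tau (fun k => X (iy k)) (fun j => X (iv j)) D
  = (-1) ^+ (r * D)%N * colsum (X i1) tau (fun j => X (iv j)) (fun k => X (iy k)) D.
Proof.
have colsumE (M s : nat) (m : 'I_M -> K) (w : 'I_s -> K) (I : finType) (z : I -> K) S :
    (forall d : 'I_M -> nat, colterm (X i1) tau m w d
      = (-1) ^+ ((M + s) * (\sum_k d k))%N * ((\prod_k hypcoef tau z (S k) (d k))
      * (vand (fun k => z (S k) + tau *+ d k) / vand (z \o S)))) ->
    colsum (X i1) tau m w D = (-1) ^+ ((M + s) * D)%N * vortex_sum tau z S D.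
  move=> term; rewrite /colsum /vortex_sum mulr_sumr; apply: eq_bigr => d /eqP sum_d.
  by rewrite term sum_d.
rewrite (colsumE N r _ _ _ x (@lshift N r)); last first.
  apply: (@colterm_vortex _ _ _ _ _ _ _ _ _ _ (@rshift N r)).
  - by [].
  - by move=> F; rewrite big_split_ord.
  - by move=> k l; rewrite !xl; ring.
  - by move=> k j; rewrite xl xr; ring.
  - exact: lshift_inj.
  - exact: nr_x.
  - exact: half_neq0 iy_inj iy_t.
rewrite (colsumE r N _ _ _ (fun f => - x f) (@rshift N r)); last first.
  apply: (@colterm_vortex _ _ _ _ _ _ _ _ _ _ (@lshift N r)).
  - by [].
  - by move=> F; rewrite big_split_ord /= mulrC.
  - by move=> k l; rewrite !xr; ring.
  - by move=> k j; rewrite xl xr; ring.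
  - exact: rshift_inj.
  - exact: nonresonantN.
  - exact: half_neq0 iv_inj iv_t.
rewrite (vortex_sum_duality N_gt0 r_gt0 nr_x) -exprM !mulnDl !exprD.
have sq a : (-1) ^+ a * (-1) ^+ a = 1 :> K by rewrite -expr2 sqrr_sign.
have := sq (N * D)%N; have := sq (r * D)%N.
set s := (-1) ^+ (N * D); set s' := (-1) ^+ (r * D); set v := vortex_sum _ _ _ _.
move=> s'2 s2; transitivity ((s * s) * (s' * s') * s * v); first by ring.
transitivity ((s' * s') * s * v); first by rewrite s2 !s'2 !mul1r.
by ring.
Qed.

End CurveSymmetry.

Section SpecializedSymmetry.
Variables (C : fieldType) (n N r : nat).
Hypothesis C_char0 : forall k, k.+1%:R != 0 :> C.
Local Notation P := {mpoly C[n]}.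
Local Notation K := {fraction P}.
Variables (i1 i2 : 'I_n) (iy : 'I_N -> 'I_n) (iv : 'I_r -> 'I_n).
Hypotheses (i12 : i1 != i2) (iy_inj : injective iy) (iv_inj : injective iv).
Hypotheses (iy_t : forall k, (iy k != i1) && (iy k != i2)).
Hypotheses (iv_t : forall j, (iv j != i1) && (iv j != i2)).
Hypotheses (N_gt0 : (0 < N)%N) (r_gt0 : (0 < r)%N).

Local Notation X i := (('X_i : P)%:F).

Lemma fpsum_symmetry D :
  regular (@spec C n i1 i2)
    ((((-1) ^+ (N * D)%N)%:MP)%:F
       * fpsum (X i1) (X i2) (fun k => X (iy k)) (fun j => X (iv j)) D
     - (((-1) ^+ (r * D)%N)%:MP)%:F
       * fpsum (X i1) (X i2) (fun j => X (iv j)) (fun k => X (iy k)) D) 0.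
Proof.
have signE a : (((-1) ^+ a)%:MP)%:F = (-1) ^+ a :> K.
  by rewrite !rmorphXn !rmorphN !rmorph1.
have spec_sign a : regular (@spec C n i1 i2) ((-1) ^+ a) ((-1) ^+ a).
  have := regular_tofrac (@spec C n i1 i2) ((-1) ^+ a).
  by rewrite !rmorphXn !rmorphN !rmorph1.
rewrite !signE -(subrr ((-1) ^+ (N * D)%N * colsum (X i1) (- (X i1 *+ 2))
  (fun k => X (iy k)) (fun j => X (iv j)) D)).
rewrite {2}(colsum_symmetry C_char0 i12 iy_inj iv_inj iy_t iv_t N_gt0 r_gt0).
apply: regularD; first by apply: regularM => //; apply: reg_fpsum.
by apply: regularN; apply: regularM => //; apply: reg_fpsum.
Qed.

End SpecializedSymmetry.

(** * Logarithmic derivative of the universal product *)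

Section LogDerivative.
Variable K : fieldType.
Hypothesis K_char0 : forall k, k.+1%:R != 0 :> K.

(** theta f / f: the power is an inverse of f if f has constant term 1. *)
Definition ldf (f : fps K) : fps K := euler_op 1 f * fps_pow f (-1).

Lemma logder_ldf f : f 0%N = 1 -> logder f (ldf f).
Proof. by move=> f0; rewrite /logder /ldf -mulrA fps_pow_inv ?mulr1. Qed.

Lemma ldf0 f : ldf f 0%N = 0.
Proof. by rewrite /ldf coef_fpsM0 /euler_op mulr0n !mul0r. Qed.

Definition unipotent_logder (f l : fps K) := f 0%N = 1 /\ logder f l.

Lemma unipotent_logder_prod (I : eqType) (s : seq I) (P : pred I) (F G : I -> fps K) :
  (forall i, i \in s -> P i -> unipotent_logder (F i) (G i)) ->
  unipotent_logder (\big[@fps_mul K/@fps_one K]_(i <- s | P i) F i)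
    (\sum_(i <- s | P i) G i).
Proof.
elim: s => [|i s IHs] FG.
  by rewrite !big_nil; split=> //; apply: logder1.
have [|f0 fl] := IHs; first by move=> j js; apply: FG; rewrite inE js orbT.
rewrite !big_cons; case: ifP => // Pi; have [g0 gl] := FG i (mem_head _ _) Pi.
by split; [apply: etrans (coef_fpsM0 _ _) _; rewrite g0 f0 mulr1 | apply: logderM].
Qed.

Lemma logder_rec (f l : fps K) m : logder f l -> l 0%N = 0 ->
  m%:R * f m = \sum_(i < m) l i.+1 * f (m - i.+1)%N.
Proof.
move=> /fpsP/(_ m) /= + l0; rewrite coef_fpsM big_ord_recl l0 mul0r add0r /euler_op => ->.
by apply: eq_bigr.
Qed.

End LogDerivative.

Section Embedding.
Variables (C : fieldType) (n : nat).
Hypothesis C_char0 : forall k, k.+1%:R != 0 :> C.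
Local Notation P := {mpoly C[n]}.
Local Notation K := {fraction P}.

Definition fps_emb (f : fps C) : fps K := fun i => ((f i)%:MP)%:F.

Lemma logder_emb f l : logder f l -> logder (fps_emb f) (fps_emb l).
Proof.
move=> /fpsP fl; apply/fpsP => i; have := fl i.
rewrite coef_fpsM /euler_op => /(congr1 (fun c => (c%:MP)%:F : K)).
rewrite coef_fpsM /fps_emb.
rewrite !rmorphM rmorph_sum rmorph_sum !rmorphMn !rmorph1 /= => ->.
by apply: eq_bigr => j _; rewrite !rmorphM.
Qed.

End Embedding.

Section Chern.
Variables (C : fieldType) (n : nat).
Hypothesis C_char0 : forall k, k.+1%:R != 0 :> C.
Local Notation P := {mpoly C[n]}.
Local Notation K := {fraction P}.
Implicit Types (p : P) (g : vchar n).

Lemma chern_class_bundle M (y : 'I_M -> wt n) :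
  chern_class C (\sum_i << y i >> : vchar n) = (\prod_i (1 + c1wt C (y i)))%:F.
Proof.
have F0 x : (1 + c1wt C x)%:F != 0 :> K by rewrite tofrac_eq0 onePc1wt_neq0.
transitivity (prodfg (fun x => (1 + c1wt C x)%:F : K) (\sum_i << y i >>)); first by [].
rewrite prodfg_sum // rmorph_prod; apply: eq_bigr => i _.
by rewrite prodfgU.
Qed.

Definition chernp (mu : seq nat) p : P := \prod_(i <- mu) hc i p.

Lemma chernp_dhomog mu p : chernp mu p \is (sumn mu).-homog.
Proof.
rewrite /chernp; elim: mu => [|i mu IHmu]; first by rewrite big_nil dhomog1.
by rewrite big_cons; apply: dhomogM (pihomogP _ _ _) IHmu.
Qed.

Lemma chern_partE mu g p : chern_class C g = p%:F ->
  chern_part C mu g = (chernp mu p)%:F.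
Proof.
move=> gp; rewrite /chern_part rmorph_prod; apply: eq_bigr => i _.
by rewrite /chern gp degpart_tofrac.
Qed.

Lemma hc1_prod M (x : 'I_M -> P) : (forall i, x i \is 1.-homog) ->
  hc 0 (\prod_i (1 + x i)) = 1 /\ hc 1 (\prod_i (1 + x i)) = \sum_i x i.
Proof.
move=> x1; have one_hom : (1 : P) \is 0.-homog by apply: dhomog1.
elim/big_rec2: _ => [|i p q _ [p0 p1]].
  by rewrite !(hc_dhomog _ one_hom).
rewrite mulrDl mul1r !raddfD /= !(hcM_dhomog _ _ (x1 i)) /= p0 p1 mulr1.
by rewrite addr0 addrC.
Qed.

End Chern.

(** The exponents attached to partitions of size at least 2 have no linear
    part. *)
Lemma big_small_parts (V : nmodType) D (F : seq nat -> V) : (0 < D)%N ->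
  (forall mu, (1 < sumn mu)%N -> F mu = 0) ->
  \sum_(mu <- parts_le D) F mu = F [::] + F [:: 1%N].
Proof.
move=> D_gt0 F0; have uniq_D : uniq (parts_le D) by apply: undup_uniq.
rewrite (bigD1_seq [::]) ?mem_parts_le //=; congr (_ + _).
rewrite -big_filter (bigD1_seq [:: 1%N]) ?filter_uniq ?mem_filter ?mem_parts_le //=.
rewrite big_seq_cond big1 ?addr0 // => mu; rewrite mem_filter mem_parts_le.
move=> /andP[/andP[mu0 /andP[part_mu _]] mu1]; apply: F0.
case: mu part_mu mu0 mu1 => [|x [|y mu]] //; rewrite /is_part !inE /=.
  by rewrite eqseq_cons andbT => x0 _ x1; lia.
by move=> /andP[_]; rewrite !negb_or => /and3P[x0 y0 _] _ _; lia.
Qed.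

Section TangentBundle.
Variables (C : fieldType) (p q : nat).
Hypothesis C_char0 : forall k, k.+1%:R != 0 :> C.
Local Notation n := (2 + p + q)%N.
Local Notation P := {mpoly C[n]}.
Local Notation cS := ((1 + 'X_(it1 p q)) * (1 + 'X_(it2 p q)) : P).

Lemma chern_class_tanS : chern_class C (tanS : vchar n) = cS%:F.
Proof.
have -> : (tanS : vchar n) = \sum_(i < 2) << if i == 0 then t1 else t2 >>.
  by rewrite big_ord_recl big_ord1.
rewrite chern_class_bundle // big_ord_recl big_ord1 /=.
by rewrite /t1 /t2 !c1wt_delta.
Qed.

Lemma hc1_cS : hc 0 cS = 1 /\ hc 1 cS = 'X_(it1 p q) + 'X_(it2 p q).
Proof.
have := @hc1_prod C n 2 (fun i => if i == 0 then 'X_(it1 p q) else 'X_(it2 p q)).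
rewrite !big_ord_recl !big_ord0 /= mulr1 addr0; apply=> i.
by case: ifP => _; apply: mpolyX_dhomog.
Qed.

Lemma chern1_tanS : chern C 1 (tanS : vchar n) = ('X_(it1 p q) + 'X_(it2 p q))%:F.
Proof. by rewrite /chern chern_class_tanS degpart_tofrac //= hc1_cS.2. Qed.

End TangentBundle.

Section UniversalProduct.
Variables (C : fieldType) (N r : nat).
Hypothesis C_char0 : forall k, k.+1%:R != 0 :> C.
Local Notation n := (2 + N + (r + 0))%N.
Local Notation P := {mpoly C[n]}.
Local Notation K := {fraction P}.
Variable A : seq nat -> seq nat -> seq nat -> fps C.
Hypothesis A0 : forall mu nu xi, is_part mu -> is_part nu -> is_part xi ->
  A mu nu xi 0%N = 1.

(** The variables v_j, y_k, t_1 and t_2 of the polynomial ring of the class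
    alpha_class N r 0, in which r + 0 stands for r. *)
Definition av (j : 'I_r) : 'I_n := rshift (2 + N) (lshift 0 j).
Definition ay (k : 'I_N) : 'I_n := lshift (r + 0) (rshift 2 k).
Definition a1 : 'I_n := it1 N (r + 0).
Definition a2 : 'I_n := it2 N (r + 0).

Let pV : P := \prod_j (1 + 'X_(av j)).
Let pE : P := \prod_k (1 + 'X_(ay k)).
Let pS : P := (1 + 'X_a1) * (1 + 'X_a2).
Let c : P := 'X_a1 + 'X_a2.
Let l : P := 'X_a1 * 'X_a2.

Lemma chern_alpha : chern_class C (alpha_class N r 0) = pV%:F.
Proof.
rewrite /alpha_class /bundle [X in _ - X]big_ord0 subr0 chern_class_bundle //.
by congr (_%:F); apply: eq_bigr => j _; rewrite c1wt_delta.
Qed.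

Lemma chern_E : chern_class C (bundle (y_ : 'I_N -> wt n)) = pE%:F.
Proof.
rewrite /bundle chern_class_bundle //.
by congr (_%:F); apply: eq_bigr => j _; rewrite c1wt_delta.
Qed.

Lemma chern_tan : chern_class C (tanS : vchar n) = pS%:F.
Proof. exact: chern_class_tanS. Qed.

Lemma hc1_pS : hc 0 pS = 1 /\ hc 1 pS = c.
Proof. exact: hc1_cS. Qed.

(** The exponent of the factor (mu, nu, xi) of the universal product is
    (c / l) uexp mu nu xi. *)
Definition uexp mu nu xi : P := chernp mu pV * chernp nu pS * chernp xi pE.

Lemma uexp_dhomog mu nu xi : uexp mu nu xi \is (sumn mu + sumn nu + sumn xi).-homog.
Proof. by apply: dhomogM; [apply: dhomogM|]; apply: chernp_dhomog. Qed.

Definition ulog (D i : nat) : P :=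
  \sum_(mu <- parts_le D) \sum_(nu <- parts_le D)
  \sum_(xi <- parts_le D | (sumn mu + sumn nu + sumn xi <= D)%N)
     ldf (A mu nu xi) i *: uexp mu nu xi.

(** Logarithmic derivatives add up over the factors, and all exponents contain
    the factor c_1(S) / (lambda_1 lambda_2). *)
Lemma univ_prod_logder D :
  unipotent_logder (univ_prod A (alpha_class N r 0) (bundle y_) D)
    (fun i => (c * ulog D i)%:F / l%:F).
Proof.
have K0 := fracmp_char0 n C_char0.
pose ex mu nu xi : K := (uexp mu nu xi * c)%:F / l%:F.
have -> : (fun i => (c * ulog D i)%:F / l%:F) = \sum_(mu <- parts_le D)
    \sum_(nu <- parts_le D) \sum_(xi <- parts_le D | (sumn mu + sumn nu + sumn xi <= D)%N)
     fpsC (ex mu nu xi) * fps_emb n (ldf (A mu nu xi)) :> fps K.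
  apply/fpsP => i; rewrite /ulog mulr_sumr rmorph_sum mulr_suml coef_fps_sum.
  apply: eq_bigr => mu _; rewrite mulr_sumr rmorph_sum mulr_suml coef_fps_sum.
  apply: eq_bigr => nu _; rewrite mulr_sumr rmorph_sum mulr_suml coef_fps_sum.
  apply: eq_bigr => xi _; rewrite /= coef_fpsCM /ex /fps_emb -mul_mpolyC.
  rewrite [RHS]mulrAC; congr (_ / _); rewrite -!tofracM; congr _%:F.
  by rewrite mulrCA mulrC [c * _]mulrC.
apply: unipotent_logder_prod => mu mu_D _; apply: unipotent_logder_prod => nu nu_D _.
apply: unipotent_logder_prod => xi xi_D _.
have [muP nuP xiP] : [/\ is_part mu, is_part nu & is_part xi].
  by move: mu_D nu_D xi_D; rewrite !mem_parts_le => /andP[-> _] /andP[-> _] /andP[-> _].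
set e := int_S _; have -> : e = ex mu nu xi.
  rewrite /e /int_S /l12 (chern_partE _ _ chern_alpha) // (chern_partE _ _ chern_tan) //.
  rewrite (chern_partE _ _ chern_E) // /chern chern_tan degpart_tofrac //=.
  by case: hc1_pS => _ ->; rewrite -!tofracM !c1wt_delta.
have emb0 : fps_emb n (A mu nu xi) 0%N = 1 by rewrite /fps_emb A0 // mpolyC1 tofrac1.
split; first exact: fps_pow0.
apply: (logder_pow K0) => //; apply: logder_emb.
by apply: logder_ldf => //; apply: A0.
Qed.

(** A triple (mu, nu, xi) enters in degree |mu| + |nu| + |xi|. *)
Lemma hc1_ulog D i : (0 < D)%N -> hc 1 (ulog D i)
  = ldf (A [:: 1%N] [::] [::]) i *: (\sum_j 'X_(av j))
    + ldf (A [::] [:: 1%N] [::]) i *: c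
    + ldf (A [::] [::] [:: 1%N]) i *: (\sum_k 'X_(ay k)).
Proof.
move=> D_gt0.
pose F mu nu xi : P := if (sumn mu + sumn nu + sumn xi == 1)%N
  then ldf (A mu nu xi) i *: uexp mu nu xi else 0.
have -> : hc 1 (ulog D i) = \sum_(mu <- parts_le D) \sum_(nu <- parts_le D)
    \sum_(xi <- parts_le D) F mu nu xi.
  rewrite /ulog linear_sum; apply: eq_bigr => mu _; rewrite linear_sum.
  apply: eq_bigr => nu _; rewrite linear_sum big_mkcond; apply: eq_bigr => xi _ /=.
  rewrite linearZ /= (hc_dhomog _ (uexp_dhomog _ _ _)) /F.
  by case: (_ =P 1%N) => [->|_]; rewrite ?D_gt0 // scaler0 if_same.
have F0 mu nu xi : (1 < sumn mu + sumn nu + sumn xi)%N -> F mu nu xi = 0.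
  by rewrite /F; case: eqP => // ->.
rewrite big_small_parts // => [|mu mu1]; last first.
  by rewrite big1 // => nu _; rewrite big1 // => xi _; rewrite F0 //; lia.
rewrite !(@big_small_parts _ D (fun nu => \sum_(xi <- parts_le D) F _ nu xi)) //; last 2 first.
- by move=> nu nu1; rewrite big1 // => xi _; rewrite F0 //; lia.
- by move=> nu nu1; rewrite big1 // => xi _; rewrite F0 //; lia.
rewrite !(@big_small_parts _ D (F _ _)) //; try by move=> xi xi1; rewrite F0 //; lia.
rewrite /F /= !addr0 !add0r.
have [_ hV] := @hc1_prod C n r (fun j => 'X_(av j)) (fun j => mpolyX_dhomog _ _).
have [_ hE] := @hc1_prod C n N (fun k => 'X_(ay k)) (fun k => mpolyX_dhomog _ _).
have [_ hS] := hc1_pS.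
rewrite /uexp /chernp !big_nil !big_seq1 hV hE hS !mul1r !mulr1.
by rewrite addrC [X in _ + X = _]addrC addrA.
Qed.

End UniversalProduct.

(** * Polynomial numerators of the Segre series *)

Lemma eventually_all (K : nat) (Q : nat -> nat -> Prop) :
  (forall j, exists D0, forall D, (D0 <= D)%N -> Q j D) ->
  exists D0, forall D, (D0 <= D)%N -> forall j, (j < K)%N -> Q j D.
Proof.
move=> evQ; elim: K => [|K [D0 D0_K]]; first by exists 0%N.
have [D1 D1_K] := evQ K; exists (maxn D0 D1) => D.
rewrite geq_max => /andP[D0_D D1_D] j; rewrite ltnS leq_eqVlt => /orP[/eqP ->|j_K].
  exact: D1_K.
exact: D0_K.
Qed.

Section NumeratorRecursion.
Variables (R : comNzRingType) (c l : R).

(** For P_n = l^n U_n, this is the equation theta U = (c / l) lg U, coefficient by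
    coefficient. *)
Definition numer_rec (lg Pn : nat -> R) := Pn 0%N = 1 /\
  forall m, m%:R * Pn m = \sum_(i < m) c * lg i.+1 * l ^+ i * Pn (m - i.+1)%N.

Lemma numer_rec_scale s lg Pn : numer_rec lg Pn ->
  numer_rec (fun m => s ^+ m * lg m) (fun m => s ^+ m * Pn m).
Proof.
case=> Pn0 Pn_rec; split=> [|m]; first by rewrite Pn0 expr0 mulr1.
rewrite mulrCA Pn_rec mulr_sumr; apply: eq_bigr => i _.
have -> : s ^+ m = s ^+ i.+1 * s ^+ (m - i.+1) by rewrite -exprD subnKC.
by ring.
Qed.

End NumeratorRecursion.

Lemma numer_rec_morph (R R' : comNzRingType) (psi : {rmorphism R -> R'}) c l lg Pn :
  numer_rec c l lg Pn -> numer_rec (psi c) (psi l) (psi \o lg) (psi \o Pn).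
Proof.
case=> Pn0 Pn_rec; split=> [|m] /=; first by rewrite Pn0 rmorph1.
rewrite -(rmorph_nat psi) -rmorphM Pn_rec rmorph_sum; apply: eq_bigr => i _.
by rewrite !rmorphM rmorphXn.
Qed.

Section Numerators.
Variables (C : fieldType) (n : nat).
Hypothesis C_char0 : forall k, k.+1%:R != 0 :> C.
Local Notation P := {mpoly C[n]}.
Local Notation K := {fraction P}.
Variables (c l : P) (lg : nat -> P) (U : fps K).
Hypothesis l0 : l != 0.
Hypothesis U0 : U 0%N = 1.
Hypothesis U_rec : forall m,
  m%:R * U m = \sum_(i < m) (c * lg i.+1)%:F / l%:F * U (m - i.+1)%N.

Let lF0 m : (l ^+ m)%:F != 0 :> K.
Proof. by rewrite tofrac_eq0 expf_neq0. Qed.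

Let natK m : m.+1%:R = ((m.+1%:R : C)%:MP)%:F :> K.
Proof. by rewrite !rmorph_nat. Qed.

Let polar m (f : K) := exists p : P, f = p%:F / (l ^+ m)%:F.

Let polar_sum m (I : Type) (s : seq I) (F : I -> K) :
  (forall i, polar m (F i)) -> polar m (\sum_(i <- s) F i).
Proof.
move=> Fm; elim/big_rec: _ => [|i f _ [p ->]]; first by exists 0; rewrite tofrac0 mul0r.
by have [q ->] := Fm i; exists (q + p); rewrite tofracD mulrDl.
Qed.

Let polar_term (a q : P) i m : (i < m)%N ->
  a%:F / l%:F * (q%:F / (l ^+ (m - i.+1))%:F) = (a * l ^+ i * q)%:F / (l ^+ m)%:F :> K.
Proof.
move=> i_m; have lF : l%:F != 0 :> K by rewrite tofrac_eq0.
apply/eqP; rewrite mulf_div (eqr_div _ _ (mulf_neq0 lF (lF0 _)) (lF0 _)) -!tofracM; apply/eqP; congr _%:F.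
have -> : l ^+ m = l ^+ i * (l * l ^+ (m - i.+1)).
  by rewrite -exprS -exprD; congr (_ ^+ _); lia.
by ring.
Qed.

Let U_polar m : polar m (U m).
Proof.
have [k] := ubnP m; elim: k m => // k IHk [|m] m_k.
  by exists 1; rewrite expr0 tofrac1 divr1.
have [p pE] : polar m.+1 (m.+1%:R * U m.+1).
  rewrite U_rec; apply: polar_sum => i.
  have [|q ->] := IHk (m.+1 - i.+1)%N; first by have := ltn_ord i; lia.
  by exists (c * lg i.+1 * l ^+ i * q); apply: polar_term.
exists ((m.+1%:R : C)^-1%:MP * p); apply: (mulfI (fracmp_char0 n C_char0 m)).
rewrite pE natK tofracM !mulrA -tofracM -mpolyCM divff ?C_char0 //.
by rewrite mpolyC1 tofrac1 mul1r.
Qed.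

Lemma numerators : exists Pn : nat -> P,
  numer_rec c l lg Pn /\ forall m, U m = (Pn m)%:F / (l ^+ m)%:F.
Proof.
have [Pn PnE] := boolp.choice U_polar; exists Pn; split=> //; split=> [|m].
  by have := PnE 0%N; rewrite U0 expr0 tofrac1 divr1 => /esym/eqP; rewrite -tofrac1 tofrac_eq => /eqP.
apply/eqP; rewrite -tofrac_eq; apply/eqP; apply: (mulIf (invr_neq0 (lF0 m))).
rewrite tofracM rmorph_nat -mulrA -PnE U_rec rmorph_sum mulr_suml.
by apply: eq_bigr => i _; rewrite PnE /= polar_term.
Qed.

End Numerators.

Section FpsumMorphism.
Variables (L L' : fieldType) (psi : {rmorphism L -> L'}).

Lemma tanprod_morph Bk Bl (g : int -> int -> L) :
  psi (tanprod Bk Bl g) = tanprod Bk Bl (fun u v => psi (g u v)).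
Proof.
rewrite /tanprod fmorph_div !rmorph_prod; congr (_ / _).
apply: eq_bigr => a _; rewrite rmorph_prod; apply: eq_bigr => b _ /=.
by rewrite fmorph_div !rmorphM.
Qed.

Lemma fpsum_morph N r (l1 l2 : L) (m : 'I_N -> L) (w : 'I_r -> L) D :
  psi (fpsum l1 l2 m w D)
  = fpsum (psi l1) (psi l2) (fun k => psi (m k)) (fun j => psi (w j)) D.
Proof.
rewrite /fpsum rmorph_sum; apply: eq_bigr => pi _; rewrite /fpterm.
case: ifP => _; last exact: rmorph0.
rewrite fmorph_div fmorphV; congr (_^-1 / _); rewrite rmorph_prod; apply: eq_bigr => k _.
  rewrite rmorph_prod; apply: eq_bigr => j _; rewrite rmorph_prod; apply: eq_bigr => b _.
  by rewrite !(rmorphD, rmorphN, rmorphMn) rmorph1.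
rewrite rmorph_prod; apply: eq_bigr => l _; rewrite tanprod_morph.
apply: eq_tanprod => u v; rewrite /fpweight; case: ifP => _; first exact: rmorph1.
by rewrite !(rmorphD, rmorphN, rmorphMz).
Qed.

End FpsumMorphism.

Lemma eq_fpsum (L : fieldType) N r (l1 l1' l2 l2' : L) (m m' : 'I_N -> L) (w w' : 'I_r -> L) d :
  l1 = l1' -> l2 = l2' -> m =1 m' -> w =1 w' ->
  fpsum l1 l2 m w d = fpsum l1' l2' m' w' d.
Proof. by move=> -> -> /boolp.funext -> /boolp.funext ->. Qed.

Section UniversalNumerators.
Variables (C : fieldType) (N r : nat).
Hypothesis C_char0 : forall k, k.+1%:R != 0 :> C.
Local Notation n := (2 + N + (r + 0))%N.
Local Notation P := {mpoly C[n]}.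
Local Notation K := {fraction P}.
Variables (A : seq nat -> seq nat -> seq nat -> fps C).
Hypothesis hA : universal_series N r A.
Local Notation av := (@av N r).
Local Notation ay := (@ay N r).
Local Notation a1 := (@a1 N r).
Local Notation a2 := (@a2 N r).

Let c : P := 'X_a1 + 'X_a2.
Let l : P := 'X_a1 * 'X_a2.
Local Notation V := (alpha_class N r 0).
Local Notation E := (bundle (y_ : 'I_N -> wt n)).

Let l_neq0 : l != 0.
Proof. by rewrite mulf_neq0 ?mpolyX_neq0. Qed.

Let univ_numerators D : exists Pn : nat -> P,
  numer_rec c l (@ulog C N r A D) Pn
  /\ forall m, univ_prod A V E D m = (Pn m)%:F / (l ^+ m)%:F.
Proof.
have [U0 U_log] := univ_prod_logder N r C_char0 hA.1 D.
apply: numerators => // m; apply: (logder_rec m U_log).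
rewrite /ulog big1 ?mulr0 ?tofrac0 ?mul0r // => mu _; rewrite big1 // => nu _.
by rewrite big1 // => xi _; rewrite ldf0 scale0r.
Qed.

Let l_hom m : l ^+ m \is (2 * m)%N.-homog.
Proof. exact/dhomogMn/mpolyXX_dhomog. Qed.

(** The universal product stabilizes separately in each degree. Uniformity holds
    because parts of degree below - 2 m vanish on both sides, which leaves
    finitely many degrees up to the bound. *)
Lemma segre_numerators (M : nat) (B : int) : exists lg Pn : nat -> P,
  [/\ numer_rec c l lg Pn,
      forall i, hc 1 (lg i)
        = ldf (A [:: 1%N] [::] [::]) i *: (\sum_j 'X_(av j))
          + ldf (A [::] [:: 1%N] [::]) i *: c
          + ldf (A [::] [::] [:: 1%N]) i *: (\sum_k 'X_(ay k))
    & forall m, (m <= M)%N -> forall d : int, (d <= B)%R ->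
        degpart d (segre_series C y_ V m) = degpart d ((Pn m)%:F / (l ^+ m)%:F)].
Proof.
have [D0 D0_univ] : exists D0, forall D, (D0 <= D)%N -> forall m, (m < M.+1)%N ->
    forall d : int, (d <= B)%R ->
    degpart d (segre_series C y_ V m) = degpart d (univ_prod A V E D m).
  apply: eventually_all => m.
  have [B1 low1] := degpart_bounded (segre_series C y_ V m).
  pose B0 := Num.min B1 (- (2 * m)%N%:Z).
  have [D0 D0_range] := @eventually_all (`|B - B0|.+1)%N (fun j D =>
      degpart (B0 + j%:Z) (segre_series C y_ V m)
      = degpart (B0 + j%:Z) (univ_prod A V E D m))
    (fun j => hA.2 r 0%N (esym (addn0 r)) m (B0 + j%:Z)).
  exists D0 => D D0_D d d_B; have [d_B0|B0_d] := ltP d B0.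
    have [Pn [_ ->]] := univ_numerators D.
    rewrite low1; last by lia.
    rewrite (degpart_homog C_char0 _ _ (expf_neq0 _ l_neq0) (l_hom m)).
    have : d + (2 * m)%N%:Z < 0 by lia.
    by case: (d + _) => // e _; rewrite /= tofrac0 mul0r.
  have -> : d = B0 + `|d - B0|%N%:Z by lia.
  by apply: D0_range => //; lia.
pose D := maxn D0 1; have [Pn [Pn_rec PnE]] := univ_numerators D.
exists (@ulog C N r A D), Pn; split; [exact: Pn_rec | move=> i | move=> m m_M d d_B].
  by rewrite hc1_ulog // leq_maxr.
by rewrite -PnE; apply: D0_univ => //; apply: leq_maxl.
Qed.

End UniversalNumerators.

Section Renaming.
Variables (C : fieldType) (N r : nat).
Hypothesis C_char0 : forall k, k.+1%:R != 0 :> C.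
Local Notation n1 := (2 + N + (r + 0))%N.
Variables (A : seq nat -> seq nat -> seq nat -> fps C).
Hypothesis hA : universal_series N r A.

Variables (n : nat) (g : 'I_n1 -> 'I_n) (g' : 'I_n -> 'I_n1).
Hypothesis gK : cancel g g'.
Local Notation P := {mpoly C[n]}.
Local Notation K := {fraction P}.
Variables (i1 i2 : 'I_n) (iy : 'I_N -> 'I_n) (iv : 'I_r -> 'I_n).
Hypotheses (g1 : g (a1 N r) = i1) (g2 : g (a2 N r) = i2).
Hypotheses (gy : forall k, g (ay r k) = iy k) (gv : forall j, g (av N j) = iv j).

Let h (i : 'I_n1) : P := 'X_(g i).
Let h_lin i : h i \is 1.-homog.
Proof. exact: mpolyX_dhomog. Qed.
Let phi_inj : injective (lsub h) := can_inj (lsub_rename_cancel gK).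
Local Notation phi := (lsub h).
Local Notation rho := (fracmap phi_inj).

Local Notation c := ('X_i1 + 'X_i2 : P).
Local Notation l := ('X_i1 * 'X_i2 : P).

Lemma ay_inj : injective (@ay N r).
Proof. by move=> k k' /lshift_inj /rshift_inj. Qed.

Lemma ay_t k : (@ay N r k != a1 N r) && (@ay N r k != a2 N r).
Proof. by rewrite -!val_eqE /= !inordK. Qed.

Local Notation side_sum :=
  (fpsum ('X_i1)%:F ('X_i2)%:F (fun k => ('X_(iy k))%:F) (fun j => ('X_(iv j))%:F)).

Let rhoX i : rho ('X_i)%:F = ('X_(g i))%:F.
Proof. by rewrite fracmap_tofrac /= lsubX. Qed.

Let side_sumE m : side_sum m = rho (segre_series C y_ (alpha_class N r 0) m).
Proof.
have -> : alpha_class N r 0 = bundle (fun j : 'I_r => delta_mx 0 (av N j)) :> vchar n1.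
  by rewrite /alpha_class [X in _ - X]big_ord0 subr0.
rewrite -[y_]/(fun k : 'I_N => delta_mx 0 (ay r k)).
rewrite (segre_seriesE C_char0 (p := N) (q := (r + 0)%N) (@av N r) ay_inj ay_t).
apply/esym; apply: etrans (fpsum_morph rho _ _ _ _ _) _.
apply: eq_fpsum => [|||].
- by apply: etrans (rhoX _) _; rewrite -g1.
- by apply: etrans (rhoX _) _; rewrite -g2.
- by move=> k; apply: etrans (rhoX _) _; rewrite gy.
- by move=> j; apply: etrans (rhoX _) _; rewrite gv.
Qed.

(** The variables are renamed by g, so that the series for (E, V) and for (V, E)
    may be compared in one ring. *)
Lemma fpsum_numerators (M : nat) (B : int) : exists lg Pn : nat -> P,
  [/\ numer_rec c l lg Pn,
      forall i, hc 1 (lg i)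
        = ldf (A [:: 1%N] [::] [::]) i *: (\sum_j 'X_(iv j))
          + ldf (A [::] [:: 1%N] [::]) i *: c
          + ldf (A [::] [::] [:: 1%N]) i *: (\sum_k 'X_(iy k))
    & forall m, (m <= M)%N -> forall d : int, (d <= B)%R ->
        degpart d (side_sum m) = degpart d ((Pn m)%:F / (l ^+ m)%:F)].
Proof.
have phi_c : phi ('X_(a1 N r) + 'X_(a2 N r)) = c by rewrite rmorphD /= !lsubX /h g1 g2.
have phi_l : phi ('X_(a1 N r) * 'X_(a2 N r)) = l by rewrite rmorphM /= !lsubX /h g1 g2.
have [lg [Pn [Pn_rec lg1 PnE]]] := segre_numerators C_char0 hA M B.
exists (phi \o lg), (phi \o Pn); split=> [|i|m m_M d d_B].
- by rewrite -phi_c -phi_l; apply: numer_rec_morph.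
- rewrite /= (hc_lsub h_lin) lg1 -!mul_mpolyC !rmorphD /= !rmorphM /= !lsubC phi_c !rmorph_sum /=.
  congr (_ * _ + _ + _ * _); apply: eq_bigr => k _; rewrite lsubX /h ?gv ?gy //.
rewrite /= side_sumE (degpart_fracmap h_lin C_char0 phi_inj) (PnE m m_M d d_B).
rewrite -(degpart_fracmap h_lin C_char0 phi_inj); congr (degpart d _).
have l0 : ('X_(a1 N r) * 'X_(a2 N r)) ^+ m != 0 :> {mpoly C[n1]}.
  rewrite expf_neq0 // -(inj_eq phi_inj) rmorph0 phi_l.
  by rewrite mulf_neq0 ?mpolyX_neq0.
rewrite (fracmap_div phi_inj _ l0) -[in RHS]phi_l -[in RHS](rmorphXn phi).
by [].
Qed.

End Renaming.

(** * Comparison of the two series *)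

Section NumeratorComparison.
Variables (C : fieldType) (n : nat).
Hypothesis C_char0 : forall k, k.+1%:R != 0 :> C.
Local Notation P := {mpoly C[n]}.
Implicit Types p q : P.

Definition vanish_to (E : nat) p := forall e, (e <= E)%N -> hc e p = 0.

Lemma vanish_toD E p q : vanish_to E p -> vanish_to E q -> vanish_to E (p + q).
Proof. by move=> p0 q0 e e_E; rewrite raddfD /= p0 // q0 // addr0. Qed.

Lemma vanish_toM E p q : vanish_to E p -> vanish_to E (p * q).
Proof.
move=> p0 e e_E; rewrite hcM big1 // => i _; rewrite p0 ?mul0r //.
by have := ltn_ord i; lia.
Qed.

Lemma vanish_toMl E p q : vanish_to E q -> vanish_to E (p * q).
Proof. by rewrite mulrC; apply: vanish_toM. Qed.

Lemma vanish_to_sum E (I : Type) (s : seq I) (F : I -> P) :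
  (forall i, vanish_to E (F i)) -> vanish_to E (\sum_(i <- s) F i).
Proof.
move=> F0; elim/big_rec: _ => [e _|i p _]; first exact: raddf0.
exact: vanish_toD.
Qed.

Variables (c l : P).
Hypotheses (c_hom : c \is 1.-homog) (l_hom : l \is 2.-homog).

Variables (L1 L2 P1 P2 : nat -> P).
Hypotheses (rec1 : numer_rec c l L1 P1) (rec2 : numer_rec c l L2 P2).

Let cl_hom m : c * l ^+ m \is (2 * m).+1.-homog.
Proof. by rewrite -add1n; apply: dhomogM => //; apply: dhomogMn. Qed.

Let numer_div lg Pn m : numer_rec c l lg Pn -> exists R, Pn m.+1 = c * R.
Proof.
case=> _ Pn_rec; exists ((m.+1%:R^-1)%:MP * \sum_(i < m.+1) lg i.+1 * l ^+ i * Pn (m.+1 - i.+1)%N).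
have -> : Pn m.+1 = (m.+1%:R^-1)%:MP * (m.+1%:R * Pn m.+1).
  by rewrite mulrA -(rmorph_nat (@mpolyC n C)) -mpolyCM mulVf ?C_char0 // mpolyC1 mul1r.
by rewrite Pn_rec [RHS]mulrCA; congr (_ * _); rewrite mulr_sumr; apply: eq_bigr => i _; rewrite !mulrA.
Qed.

(** Each P_j with j > 0 is divisible by c, so that in the recursion all summands but
    c l^m L are divisible by c^2. The part of degree 2 (m + 1) of c l^m L only
    involves the linear part of L. *)
Lemma numer_middle m : hc 1 (L1 m.+1) = hc 1 (L2 m.+1) ->
  exists2 G, G \is (2 * m).-homog & hc (2 * m.+1) (P1 m.+1 - P2 m.+1) = c ^+ 2 * G.
Proof.
move=> L12.
have [R1 R1E] := boolp.choice (fun m => numer_div m rec1).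
have [R2 R2E] := boolp.choice (fun m => numer_div m rec2).
pose H := \sum_(i < m) (L1 i.+1 * l ^+ i * R1 (m - i.+1)%N - L2 i.+1 * l ^+ i * R2 (m - i.+1)%N).
exists ((m.+1%:R^-1)%:MP * hc (2 * m) H); first by rewrite mul_mpolyC; apply/dhomogZ/pihomogP.
have -> : P1 m.+1 - P2 m.+1 = (m.+1%:R^-1)%:MP * (m.+1%:R * (P1 m.+1 - P2 m.+1)).
  by rewrite mulrA -(rmorph_nat (@mpolyC n C)) -mpolyCM mulVf ?C_char0 // mpolyC1 mul1r.
rewrite mul_mpolyC linearZ /= -mul_mpolyC [RHS]mulrCA; congr (_ * _).
have -> : m.+1%:R * (P1 m.+1 - P2 m.+1)
    = c * l ^+ m * (L1 m.+1 - L2 m.+1) + c ^+ 2 * H.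
  rewrite [m.+1%:R * (_ - _)]mulrBr rec1.2 rec2.2 !big_ord_recr /= subnn rec1.1 rec2.1 !mulr1 /H mulr_sumr.
  rewrite opprD addrACA -sumrB addrC; congr (_ + _); first by ring.
  apply: eq_bigr => i _.
  have -> : (m.+1 - i.+1 = (m - i.+1).+1)%N by have := ltn_ord i; lia.
  by rewrite R1E R2E; ring.
rewrite raddfD /= (hcM_dhomog _ _ (cl_hom m)) ifT; last by lia.
rewrite (_ : 2 * m.+1 - _ = 1)%N; last by lia.
rewrite raddfB /= L12 subrr mulr0 add0r.
have c2 : c ^+ 2 \is 2.-homog by have := dhomogMn 2 c_hom; rewrite mul1n.
by rewrite (hcM_dhomog _ _ c2) ifT; [congr (_ * hc _ _) |]; lia.
Qed.

Hypotheses (c_neq0 : c != 0) (l_neq0 : l != 0).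

Let cl_neq0 m : c * l ^+ m != 0.
Proof. by rewrite mulf_neq0 ?expf_neq0. Qed.

(** By induction, all summands of the two recursions agree in the given range
    except the last ones, c l^m L1 and c l^m L2, where c and l may be
    cancelled. *)
Lemma numer_cancel M : (forall m, (m <= M)%N -> vanish_to (2 * M) (P1 m - P2 m)) ->
  forall m, (m < M)%N -> hc 1 (L1 m.+1) = hc 1 (L2 m.+1).
Proof.
move=> P12 m m_M.
suff low : vanish_to (2 * M) (c * l ^+ m * (L1 m.+1 - L2 m.+1)).
  have /low : (2 * m.+1 <= 2 * M)%N by lia.
  rewrite (hcM_dhomog _ _ (cl_hom m)) ifT; last by lia.
  rewrite (_ : 2 * m.+1 - _ = 1)%N; last by lia.
  by move/eqP; rewrite mulf_eq0 (negPf (cl_neq0 m)) /= raddfB subr_eq0 => /eqP.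
have [k] := ubnP m; elim: k m m_M => // k IHk m m_M m_k.
have -> : c * l ^+ m * (L1 m.+1 - L2 m.+1) = m.+1%:R * (P1 m.+1 - P2 m.+1)
    + - \sum_(i < m) (c * l ^+ i * (L1 i.+1 - L2 i.+1) * P1 (m.+1 - i.+1)%N
        + c * L2 i.+1 * l ^+ i * (P1 (m.+1 - i.+1)%N - P2 (m.+1 - i.+1)%N)).
  rewrite [m.+1%:R * (_ - _)]mulrBr rec1.2 rec2.2 !big_ord_recr /= subnn rec1.1 rec2.1 !mulr1.
  rewrite [RHS](_ : _ = \sum_(i < m) c * L1 i.+1 * l ^+ i * P1 (m.+1 - i.+1)%N
    - \sum_(i < m) c * L2 i.+1 * l ^+ i * P2 (m.+1 - i.+1)%N - \sum_(i < m)
     (c * l ^+ i * (L1 i.+1 - L2 i.+1) * P1 (m.+1 - i.+1)%N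
        + c * L2 i.+1 * l ^+ i * (P1 (m.+1 - i.+1)%N - P2 (m.+1 - i.+1)%N))
      + (c * l ^+ m * (L1 m.+1 - L2 m.+1))); last first.
    by set u := \sum_(i < m) _; set v := \sum_(i < m) _; set w := \sum_(i < m) _; ring.
  rewrite -!sumrB big1 ?add0r // => i _; ring.
apply: vanish_toD; first by apply/vanish_toMl/P12.
rewrite -mulN1r; apply/vanish_toMl/vanish_to_sum => i; apply: vanish_toD.
  by apply/vanish_toM/IHk; have := ltn_ord i; lia.
by apply/vanish_toMl/P12; lia.
Qed.

End NumeratorComparison.

Section LogDerivative.
Variable K : fieldType.
Hypothesis K_char0 : forall k, k.+1%:R != 0 :> K.

Lemma logder_scale s (f l : fps K) : logder f l -> logder (fps_scale s f) (fps_scale s l).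
Proof.
move=> /fpsP fl; apply/fpsP => m; have := fl m; rewrite /euler_op /fps_scale !coef_fpsM.
rewrite mulrCA => ->.
rewrite mulr_sumr; apply: eq_bigr => i _.
have -> : s ^+ m = s ^+ i * s ^+ (m - i) by rewrite -exprD subnKC // -ltnS.
by ring.
Qed.

Lemma logder_inj (f g l k : fps K) : f 0%N = g 0%N -> logder f l -> logder g k ->
  l 0%N = 0 -> k 0%N = 0 -> (forall m, l m.+1 = k m.+1) -> f =1 g.
Proof.
move=> fg0 fl gk l0 k0 lk m; have [d] := ubnP m; elim: d m => // d IHd [//|m] m_d.
apply: (mulfI (K_char0 m)); rewrite (logder_rec _ fl l0) (logder_rec _ gk k0).
by apply: eq_bigr => i _; rewrite lk IHd //; lia.
Qed.

End LogDerivative.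

Section Symmetry.
Variables (C : fieldType) (n N r : nat).
Hypothesis C_char0 : forall k, k.+1%:R != 0 :> C.
Local Notation P := {mpoly C[n]}.
Local Notation K := {fraction P}.
Variables (i1 i2 : 'I_n) (iy : 'I_N -> 'I_n) (iv : 'I_r -> 'I_n).
Hypotheses (i12 : i1 != i2) (iy_inj : injective iy) (iv_inj : injective iv).
Hypotheses (iy_t : forall k, (iy k != i1) && (iy k != i2)).
Hypotheses (iv_t : forall j, (iv j != i1) && (iv j != i2)).
Hypotheses (iyv : forall k j, iy k != iv j).
Hypotheses (N_gt0 : (0 < N)%N) (r_gt0 : (0 < r)%N).

Local Notation X i := (('X_i : P)%:F).
Local Notation sumE := (fpsum (X i1) (X i2) (fun k => X (iy k)) (fun j => X (iv j))).
Local Notation sumV := (fpsum (X i1) (X i2) (fun j => X (iv j)) (fun k => X (iy k))).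
Local Notation c := ('X_i1 + 'X_i2 : P).
Local Notation l := ('X_i1 * 'X_i2 : P).
Local Notation sg := (@spec C n i1 i2).
Local Notation sE := (((-1) ^+ N : C)).
Local Notation sV := (((-1) ^+ r : C)).

Let l_neq0 : l != 0. Proof. by rewrite mulf_neq0 ?mpolyX_neq0. Qed.

Let hcz_spec d (p : P) : hcz d (sg p) = sg (hcz d p).
Proof. exact/hcz_lsub/spec_var_lin. Qed.

(** The difference of the two series is a fraction p / q whose numerator vanishes
    on the line while q does not. In low degrees its product with q l^D agrees
    with q times the difference of the numerators; hence the latter vanishes on
    the line, up to the loss of degree in cancelling q. *)
Lemma specialized_numerators D (e0 : nat) : exists E0, forall E, (E0 <= E)%N ->
  forall Q1 Q2 : P,
    (forall d : int, (d <= E%:Z)%R -> degpart d (sumE D) = degpart d (Q1%:F / (l ^+ D)%:F)) ->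
    (forall d : int, (d <= E%:Z)%R -> degpart d (sumV D) = degpart d (Q2%:F / (l ^+ D)%:F)) ->
  vanish_to e0 (sg ((sE ^+ D)%:MP * Q1 - (sV ^+ D)%:MP * Q2)).
Proof.
have := fpsum_symmetry C_char0 i12 iy_inj iv_inj iy_t iv_t N_gt0 r_gt0 D.
rewrite !exprM; set a := sE ^+ D; set b := sV ^+ D.
case=> p [q [q0 fE]] /esym/eqP; rewrite mulf_eq0 invr_eq0 !tofrac_eq0 (negPf q0) orbF => /eqP p0.
have q_neq0 : q != 0 by apply: contraNneq q0 => ->; rewrite rmorph0.
have lD_neq0 : l ^+ D != 0 by rewrite expf_neq0.
have [o uniq_o] := lconv_eq0 q0; exists (e0 + o)%N => E E_ge Q1 Q2 Q1E Q2E.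
set S := a%:MP * Q1 - b%:MP * Q2.
have low (d : int) : (d <= E%:Z)%R -> degpart d ((p * l ^+ D - q * S)%:F / (q * l ^+ D)%:F) = 0.
  move=> d_E; have -> : (p * l ^+ D - q * S)%:F / (q * l ^+ D)%:F
     = (1%:MP)%:F * (p%:F / q%:F) - (1%:MP)%:F * (S%:F / (l ^+ D)%:F) :> K.
    rewrite mpolyC1 tofrac1 !mul1r -[in RHS]mulNr addf_div ?tofrac_eq0 //.
    by rewrite -!tofracN -!tofracM -tofracD [q * S]mulrC mulNr.
  rewrite (degpart_lin C_char0) mpolyC1 tofrac1 !mul1r -fE (degpart_lin C_char0).
  rewrite (Q1E d d_E) (Q2E d d_E) -(degpart_lin C_char0) /S tofracB mulrBl !tofracM !mulrA.
  by rewrite subrr.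
have ql_neq0 : q * l ^+ D != 0 by rewrite mulf_neq0.
have spec0 (e : int) : (e <= E%:Z)%R -> hcz e (sg q * sg S) = 0.
  move=> e_E; have := degpart_low_numer C_char0 ql_neq0 low e_E.
  move=> /(congr1 sg); rewrite -hcz_spec rmorphB !rmorphM /= p0 mul0r sub0r rmorph0.
  by case: e {e_E} => e //=; rewrite raddfN => /eqP; rewrite oppr_eq0 => /eqP.
move=> e e_e0; apply/eqP; rewrite -tofrac_eq0 -/(hcz (Posz e) _); apply/eqP.
apply: (uniq_o (fun d => (hcz d (sg S))%:F) E%:Z); first exact: hcz_bounded.
  by move=> d d_E; rewrite -hczM spec0 ?tofrac0.
by lia.
Qed.

Variables (AE AV : seq nat -> seq nat -> seq nat -> fps C).
Local Notation aE := (ldf (AE [:: 1%N] [::] [::])).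
Local Notation bE := (ldf (AE [::] [:: 1%N] [::])).
Local Notation dE := (ldf (AE [::] [::] [:: 1%N])).
Local Notation aV := (ldf (AV [:: 1%N] [::] [::])).
Local Notation bV := (ldf (AV [::] [:: 1%N] [::])).
Local Notation dV := (ldf (AV [::] [::] [:: 1%N])).
Local Notation sumXv := (\sum_j 'X_(iv j) : P).
Local Notation sumXy := (\sum_k 'X_(iy k) : P).

Hypothesis numE : forall (M : nat) (B : int), exists lg Pn : nat -> P,
  [/\ numer_rec c l lg Pn,
      forall i, hc 1 (lg i) = aE i *: sumXv + bE i *: c + dE i *: sumXy
    & forall m, (m <= M)%N -> forall d : int, (d <= B)%R ->
        degpart d (sumE m) = degpart d ((Pn m)%:F / (l ^+ m)%:F)].
Hypothesis numV : forall (M : nat) (B : int), exists lg Pn : nat -> P,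
  [/\ numer_rec c l lg Pn,
      forall i, hc 1 (lg i) = aV i *: sumXy + bV i *: c + dV i *: sumXv
    & forall m, (m <= M)%N -> forall d : int, (d <= B)%R ->
        degpart d (sumV m) = degpart d ((Pn m)%:F / (l ^+ m)%:F)].

Let spec_c : sg c = - 'X_i1.
Proof. by rewrite rmorphD /= spec_i1 // spec_i2; ring. Qed.

Let spec_l : sg l = - ('X_i1 * 'X_i1) *+ 2.
Proof. by rewrite rmorphM /= spec_i1 // spec_i2; ring. Qed.

Let eval_spec (s a b d : C) (p : P) m i :
  hc 1 p = a *: sumXv + b *: c + d *: sumXy ->
  (hc 1 (sg (s%:MP ^+ m * p))).@[fun i' => (i' == i)%:R]
  = s ^+ m * (a * (\sum_j (iv j == i)%:R) - b * (i1 == i)%:R + d * (\sum_k (iy k == i)%:R)).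
Proof.
move=> pE; have sC (x : C) q : sg (x%:MP * q) = x%:MP * sg q.
  by rewrite rmorphM; congr (_ * _); apply: lsubC.
have -> : hc 1 (sg (s%:MP ^+ m * p)) = (s ^+ m)%:MP * sg (hc 1 p).
  rewrite -(rmorphXn (@mpolyC n C)) sC mul_mpolyC linearZ /= -mul_mpolyC.
  by rewrite hc_lsub //; apply: spec_var_lin.
rewrite pE -!mul_mpolyC.
rewrite 2!(rmorphD sg) /= !sC spec_c !(rmorph_sum sg) /=.
have -> : \sum_j sg 'X_(iv j) = sumXv by apply: eq_bigr => j _; apply: spec_iv.
have -> : \sum_k sg 'X_(iy k) = sumXy by apply: eq_bigr => k _; apply: spec_iy.
have evX (I : finType) (f : I -> 'I_n) :
    (\sum_j 'X_(f j) : P).@[fun i' => (i' == i)%:R] = \sum_j (f j == i)%:R.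
  by rewrite raddf_sum; apply: eq_bigr => j _; apply: mevalXU.
by rewrite !(rmorphM, rmorphD, rmorphN) /= !mevalC !evX mevalXU mulrN.
Qed.

(** On the line the sums of the w_j and of the m_k and c = - lambda_1 are linearly
    independent: a coefficient is isolated by evaluating at a point where only
    one w_j, one m_k or lambda_1 is nonzero. *)
Lemma logder_symmetry m :
  [/\ sE ^+ m.+1 * aE m.+1 = sV ^+ m.+1 * dV m.+1,
      sE ^+ m.+1 * bE m.+1 = sV ^+ m.+1 * bV m.+1
    & sE ^+ m.+1 * dE m.+1 = sV ^+ m.+1 * aV m.+1].
Proof.
have [E0 E0P] := @eventually_all m.+2 _ (fun D => specialized_numerators D (2 * m.+1)).
have [lg1 [P1 [rec1 lg1E P1E]]] := numE m.+1 E0%:Z.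
have [lg2 [P2 [rec2 lg2E P2E]]] := numV m.+1 E0%:Z.
have := numer_rec_morph sg (numer_rec_scale (sE%:MP) rec1).
have := numer_rec_morph sg (numer_rec_scale (sV%:MP) rec2).
move=> rec2' rec1'.
have c_hom : sg c \is 1.-homog.
  by rewrite spec_c rpredN mpolyX_dhomog.
have l_hom : sg l \is 2.-homog.
  by rewrite spec_l rpredMn // rpredN mpolyXX_dhomog.
have c0 : sg c != 0 by rewrite spec_c oppr_eq0 mpolyX_neq0.
have l0 : sg l != 0.
  rewrite rmorphM mulf_neq0 /= ?spec_i1 ?spec_i2 ?oppr_eq0 ?mpolyX_neq0 //.
  by rewrite -mulr_natl -(rmorph_nat (@mpolyC n C)) mulf_neq0 ?mpolyX_neq0 // mpolyC_eq0 C_char0.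
have L12 : hc 1 (sg (sE%:MP ^+ m.+1 * lg1 m.+1)) = hc 1 (sg (sV%:MP ^+ m.+1 * lg2 m.+1)).
  apply: (numer_cancel c_hom l_hom rec1' rec2' c0 l0 (M := m.+1)) => [k k_m|]; last exact: leqnn.
  rewrite /= -rmorphB -!(rmorphXn (@mpolyC n C)).
  exact: (E0P E0 (leqnn _) k k_m (P1 k) (P2 k) (P1E k k_m) (P2E k k_m)).
have ev i := congr1 (meval (fun i' => (i' == i)%:R)) L12.
have {}ev i : sE ^+ m.+1 * (aE m.+1 * (\sum_j (iv j == i)%:R) - bE m.+1 * (i1 == i)%:R
      + dE m.+1 * (\sum_k (iy k == i)%:R))
    = sV ^+ m.+1 * (dV m.+1 * (\sum_j (iv j == i)%:R) - bV m.+1 * (i1 == i)%:R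
      + aV m.+1 * (\sum_k (iy k == i)%:R)).
  rewrite -(eval_spec _ _ _ (lg1E _)) ev; apply: eval_spec.
  by rewrite lg2E addrC -[RHS]addrA; congr (_ + _); apply: addrC.
have sum1 (M : nat) (f : 'I_M -> 'I_n) i0 : injective f -> \sum_i (f i == f i0)%:R = 1 :> C.
  move=> f_inj; rewrite (bigD1 i0) //= eqxx big1 ?addr0 // => i.
  by rewrite (inj_eq f_inj) => /negPf ->.
have sum0 (M : nat) (f : 'I_M -> 'I_n) i0 : (forall i, f i != i0) -> \sum_i (f i == i0)%:R = 0 :> C.
  by move=> f_i0; rewrite big1 // => i _; rewrite (negPf (f_i0 i)).
have t1y k : (i1 == iy k) = false by have /andP[/negPf + _] := iy_t k; rewrite eq_sym.
have t1v j : (i1 == iv j) = false by have /andP[/negPf + _] := iv_t j; rewrite eq_sym.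
split.
- have := ev (iv (Ordinal r_gt0)); rewrite !sum1 // t1v !sum0 => [|k]; last exact: iyv.
  by rewrite !mulr1 !mulr0 !subr0 !addr0.
- have := ev i1; rewrite eqxx !sum0 => [|k|j].
  + by rewrite !mulr0 !mulr1 !sub0r !addr0 !mulrN => /oppr_inj.
  + by rewrite eq_sym t1y.
  + by rewrite eq_sym t1v.
have := ev (iy (Ordinal N_gt0)); rewrite !sum1 // t1y !sum0 => [|k]; last by rewrite eq_sym iyv.
by rewrite !mulr1 !mulr0 !subr0 !add0r.
Qed.

Let degpart0_numer m (p : P) : degpart 0 (p%:F / (l ^+ m)%:F) = (hc (2 * m) p)%:F / (l ^+ m)%:F :> K.
Proof.
have l_hom : l ^+ m \is (2 * m)%N.-homog by apply/dhomogMn/mpolyXX_dhomog.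
by rewrite (degpart_homog C_char0 p 0 (expf_neq0 m l_neq0) l_hom) add0r.
Qed.

Lemma degpart0_initial : degpart 0 (sumE 0) = degpart 0 (sumV 0).
Proof.
have [_ [P1 [[P10 _] _ P1E]]] := numE 0 0; have [_ [P2 [[P20 _] _ P2E]]] := numV 0 0.
by rewrite (P1E 0%N (leqnn _) 0 (lexx _)) (P2E 0%N (leqnn _) 0 (lexx _)) P10 P20.
Qed.

(** The linear parts of the logarithmic derivatives agree by logder_symmetry, so
    that numer_middle applies. *)
Lemma degpart0_difference m : exists2 G : P, G \is (2 * m).-homog
  & ((sE ^+ m.+1)%:MP)%:F * degpart 0 (sumE m.+1) - ((sV ^+ m.+1)%:MP)%:F * degpart 0 (sumV m.+1)
    = (c ^+ 2 * G)%:F / (l ^+ m.+1)%:F.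
Proof.
have [lg1 [P1 [rec1 lg1E P1E]]] := numE m.+1 0; have [lg2 [P2 [rec2 lg2E P2E]]] := numV m.+1 0.
have c_hom : c \is 1.-homog by apply: rpredD; apply: mpolyX_dhomog.
have l_hom : l \is 2.-homog by apply: mpolyXX_dhomog.
have hcC d (a : C) p : hc d (a%:MP * p) = a%:MP * hc d p by rewrite mul_mpolyC linearZ /= -mul_mpolyC.
have [abE1 abE2 abE3] := logder_symmetry m.
have L12 : hc 1 ((sE%:MP) ^+ m.+1 * lg1 m.+1) = hc 1 ((sV%:MP) ^+ m.+1 * lg2 m.+1).
  rewrite -!(rmorphXn (@mpolyC n C)) !hcC lg1E lg2E -!mul_mpolyC !mulrDr !mulrA -!mpolyCM.
  by rewrite abE1 abE2 abE3 [RHS]addrC -[LHS]addrA; congr (_ + _); apply: addrC.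
have [G G_hom GE] := numer_middle C_char0 c_hom l_hom
  (numer_rec_scale (sE%:MP) rec1) (numer_rec_scale (sV%:MP) rec2) L12.
exists G => //; rewrite -GE (P1E _ (leqnn _) 0 (lexx _)) (P2E _ (leqnn _) 0 (lexx _)).
rewrite !degpart0_numer -!(rmorphXn (@mpolyC n C)) raddfB /= !hcC.
by rewrite tofracB mulrBl !tofracM !mulrA.
Qed.

End Symmetry.

Section Exchange.
Variables (C : fieldType) (N r : nat).
Hypothesis C_char0 : forall k, k.+1%:R != 0 :> C.
Hypotheses (N_gt0 : (0 < N)%N) (r_gt0 : (0 < r)%N).
Variable (A : nat -> nat -> seq nat -> seq nat -> seq nat -> fps C).
Hypothesis hE : universal_series N r (A N r).
Hypothesis hV : universal_series r N (A r N).
Local Notation n := (2 + N + r)%N.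
Local Notation P := {mpoly C[n]}.
Local Notation K := {fraction P}.

Let i1 : 'I_n := it1 N r.
Let i2 : 'I_n := it2 N r.
Let iy (k : 'I_N) : 'I_n := lshift r (rshift 2 k).
Let iv (j : 'I_r) : 'I_n := rshift (2 + N) j.

Let i12 : i1 != i2. Proof. by rewrite -val_eqE /= !inordK. Qed.
Let iy_inj : injective iy. Proof. by move=> k k' /lshift_inj /rshift_inj. Qed.
Let iv_inj : injective iv. Proof. by move=> j j' /rshift_inj. Qed.
Let iy_t k : (iy k != i1) && (iy k != i2).
Proof. by rewrite -!val_eqE /= !inordK. Qed.
Let iv_t j : (iv j != i1) && (iv j != i2).
Proof. by rewrite -!val_eqE /= !inordK. Qed.
Let iyv k j : iy k != iv j.
Proof. by rewrite -val_eqE /= neq_ltn; have := ltn_ord k; lia. Qed.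

Local Notation sumE := (fpsum ('X_i1)%:F ('X_i2)%:F (fun k => ('X_(iy k) : P)%:F) (fun j => ('X_(iv j) : P)%:F)).
Local Notation sumV := (fpsum ('X_i1)%:F ('X_i2)%:F (fun j => ('X_(iv j) : P)%:F) (fun k => ('X_(iy k) : P)%:F)).

Let rename_eq : (2 + N + (r + 0) = n)%N. Proof. by rewrite addn0. Qed.

Let keep1 : cast_ord rename_eq (a1 N r) = i1. Proof. exact: val_inj. Qed.
Let keep2 : cast_ord rename_eq (a2 N r) = i2. Proof. exact: val_inj. Qed.
Let keepy k : cast_ord rename_eq (ay r k) = iy k. Proof. exact: val_inj. Qed.
Let keepv j : cast_ord rename_eq (av N j) = iv j. Proof. exact: val_inj. Qed.

Let numE := fpsum_numerators C_char0 hE (cast_ordK rename_eq) keep1 keep2 keepy keepv.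

(** Exchanges the blocks of variables of lengths r and N, which follow t_1, t_2. *)
Definition swapn (r N i : nat) : nat :=
  if (i < 2)%N then i else if (i < 2 + r)%N then (i + N)%N else (i - r)%N.

Fact swapn_lt (i : 'I_(2 + r + (N + 0))) : (swapn r N i < n)%N.
Proof. by have := ltn_ord i; rewrite /swapn; repeat case: ifP => ? /=; lia. Qed.
Fact swapn_lt' (i : 'I_n) : (swapn N r i < 2 + r + (N + 0))%N.
Proof. by have := ltn_ord i; rewrite /swapn; repeat case: ifP => ? /=; lia. Qed.

Fact swapnK : cancel (fun i => Ordinal (swapn_lt i)) (fun i => Ordinal (swapn_lt' i)).
Proof.
move=> i; apply: val_inj; have := ltn_ord i; rewrite /= /swapn.
by have [i_2|i_2] := ltnP i 2; [|have [i_r|i_r] := ltnP i (2 + r)]; repeat case: ifP => ? /=; lia.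
Qed.

Let swap1 : Ordinal (swapn_lt (a1 r N)) = i1.
Proof. by apply: val_inj; rewrite /= /swapn /= inordK. Qed.
Let swap2 : Ordinal (swapn_lt (a2 r N)) = i2.
Proof. by apply: val_inj; rewrite /= /swapn /= inordK. Qed.
Let swapy j : Ordinal (swapn_lt (ay N j)) = iv j.
Proof. by apply: val_inj; rewrite /= /swapn /=; have := ltn_ord j; repeat case: ifP => ? /=; lia. Qed.
Let swapv k : Ordinal (swapn_lt (av r k)) = iy k.
Proof. by apply: val_inj; rewrite /= /swapn /=; have := ltn_ord k; repeat case: ifP => ? /=; lia. Qed.

Let numV := fpsum_numerators C_char0 hV swapnK swap1 swap2 swapy swapv.

Lemma leading_logder_symmetry m :
  [/\ ((-1) ^+ N) ^+ m.+1 * ldf (A N r [:: 1%N] [::] [::]) m.+1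
      = ((-1) ^+ r) ^+ m.+1 * ldf (A r N [::] [::] [:: 1%N]) m.+1,
      ((-1) ^+ N) ^+ m.+1 * ldf (A N r [::] [:: 1%N] [::]) m.+1
      = ((-1) ^+ r) ^+ m.+1 * ldf (A r N [::] [:: 1%N] [::]) m.+1
    & ((-1) ^+ N) ^+ m.+1 * ldf (A N r [::] [::] [:: 1%N]) m.+1
      = ((-1) ^+ r) ^+ m.+1 * ldf (A r N [:: 1%N] [::] [::]) m.+1].
Proof.
exact: (logder_symmetry C_char0 i12 iy_inj iv_inj iy_t iv_t iyv N_gt0 r_gt0 numE
  numV).
Qed.

Lemma series_exchange mu nu xi :
  (mu, nu, xi) \in [:: ([:: 1%N], [::], [::]); ([::], [:: 1%N], [::]); ([::], [::], [:: 1%N])] ->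
  fps_scale ((-1) ^+ N) (A N r mu nu xi) =1 fps_scale ((-1) ^+ r) (A r N xi nu mu).
Proof.
have scaled0 s (f : fps C) : f 0%N = 0 -> fps_scale s f 0%N = 0.
  by rewrite /fps_scale => ->; rewrite mulr0.
move=> mnx; have [muP nuP xiP] : [/\ is_part mu, is_part nu & is_part xi].
  by move: mnx; rewrite !inE => /or3P[] /eqP[-> -> ->].
have [A0 A'0] := (hE.1 mu nu xi muP nuP xiP, hV.1 xi nu mu xiP nuP muP).
apply: (logder_inj C_char0 _ (logder_scale _ (logder_ldf C_char0 A0))
  (logder_scale _ (logder_ldf C_char0 A'0)) (scaled0 _ _ (ldf0 _)) (scaled0 _ _ (ldf0 _))).
  by rewrite /fps_scale A0 A'0.
move=> m; rewrite /fps_scale; have [sym1 sym2 sym3] := leading_logder_symmetry m.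
by move: mnx; rewrite !inE => /or3P[] /eqP[-> -> ->].
Qed.

Lemma segre_E k : segre_series C (y_ : 'I_N -> wt n) (bundle v_) k = sumE k.
Proof. exact: (segre_seriesE C_char0 iv iy_inj iy_t). Qed.

Lemma segre_V k : segre_series C (v_ : 'I_r -> wt n) (bundle y_) k = sumV k.
Proof. exact: (segre_seriesE C_char0 iy iv_inj iv_t). Qed.

Lemma degree0_exchange : exists g : nat -> P,
  (forall k, (0 < k)%N -> g k \is (2 * k - 2)%N.-homog) /\
  forall k,
    fps_scale ((-1) ^+ N) (fun k => degpart 0 (segre_series C (y_ : 'I_N -> wt n) (bundle v_) k)) k
    - fps_scale ((-1) ^+ r) (fun k => degpart 0 (segre_series C v_ (bundle y_) k)) k
    = if k == 0%N then 0 else (g k)%:F / l12 ^ (k%:Z - 2) * int_S (chern C 1 tanS) ^+ 2.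
Proof.
have diff k := degpart0_difference C_char0 i12 iy_inj iv_inj iy_t iv_t iyv N_gt0 r_gt0 numE numV k.
have [G GP] := boolp.choice (fun k => let: ex_intro2 G G_hom GE := diff k in ex_intro _ G (conj G_hom GE)).
exists (fun k => G k.-1); split=> [[//|k] _|[|k]].
- by rewrite (_ : 2 * k.+1 - 2 = 2 * k)%N; [exact: (GP k).1 | lia].
- rewrite /fps_scale !expr0 !mul1r segre_E segre_V.
  apply/eqP; rewrite subr_eq0; apply/eqP.
  exact: (degpart0_initial numE numV).
rewrite /fps_scale segre_E segre_V /= /int_S chern1_tanS // /l12 /t1 /t2 !c1wt_delta.
have signE a : (((-1) ^+ a ^+ k.+1)%:MP)%:F = (-1) ^+ a ^+ k.+1 :> K.
  by rewrite !rmorphXn !rmorphN !rmorph1.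
rewrite -!signE; apply: etrans (GP k).2 _.
rewrite -/i1 -/i2; set l : P := 'X_i1 * 'X_i2; set c : P := 'X_i1 + 'X_i2.
have l0 : l%:F != 0 :> K.
  by rewrite tofrac_eq0 mulf_neq0 ?mpolyX_neq0.
rewrite (_ : l%:F ^ (k.+1%:Z - 2) = l%:F ^+ k.+1 / l%:F ^+ 2); last by rewrite expfzDr.
rewrite tofracM !rmorphXn /= expr_div_n invfM invrK.
have cross (L : fieldType) (u v w x : L) : v != 0 -> w * x * u = x * (u * v) * (w / v).
  by move=> v0; field.
by apply: cross; rewrite expf_neq0.
Qed.
End Exchange.

Theorem corollary1p13 (R : realType) (N r : nat) (hN : (0 < N)%N) (hr : (0 < r)%N)
  (A : nat -> nat -> seq nat -> seq nat -> seq nat -> fps (complex R))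
  (hA : universal_series N r (A N r))
  (hA' : universal_series r N (A r N)) :
  (forall mu nu xi : seq nat,
     (mu, nu, xi) \in [:: ([:: 1%N], [::], [::]);
                          ([::], [:: 1%N], [::]);
                          ([::], [::], [:: 1%N])] ->
     fps_scale ((-1) ^+ N) (A N r mu nu xi)
       =1 fps_scale ((-1) ^+ r) (A r N xi nu mu)) /\
  (exists g : nat -> {mpoly (complex R)[2 + N + r]},
     (forall n : nat, (0 < n)%N -> g n \is (2 * n - 2)%N.-homog) /\
     (forall n : nat,
        fps_scale ((-1) ^+ N)
          (fun k => degpart 0 (segre_series (complex R) y_ (bundle v_) k)) n
        - fps_scale ((-1) ^+ r)
          (fun k => degpart 0 (segre_series (complex R) v_ (bundle y_) k)) n
        = if n == 0%N then 0
          else tofrac (g n) / l12 ^ (n%:Z - 2)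
               * int_S (chern (complex R) 1 tanS) ^+ 2)).
Proof.
have C0 k : k.+1%:R != 0 :> complex R by rewrite pnatr_eq0.
split; first exact: (series_exchange C0 hN hr hA hA').
exact: (degree0_exchange C0 hN hr hA hA').
Qed.
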